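(* For each integer $n\ge 1$ and $m=n+3$, there is a uniquely optimal graph in $\mathcal{G}_{n,m}$, and this graph also uniquely maximizes the number of spanning trees in $\mathcal{G}_{n,m}$. This graph is a balanced weak subdivision of the complete bipartite graph $K_{3,3}$ (a subdivision, i.e. with all chain lengths positive, when $n\ge 6$), and it is specified up to isomorphism by the following additional conditions, where $m=9q+r$ with $q,r$ integers and $r\in\{-4,-3,\dots,4\}$ (so that, by balancedness, $9-|r|$ chains have length $q$ and the remaining $|r|$ chains all have length $q+1$ if $r>0$, respectively $q-1$ if $r<0$): \begin{itemize} \item If $r\in\{0,1,-1\}$, no further condition is needed. \item If $r\in\{\pm2,\pm3\}$, the $|r|$ longer (for positive $r$) or shorter (for negative $r$) chains correspond to a matching in $K_{3,3}$. \item If $r=4$, the four longer chains correspond to a path with 3 edges and a path with 1 edge, vertex-disjoint, in $K_{3,3}$. \item If $r=-4$, the four shorter chains correspond to two vertex-disjoint paths with 2 edges each in $K_{3,3}$. \end{itemize}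
   Context: Graphs are finite connected multigraphs (multiple edges and loops allowed), considered up to isomorphism. $\mathcal{G}_{n,m}$ is the set of connected graphs with $n$ vertices and $m$ edges. For $p\in(0,1)$, $R(G,p)$ is the probability that $G$ remains connected (on all its vertices) when each edge is independently retained with probability $p$ and deleted otherwise. $G\in\mathcal{G}_{n,m}$ is uniquely optimal if $R(G,p)>R(H,p)$ for all $p\in(0,1)$ and all other graphs $H\in\mathcal{G}_{n,m}$. A weak subdivision of a cubic graph $D$ is a graph obtained as follows: assign to each edge $e$ of $D$ a nonnegative integer weight $\ell(e)$ such that every cycle of $D$ has positive total weight; contract each edge of weight $0$ and replace each edge of weight $\ell\ge1$ by a path with $\ell$ edges. The resulting object replacing an edge is a chain (a zero chain if the weight is $0$), corresponding to that edge of $D$, and its length is the weight. The weak subdivision is balanced (relative to $D$) if any two chain lengths, including zero lengths, differ by at most one. *)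

(* Defs.v *)
From HB Require Import structures.
From mathcomp Require Import all_boot all_order all_algebra.
From mathcomp Require Import boolp reals.

Set Implicit Arguments.
Unset Strict Implicit.
Unset Printing Implicit Defensive.

Import Order.TTheory GRing.Theory Num.Theory.

(* Finite multigraphs with loops. The orientation given by src and tgt is a
   bookkeeping device: everything below is invariant under reversing edges. *)
Record mgraph := MGraph {
  vert : finType;
  edge : finType;
  src : edge -> vert;
  tgt : edge -> vert }.

Section Multigraphs.
Variable G : mgraph.
Implicit Types (A : {set edge G}) (x y : vert G).

Definition ends (e : edge G) : {set vert G} := [set src e; tgt e].

Definition adj A : rel (vert G) :=
  fun x y => [exists e in A, ends e == [set x; y]].

Definition connected_by A : bool := [forall x, forall y, connect (adj A) x y].

Definition component A x : {set vert G} := [set y | connect (adj A) x y].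

(* A dart is an edge with a direction of traversal (true: from tgt to src). *)
Definition dart : Type := (edge G * bool)%type.
Definition dsrc (d : dart) : vert G := if d.2 then tgt d.1 else src d.1.
Definition dtgt (d : dart) : vert G := if d.2 then src d.1 else tgt d.1.
Definition follows : rel dart := fun d d' => dtgt d == dsrc d'.

(* Requiring distinct edges excludes traversing one edge back and forth; a
   loop is a cycle of length 1, two parallel edges form a cycle of length 2. *)
Definition is_cycle (c : seq dart) : bool :=
  [&& 0 < size c, cycle follows c,
      uniq [seq dsrc d | d <- c] & uniq [seq d.1 | d <- c]].

(* Paths are taken with at least one edge. *)
Definition path_verts (c : seq dart) : seq (vert G) :=
  if c is d :: _ then dsrc d :: [seq dtgt d' | d' <- c] else [::].
Definition is_path (c : seq dart) : bool :=
  [&& 0 < size c, sorted follows c & uniq (path_verts c)].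

Definition acyclic A : Prop :=
  forall c, is_cycle c -> ~ {subset [seq d.1 | d <- c] <= A}.

Definition spanning_tree A : bool := connected_by A && `[< acyclic A >].

Definition num_spanning_trees : nat := #|[set A | spanning_tree A]|.

Definition matching A : Prop :=
  {in A &, forall e f, e != f -> [disjoint ends e & ends f]}.

Definition two_disjoint_paths (k1 k2 : nat) A : Prop :=
  exists c1 c2 : seq dart,
    [/\ is_path c1 /\ size c1 = k1,
        is_path c2 /\ size c2 = k2,
        [disjoint path_verts c1 & path_verts c2] &
        A = [set e in [seq d.1 | d <- c1 ++ c2]]].

Local Open Scope ring_scope.

Definition reliability (R : realType) (p : R) : R :=
  \sum_(A : {set edge G} | connected_by A) p ^+ #|A| * (1 - p) ^+ #|~: A|.

End Multigraphs.

Definition iso (G H : mgraph) : Prop :=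
  exists (f : vert G -> vert H) (g : edge G -> edge H),
    [/\ bijective f, bijective g & forall e, ends (g e) = f @: ends e].

Definition graph_class (n m : nat) (G : mgraph) : Prop :=
  [/\ #|vert G| = n, #|edge G| = m & connected_by [set: edge G]].

Definition uniquely_optimal (R : realType) (n m : nat) (G : mgraph) : Prop :=
  graph_class n m G /\
  forall H, graph_class n m H -> ~ iso H G ->
  forall p : R, (0 < p < 1)%R -> (reliability H p < reliability G p)%R.

Definition uniquely_max_spanning_trees (n m : nat) (G : mgraph) : Prop :=
  graph_class n m G /\
  forall H, graph_class n m H -> ~ iso H G ->
  num_spanning_trees H < num_spanning_trees G.

Section WeakSubdivision.
Variables (D : mgraph) (l : edge D -> nat).

Definition admissible : Prop :=
  forall c : seq (dart D), is_cycle c -> 0 < \sum_(d <- c) l d.1.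

Definition balanced : Prop := forall e f, l e <= (l f).+1.

Definition zero_edges : {set edge D} := [set e | l e == 0].

(* Vertices of the contraction: the components of the weight-0 edges. *)
Definition merged : finType :=
  {S : {set vert D} | S \in [set component zero_edges x | x : vert D]}.
Definition merge (x : vert D) : merged :=
  exist _ (component zero_edges x) (imset_f _ (erefl : x \in vert D)).

Definition wsub_vert : finType := (merged + {e : edge D & 'I_(l e).-1})%type.
Definition wsub_edge : finType := {e : edge D & 'I_(l e)}.

(* The vertex at distance k from the source of the chain of e, k <= l e; the
   inner vertices are those with 0 < k < l e. *)
Definition chain_vert (e : edge D) (k : nat) : wsub_vert :=
  if k is k'.+1 then
    if insub k' is Some i then inr (existT (fun f => 'I_(l f).-1) e i)
    else inl (merge (tgt e))
  else inl (merge (src e)).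

Definition weak_subdivision : mgraph :=
  @MGraph wsub_vert wsub_edge
    (fun a => chain_vert (tag a) (tagged a))
    (fun a => chain_vert (tag a) (tagged a).+1).

End WeakSubdivision.

Definition K33 : mgraph :=
  @MGraph ('I_3 + 'I_3)%type ('I_3 * 'I_3)%type
    (fun e => inl e.1) (fun e => inr e.2).

Section Chains.
Variables (q r : int) (l : edge K33 -> nat).
Local Open Scope ring_scope.

Definition chains_of_length (k : int) : {set edge K33} :=
  [set e | (l e)%:Z == k].

Definition chain_counts : Prop :=
  [/\ #|chains_of_length q| = (9 - `|r|)%N,
      0 < r -> #|chains_of_length (q + 1)| = `|r|%N &
      r < 0 -> #|chains_of_length (q - 1)| = `|r|%N].

Definition chain_placement : Prop :=
  [/\ r = 2 \/ r = 3 -> matching (chains_of_length (q + 1)),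
      r = - 2 \/ r = - 3 -> matching (chains_of_length (q - 1)),
      r = 4 -> two_disjoint_paths 3 1 (chains_of_length (q + 1)) &
      r = - 4 -> two_disjoint_paths 2 2 (chains_of_length (q - 1))].

End Chains.

(* Main.v *)
From Stdlib Require Import ZArith Lia.
Require Import Defs.
From HB Require Import structures.
From mathcomp Require Import all_boot all_order all_algebra.
From mathcomp Require Import boolp reals zify ssrZ.

Set Implicit Arguments.
Unset Strict Implicit.
Unset Printing Implicit Defensive.

Import Order.TTheory GRing.Theory Num.Theory.

(** Let N_k(H) be the number of k-sets of edges whose deletion leaves H connected. As H has
    corank 4, R(H,p) is the sum over k <= 4 of N_k(H) p^(m-k) (1-p)^k, and N_4(H) is the
    number of spanning trees. It therefore suffices that one graph maximizes N_0, ..., N_4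
    simultaneously and is the only one to maximize N_4.

    Contracting a bridge preserves every N_k and lowers the number of edges. If two edges
    form a cut, one of them can be contracted and its length transferred to the other. Splitting
    a vertex of degree at least 4 adds an edge of length 0 and keeps 3-edge-connectivity.
    So H becomes an assignment of lengths to the edges of a 3-edge-connected cubic graph on
    6 vertices, which is K33 or the triangular prism, and N_k becomes a polynomial in 9
    lengths of sum m. A prism with a rung of length 0 can be twisted into K33. If all
    rungs are positive, N_4 is strictly too small by a star-triangle transformation, and
    for k <= 3 twisting a suitable pair of edges does not decrease N_k.

    For K33 the polynomials N_3 and N_4 are s^3 and s^4 up to a constant factor, where s = m
    is the sum of the lengths, minus nonnegative deviation terms. This leaves only finitely
    many offsets of the lengths from q for competitors of the claimed optimum, and for fixed
    offsets the difference to the optimum has degree at most 2 in q, so that three values of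
    q decide. If N_4(H) is optimal, the reduction traces K33 in H as a partition of the edges
    into trails with the optimal lengths, and counting vertices shows that H is the claimed
    weak subdivision. *)

(** * Cuts *)

(** Uniqueness, rather than the bound, shapes the reduction. Counts survive a shift of length across
    any two-edge cut, but the graph need not. The contraction can be undone only where the two edges
    meet at a vertex of degree 2: there the trail through one edge is prolonged by the other. If a
    two-edge cut remains although all degrees are at least 3, corank 4 leaves at most 6 vertices and
    9 edges. After the contraction there are at most 8 edges, so some edge of K33 has length 0 while
    the merged edge has length at least 2. Optimal lengths differ by at most one, so such a graph is
    strictly worse.

    Lengths on the cubic graph may be 0, because edges created by splitting a vertex have length 0.
    A rung of length 0 is what makes the twist of the prism into K33 preserve the counts.

    Two ranges escape the general estimates. The deviation bounds need q >= 1, so totals up to 4 are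
    enumerated. The optimal lengths are determined only for totals of at least 5, so the
    single-vertex graph with four loops is treated apart. *)

Section Cuts.
Variable G : mgraph.
Implicit Types (A S : {set edge G}) (X Y : {set vert G}) (e f : edge G).

Definition cut X : {set edge G} := [set e | (src e \in X) (+) (tgt e \in X)].

Lemma in_cut X e : (e \in cut X) = (src e \in X) (+) (tgt e \in X).
Proof. by rewrite inE. Qed.

Lemma cutC X : cut (~: X) = cut X.
Proof. by apply/setP=> e; rewrite !inE addNb addbN negbK. Qed.

Lemma adj_sym A : symmetric (adj A).
Proof.
by move=> x y; apply/existsP/existsP => -[e He]; exists e; rewrite setUC.
Qed.

Lemma adj_closed A X : [disjoint A & cut X] -> closed (adj A) X.
Proof.
move=> dAX x y /existsP[e /andP[eA /eqP exy]].
have := disjointFr dAX eA; rewrite in_cut.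
have : (src e \in ends e) && (tgt e \in ends e) by rewrite !inE !eqxx orbT.
have : (x \in ends e) && (y \in ends e) by rewrite exy !inE !eqxx orbT.
rewrite {3 4}exy !inE.
case/andP=> /orP[]/eqP-> /orP[]/eqP-> // /andP[];
  try by move=> _ _; case: (_ \in X); case: (_ \in X).
all: rewrite -?exy.
all: by do 2![case/orP=> /eqP->]; case: (_ \in X); case: (_ \in X).
Qed.

(** Connectivity is tested by cuts throughout the surgery that follows: cuts pull back along
    contractions and isomorphisms and add under symmetric difference, whereas paths would have to be
    rerouted. *)
Lemma connected_cutP A :
  reflect (forall X, X != set0 -> X != setT -> exists2 e, e \in A & e \in cut X)
          (connected_by A).
Proof.
apply: (iffP idP) => [cA X /set0Pn[x xX] XT | cA].
  case: (boolP [exists e in A, e \in cut X]) => [/exists_inP[e eA eX]|no];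
    first by exists e.
  have dAX : [disjoint A & cut X].
    apply/pred0P => e /=; apply/negP => /andP[eA eX].
    by move/exists_inP: no => []; exists e.
  case/negP: XT; apply/eqP/setP => y; rewrite inE.
  have /forallP/(_ x)/forallP/(_ y) cxy := cA.
  by rewrite -(closed_connect (adj_closed dAX) cxy).
apply/forallP=> x; apply/forallP=> y; apply/negPn/negP => ncxy.
pose X := component A x.
have [] := cA X.
- by apply/set0Pn; exists x; rewrite inE connect0.
- by apply/eqP => /setP/(_ y); rewrite !inE (negPf ncxy).
move=> e eA; rewrite in_cut !inE.
have a1 : connect (adj A) (src e) (tgt e).
  by apply/connect1/existsP; exists e; rewrite eA /ends eqxx.
by rewrite (same_connect_r (sym_connect_sym (@adj_sym A)) a1) addbb.
Qed.

Lemma connected_sub A A' : A \subset A' -> connected_by A -> connected_by A'.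
Proof.
move=> sAA' /connected_cutP cA; apply/connected_cutP => X X0 XT.
by have [e eA eX] := cA X X0 XT; exists e => //; apply: (subsetP sAA').
Qed.

Lemma disconnectedP A :
  reflect (exists X, [/\ X != set0, X != setT & cut X \subset ~: A])
          (~~ connected_by A).
Proof.
apply: (iffP idP) => [nA | [X [X0 XT sX]]].
  apply: contrapT => no; case/negP: nA; apply/connected_cutP => X X0 XT.
  apply: contrapT => no2; apply: no; exists X; split=> //.
  by apply/subsetP => e eX; rewrite inE; apply/negP => eA; apply: no2; exists e.
apply/negP => /connected_cutP/(_ X X0 XT)[e eA eX].
by have := subsetP sX e eX; rewrite inE eA.
Qed.

(* When each edge e is replaced by a path of l e edges, a k-set of edges whose deletion
   leaves the graph connected picks one edge in each of k different paths. *)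
Definition wcount (l : edge G -> nat) (k : nat) : nat :=
  \sum_(S : {set edge G} | (#|S| == k) && connected_by (~: S)) \prod_(e in S) l e.

Lemma eq_wcount l l' k : l =1 l' -> wcount l k = wcount l' k.
Proof. by move=> ll'; apply: eq_bigr => S _; apply: eq_bigr. Qed.

End Cuts.

Lemma sum_setD1 (T : finType) (a : T) (F : {set T} -> nat) :
  \sum_(S : {set T}) F S = \sum_(S : {set T} | a \notin S) (F S + F (a |: S)).
Proof.
rewrite big_split /= (bigID (fun S : {set T} => a \notin S)) /=; congr (_ + _).
rewrite (reindex_onto (fun S : {set T} => a |: S) (fun S => S :\ a)) /=.
  apply: eq_bigl => S; rewrite !inE eqxx /=.
  by apply/eqP/idP => [<-|aS]; rewrite ?setD11 // setU1K.
by move=> S; rewrite negbK => aS; rewrite setD1K.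
Qed.

(** * Two-edge cuts and contraction *)

Section Shift.
Variable G : mgraph.
Implicit Types (A S : {set edge G}) (X Y : {set vert G}) (e f : edge G).

Definition shift_weight (e f : edge G) (l : edge G -> nat) : edge G -> nat :=
  fun g => if g == f then 0 else if g == e then l e + l f else l g.

Lemma cut_nontrivial X e : e \in cut X -> X != set0 /\ X != setT.
Proof.
move=> eX; split; apply/negP => /eqP X0; move: eX;
  by rewrite X0 in_cut !inE.
Qed.

Lemma cut_diff X Y : cut [set x | (x \in X) (+) (x \in Y)] =
  [set e | (e \in cut X) (+) (e \in cut Y)].
Proof.
apply/setP=> e; rewrite !inE.
by do 4!case: (_ \in _).
Qed.

(** If the cut of some [Y] were contained in [f |: S], it would contain [f] and not [e]. The cut of
    the symmetric difference of [X] and [Y] would then be contained in [e |: S]. *)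
Lemma connected_swap X e f S : e != f -> cut X = [set e; f] ->
  e \notin S -> f \notin S ->
  connected_by (~: (e |: S)) -> connected_by (~: (f |: S)).
Proof.
move=> ef cX eS fS /connected_cutP ce; apply/connected_cutP => Y Y0 YT.
apply: contrapT => no.
have sub g : g \in cut Y -> g \notin S -> g = f.
  move=> gY gS; apply: contrapT => gf; apply: no; exists g => //.
  by rewrite !inE negb_or gS andbT; apply/eqP.
pose W := [set x | (x \in X) (+) (x \in Y)].
have eY : e \notin cut Y.
  by apply/negP => eY; case/eqP: ef; apply: sub.
have fY : f \in cut Y.
  have [g] := ce Y Y0 YT; rewrite !inE negb_or => /andP[ge gS] gY.
  by rewrite -(sub g) // inE.
have cW : cut W = [set g | (g \in cut X) (+) (g \in cut Y)] by apply: cut_diff.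
have eW : e \in cut W by rewrite cW in_set cX in_set2 eqxx (negPf eY).
have [W0 WT] := cut_nontrivial eW.
have [g] := ce W W0 WT; rewrite cW inE cX in_setC in_setU1 negb_or.
case/andP=> ge gS; rewrite in_set2 (negPf ge) /=.
case: eqP => [->|gf]; first by rewrite fY.
by move/sub/(_ gS)/gf.
Qed.

End Shift.

Lemma sum_setD1P (T : finType) (a : T) (Q : pred {set T}) (F : {set T} -> nat) :
  (forall S : {set T}, Q (a |: S) = Q S) ->
  \sum_(S : {set T} | Q S) F S =
  \sum_(S : {set T} | Q S && (a \notin S)) (F S + F (a |: S)).
Proof.
move=> QE; rewrite big_mkcond (sum_setD1 a) [RHS]big_mkcondl.
by apply: eq_bigr => S _; rewrite QE; case: ifP.
Qed.

(** Deleted sets are grouped by their part [S] outside [e] and [f]. Deleting both edges disconnects,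
    and deleting either one has the same effect, so only [l e + l f] enters. *)
Lemma wcount_shift (G : mgraph) (X : {set vert G}) (e f : edge G) l k :
  e != f -> cut X = [set e; f] -> wcount (shift_weight e f l) k = wcount l k.
Proof.
move=> ef cX; rewrite /wcount ![LHS]big_mkcond ![RHS]big_mkcond /=.
have [X0 XT] : X != set0 /\ X != setT.
  by apply: (@cut_nontrivial _ _ e); rewrite cX !inE eqxx.
rewrite ![LHS](@sum_setD1P _ e xpredT) // ![RHS](@sum_setD1P _ e xpredT) //.
rewrite ![LHS](@sum_setD1P _ f (fun S => e \notin S)); last first.
  by move=> S; rewrite !inE (negPf ef).
rewrite ![RHS](@sum_setD1P _ f (fun S => e \notin S)); last first.
  by move=> S; rewrite !inE (negPf ef).
apply: eq_bigr => S /= /andP[eS fS].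
have fe : f == e = false by rewrite eq_sym (negPf ef).
have fS' : f \notin e |: S by rewrite !inE fe.
have eS' : e \notin f |: S by rewrite !inE (negPf ef).
have bad : connected_by (~: (e |: (f |: S))) = false.
  apply/negP => /connected_cutP/(_ X X0 XT)[g]; rewrite cX !inE !negb_or.
  by case/and3P=> /negPf-> /negPf->.
have prodE g : g \in S -> shift_weight e f l g = l g.
  move=> gS; rewrite /shift_weight.
  have /negPf-> : g != f by apply: contraNneq fS => <-.
  by have /negPf-> : g != e by apply: contraNneq eS => <-.
have swap : connected_by (~: (e |: S)) = connected_by (~: (f |: S)).
  apply/idP/idP; first exact: connected_swap ef cX eS fS.
  by apply: (@connected_swap _ X f e) => //; [rewrite fe | rewrite cX setUC].
rewrite bad !andbF !addn0 !cardsU1 eS fS /= swap.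
rewrite !big_setU1 //= /shift_weight eqxx (negPf ef) eqxx mul0n.
rewrite (setUC [set f]) (eq_bigr l) //.
by rewrite mulnDl; case: (_ && connected_by (~: (_ :|: _))); rewrite !addn0 ?addnA.
Qed.

(* The graph D is the contraction of the edge f of D', described by its
   projection pi on vertices and the inclusion j on edges. *)
Definition contraction (D' : mgraph) (f : edge D') (D : mgraph)
    (pi : vert D' -> vert D) (j : edge D -> edge D') : Prop :=
  [/\ injective j, (forall g, (g \in codom j) = (g != f)),
      (forall e, src e = pi (src (j e)) /\ tgt e = pi (tgt (j e))),
      (forall x, exists x', pi x' = x) &
      forall x y, pi x = pi y <-> (x = y \/ [set x; y] = ends f)].

Section Contraction.
Variables (D' : mgraph) (f : edge D') (D : mgraph).
Variables (pi : vert D' -> vert D) (j : edge D -> edge D').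
Hypothesis C : contraction f pi j.

Lemma cut_contraction (X : {set vert D}) e :
  (j e \in cut (pi @^-1: X)) = (e \in cut X).
Proof. by case: C => _ _ E _ _; rewrite !inE; have [-> ->] := E e. Qed.

Lemma contractionNcut (X : {set vert D}) : f \notin cut (pi @^-1: X).
Proof.
case: C => _ _ _ _ E; rewrite !inE.
have -> : pi (src f) = pi (tgt f) by apply/E; right.
by rewrite addbb.
Qed.

(** The ends of [f] form the only fibre of [pi] that may have two elements, so a side that [f] does
    not cross is a union of fibres. *)
Lemma contraction_saturated (X : {set vert D'}) :
  f \notin cut X -> X = pi @^-1: [set pi x | x in X].
Proof.
case: C => _ _ _ _ E fX; apply/setP => x; rewrite inE; apply/idP/imsetP.
  by move=> xX; exists x.
case=> y yX /E[->//|exy]; move: fX; rewrite in_cut.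
have : (x \in ends f) && (y \in ends f) by rewrite -exy !inE !eqxx orbT.
have : (src f \in [set x; y]) && (tgt f \in [set x; y]).
  by rewrite exy !inE !eqxx orbT.
rewrite !inE => /andP[a b] /andP[c d].
case/orP: a => /eqP a; case/orP: b => /eqP b; case/orP: c => /eqP c;
case/orP: d => /eqP d; rewrite a b; try congruence; rewrite yX;
  by [case: (x \in X) | rewrite ?a ?b -?c -?d; case: (x \in X); rewrite // c d b -d a yX | congruence].
Qed.

Lemma preim_pi0 (X : {set vert D}) : (pi @^-1: X == set0) = (X == set0).
Proof.
case: C => _ _ _ sur _; apply/eqP/eqP => [|->]; last by rewrite preimset0.
move=> /setP E; apply/setP => x; have [x' <-] := sur x.
by have := E x'; rewrite !inE.
Qed.

Lemma preim_piT (X : {set vert D}) : (pi @^-1: X == setT) = (X == setT).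
Proof.
case: C => _ _ _ sur _; apply/eqP/eqP => [|->]; last by rewrite preimsetT.
move=> /setP E; apply/setP => x; have [x' <-] := sur x.
by have := E x'; rewrite !inE.
Qed.

(** Cuts of [D'] avoiding [f] are those of [D]; the others are met by [f] itself, which is never
    deleted here. *)
Lemma connected_contraction (S : {set edge D}) :
  connected_by (~: (j @: S)) = connected_by (~: S).
Proof.
case: (C) => injj imj _ _ _.
apply/connected_cutP/connected_cutP => conn X X0 XT.
  have [] := conn (pi @^-1: X); rewrite ?preim_pi0 ?preim_piT //.
  move=> g gS gX.
  have : g \in codom j.
    by rewrite imj; apply: contraTneq gX => ->; apply: contractionNcut.
  case/codomP=> e ge; subst g; exists e; last by rewrite -cut_contraction.
  by move: gS; rewrite !inE mem_imset.
have [fX|fX] := boolP (f \in cut X).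
  exists f => //; rewrite inE; apply/imsetP => -[e _ fe].
  by have := imj f; rewrite fe eqxx codom_f.
have XE := contraction_saturated fX.
have [] := conn [set pi x | x in X].
- by rewrite -preim_pi0 -XE.
- by rewrite -preim_piT -XE.
move=> e eS eX; exists (j e); first by move: eS; rewrite !inE mem_imset.
by rewrite XE cut_contraction.
Qed.

(** Only the sets containing [f] are lost, and they contribute nothing: either the product has the
    factor 0 or deleting [f] disconnects. The two cases serve edges of length 0 and bridges. *)
Lemma wcount_contraction (l : edge D' -> nat) k :
  (l f = 0 \/ ~~ connected_by (~: [set f])) ->
  wcount l k = wcount (l \o j) k.
Proof.
case: (C) => injj imj _ _ _ lf.
rewrite [LHS]/wcount (bigID (fun S : {set edge D'} => f \in S)) /=.
rewrite big1 ?add0n; last first.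
  move=> S /andP[/andP[_ cS] fS]; case: lf => [lf|/negP[]].
    by rewrite (bigD1 f) //= lf.
  by apply: connected_sub cS; rewrite setCS sub1set.
rewrite (reindex_onto (fun S : {set edge D} => j @: S)
                      (fun S : {set edge D'} => j @^-1: S)) /=; last first.
  move=> S /andP[_ fS]; apply/setP => g; apply/imsetP/idP.
    by case=> e; rewrite inE => eS ->.
  move=> gS; have : g \in codom j by rewrite imj; apply: contraNneq fS => <-.
  by case/codomP => e ge; exists e; rewrite // inE -ge.
rewrite /wcount; apply: eq_big => S.
  rewrite connected_contraction card_imset //.
  have -> : j @^-1: (j @: S) == S.
    by apply/eqP/setP => e; rewrite inE mem_imset.
  have -> : f \notin j @: S.
    apply/imsetP => -[e _ fe]; have := imj f.
    by rewrite fe eqxx codom_f.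
  by rewrite !andbT.
by move=> _; rewrite big_imset //= => x y _ _; apply: injj.
Qed.

Lemma card_edge_contraction : #|edge D'| = #|edge D|.+1.
Proof.
case: C => injj imj _ _ _; rewrite -(card_codom injj) (cardD1 f) inE add1n.
by congr _.+1; apply: eq_card => g; rewrite imj !inE andbT.
Qed.

End Contraction.

(** * Three-edge-connected graphs and vertex splitting *)

Section Tec.
Variable G : mgraph.
Implicit Types (A S : {set edge G}) (X Y : {set vert G}) (e f : edge G).

Definition three_edge_connected : Prop :=
  forall S, #|S| <= 2 -> connected_by (~: S).

Lemma three_edge_connectedP :
  three_edge_connected <->
  forall X, X != set0 -> X != setT -> 2 < #|cut X|.
Proof.
split=> [tec X X0 XT | tec S S2].
  rewrite ltnNge; apply/negP => /tec/connected_cutP/(_ X X0 XT)[e].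
  by rewrite in_setC => /negPf->.
apply/negPn/negP => /disconnectedP[X [X0 XT]].
rewrite setCK => /subset_leq_card; have := tec X X0 XT; lia.
Qed.

Lemma cut_cases : connected_by [set: edge G] ->
  three_edge_connected \/
  exists X, [/\ X != set0, X != setT &
    (exists f, cut X = [set f]) \/ (exists e f, e != f /\ cut X = [set e; f])].
Proof.
move=> cG; have [tec|] := pselect three_edge_connected; first by left.
move=> ntec; right; apply: contrapT => no; apply: ntec.
apply/three_edge_connectedP => X X0 XT; rewrite ltnNge; apply/negP => X2.
apply: no; exists X; split => //.
have [e _ eX] := connected_cutP _ cG X X0 XT.
have : 0 < #|cut X| by apply/card_gt0P; exists e.
case E : #|cut X| X2 => [|[|[|//]]] // _ _; [left | right].
  by apply/cards1P; rewrite E.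
by have /eqP/cards2P[a [b [ab Xab]]] := E; exists a, b.
Qed.

Lemma card_cut X : #|cut X| = \sum_e ((src e \in X) (+) (tgt e \in X)).
Proof. by rewrite -sum1dep_card big_mkcond; apply: eq_bigr => e _; case: ifP. Qed.

Lemma cut_submodular X Y : #|cut (X :|: Y)| + #|cut (X :&: Y)| <= #|cut X| + #|cut Y|.
Proof.
rewrite !card_cut -!big_split; apply: leq_sum => e _ /=; rewrite !inE.
by do 4!case: (_ \in _).
Qed.

Definition darts_at (v : vert G) : {set dart G} := [set d | dsrc d == v].

Lemma sum_darts_at : \sum_v #|darts_at v| = 2 * #|edge G|.
Proof.
rewrite mulnC -card_bool -card_prod -sum1_card (partition_big (@dsrc G) xpredT) //=.
by apply: eq_bigr => v _; rewrite -sum1dep_card.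
Qed.

Lemma dart_cut (d : dart G) X : dsrc d \notin X -> (d.1 \in cut X) = (dtgt d \in X).
Proof.
rewrite in_cut /dsrc /dtgt; case: d.2 => /negPf-> //=.
by rewrite addbF.
Qed.

(** A loop at [v] crosses no cut, so it can be paired with any other edge. Without loops, suppose
    that a dart [p] fails with each of three others. Then there are 3-edge cuts around sets [X1],
    [X2], [X3] that avoid [v], contain the head of [p], and each contain one further head.
    Uncrossing by submodularity twice gives their union a cut of at most 3 edges, yet all four darts
    cross it. *)
Lemma separable_darts v : three_edge_connected -> 4 <= #|darts_at v| ->
  exists p q, [/\ p \in darts_at v, q \in darts_at v, p.1 != q.1 &
    forall X, v \notin X -> p.1 \in cut X -> q.1 \in cut X -> 3 < #|cut X|].
Proof.
move=> tec v4.
have [[e [se te]]|noloop] := pselect (exists e, src e = v /\ tgt e = v).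
  have : darts_at v :\: [set (e, false); (e, true)] != set0.
    rewrite -subset0; apply/negP => /subset_leq_card.
    rewrite cards0 cardsD.
    have := subset_leq_card (subsetIr (darts_at v) [set (e, false); (e, true)]).
    rewrite cards2; lia.
  case/set0Pn => -[g b]; rewrite in_setD in_set2 !xpair_eqE /= => /andP[ge gv].
  exists (e, false), (g, b); split=> //.
  - by rewrite inE /dsrc se.
  - by move: ge; rewrite eq_sym; case: eqP => //= _; case: b {gv}.
  - by move=> X _; rewrite in_cut /= se te addbb.
have inj : {in darts_at v &, injective (fun d : dart G => d.1)}.
  move=> [g b] [g' b']; rewrite !inE /dsrc /= => E E' gg'; subst g'.
  case: (eqVneq b b') => [->//|bb']; case: noloop; exists g.
  by case: b b' bb' E E' => -[] //= _ /eqP-> /eqP->.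
apply: contrapT => no.
have bad p q : p \in darts_at v -> q \in darts_at v -> p != q ->
    exists X, [/\ v \notin X, dtgt p \in X, dtgt q \in X & #|cut X| = 3].
  move=> pv qv pq; apply: contrapT => noX; apply: no; exists p, q; split=> //.
    by apply: contraNneq pq => /inj->.
  move=> X vX.
  have sp : dsrc p = v by move: pv; rewrite inE => /eqP.
  have sq : dsrc q = v by move: qv; rewrite inE => /eqP.
  rewrite !dart_cut ?sp ?sq // => pX qX.
  rewrite ltn_neqAle (iffLR three_edge_connectedP tec) ?andbT.
  - by apply/eqP => X3; apply: noX; exists X.
  - by apply/set0Pn; exists (dtgt p).
  - by apply: contraNneq vX => ->; rewrite inE.
have [s [us sv s4]] : exists s : seq (dart G),
    [/\ uniq s, {subset s <= darts_at v} & size s = 4].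
  exists (take 4 (enum (darts_at v))); split.
  - by rewrite take_uniq // enum_uniq.
  - by move=> d /mem_take; rewrite mem_enum.
  - by rewrite size_takel // -cardE.
case: s us sv s4 => [|p [|q1 [|q2 [|q3 [|]]]]] //= us sv _.
have pv : p \in darts_at v by apply: sv; rewrite inE eqxx.
have q1v : q1 \in darts_at v by apply: sv; rewrite !inE eqxx orbT.
have q2v : q2 \in darts_at v by apply: sv; rewrite !inE eqxx !orbT.
have q3v : q3 \in darts_at v by apply: sv; rewrite !inE eqxx !orbT.
move: us; rewrite !inE !negb_or => /and4P[/and3P[n1 n2 n3] /andP[n4 n5] n6 _].
have [X1 [v1 p1 t1 c1]] := bad _ _ pv q1v n1.
have [X2 [v2 p2 t2 c2]] := bad _ _ pv q2v n2.
have [X3 [v3 p3 t3 c3]] := bad _ _ pv q3v n3.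
have big X : v \notin X -> dtgt p \in X -> 2 < #|cut X|.
  move=> vX pX; apply: (iffLR three_edge_connectedP tec).
    by apply/set0Pn; exists (dtgt p).
  by apply: contraNneq vX => ->; rewrite inE.
have h1 := cut_submodular X1 X2.
have h2 := cut_submodular (X1 :|: X2) X3.
have b1 : 2 < #|cut (X1 :&: X2)| by apply: big; rewrite !inE ?p1 ?p2 ?negb_and ?v1.
have b2 : 2 < #|cut ((X1 :|: X2) :&: X3)|.
  by apply: big; rewrite !inE ?p1 ?p3 ?negb_and ?v3 ?orbT.
have : [set p.1; q1.1; q2.1; q3.1] \subset cut (X1 :|: X2 :|: X3).
  apply/subsetP => g; rewrite !(in_setU, in_set1) -!orbA.
  have vU : v \notin X1 :|: X2 :|: X3 by rewrite !inE !negb_or v1 v2 v3.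
  have key d : d \in darts_at v -> dtgt d \in X1 :|: X2 :|: X3 ->
      d.1 \in cut (X1 :|: X2 :|: X3).
    by rewrite inE => /eqP dv dX; rewrite dart_cut // dv.
  have := (key p pv, key q1 q1v, key q2 q2v, key q3 q3v).
  rewrite !in_setU p1 t1 t2 t3 !orbT => -[[[/(_ isT) kp /(_ isT) k1] /(_ isT) k2] /(_ isT) k3].
  by case/or4P => /eqP->; [exact: kp | exact: k1 | exact: k2 | exact: k3].
move/subset_leq_card.
have D a b : a \in darts_at v -> b \in darts_at v -> (a.1 == b.1) = (a == b).
  by move=> av bv; apply/eqP/eqP => [/inj->//|->].
have -> : #|[set p.1; q1.1; q2.1; q3.1]| = 4.
  rewrite -!setUA !cardsU1 cards1 !(in_setU, in_set1) !D //.
  by rewrite (negPf n1) (negPf n2) (negPf n3) (negPf n4) (negPf n5) (negPf n6).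
move=> four.
have u12 : #|cut (X1 :|: X2)| <= 3.
  rewrite -(leq_add2r 3); apply: leq_trans (leq_trans h1 _); last by rewrite c1 c2.
  by rewrite leq_add2l.
have := leq_trans (leq_add four b2) h2.
rewrite c3 leqNgt; apply/negP; rewrite negbK.
by apply: (@leq_trans 7); rewrite // ltnS (leq_add u12).
Qed.

End Tec.

Section Contract.
Variables (G : mgraph) (f : edge G) (v w : vert G).
Hypotheses (fvw : ends f = [set v; w]) (vw : w != v).

(** The default of [insubd] does the identification: [v], the only vertex outside the subtype, is
    sent to [w]. *)
Definition contract_pi (x : vert G) : {x : vert G | x != v} :=
  insubd (exist _ w vw) x.

Definition contract : mgraph :=
  @MGraph {x : vert G | x != v} {e : edge G | e != f}
    (fun e => contract_pi (src (val e))) (fun e => contract_pi (tgt (val e))).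

Lemma val_contract_pi x : val (contract_pi x) = if x == v then w else x.
Proof. by rewrite /contract_pi val_insubd; case: eqP => // ->. Qed.

Lemma contract_pi_val (x : vert contract) : contract_pi (val x) = x.
Proof. by apply: val_inj; rewrite val_contract_pi (negPf (svalP x)). Qed.

Lemma contractP : @contraction G f contract contract_pi val.
Proof.
split=> //.
- exact: val_inj.
- move=> g; apply/codomP/idP => [[[e He] ->]|gf] //.
  by exists (exist _ g gf).
- by move=> x; exists (val x); rewrite contract_pi_val.
move=> x y; rewrite fvw; split.
  move/(congr1 val); rewrite !val_contract_pi.
  case: eqP => [->|_]; case: eqP => [->|_].
  - by left.
  - by move=> ->; right.
  - by move=> ->; right; rewrite setUC.
  - by left.
case=> [->//|/setP E]; apply: val_inj; rewrite !val_contract_pi.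
have := E x; have := E y; have := E v; have := E w.
rewrite !inE !eqxx ?orbT /= (eq_sym v) (eq_sym w) (eq_sym v) (eq_sym w).
by case: (eqVneq x v) => [->|xv]; case: (eqVneq y v) => [->|yv] //=;
  rewrite ?orbF; try (by move=> _ _ /esym/eqP->); try (by move=> _ _ _ /esym/eqP->);
  move=> _ _ /esym/eqP.
Qed.

Lemma card_vert_contract : #|vert G| = #|vert contract|.+1.
Proof. rewrite card_sig cardC1 prednK //; apply: (leq_trans _ (max_card (pred1 v))).
by rewrite card1. Qed.

End Contract.

Section Split.
Variables (G : mgraph) (v : vert G) (p q : dart G).
Hypotheses (pv : dsrc p = v) (qv : dsrc q = v) (pq : p.1 != q.1).

(** The new vertex and the new edge are both [None]; the darts [p] and [q] are moved from [v] to the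
    new vertex. Moving darts rather than edges allows a single end of a loop to move. *)
Definition split_src (d : dart G) : option (vert G) :=
  if (d == p) || (d == q) then None else Some (dsrc d).

Definition split_vertex : mgraph :=
  @MGraph (option (vert G)) (option (edge G))
    (fun a => if a is Some e then split_src (e, false) else Some v)
    (fun a => if a is Some e then split_src (e, true) else None).

Definition split_pi (x : vert split_vertex) : vert G := odflt v x.

Lemma split_src_pi d : odflt v (split_src d) = dsrc d.
Proof. by rewrite /split_src; case: eqP => [->|_] //=; case: eqP => [->|]. Qed.

Lemma split_vertexP : @contraction split_vertex None G split_pi Some.
Proof.
split.
- by move=> ? ? [].
- case=> [e|]; first by rewrite codom_f.
  by rewrite eqxx; apply/negP => /codomP[].
- by move=> e; rewrite /split_pi /= !split_src_pi.
- by move=> x; exists (Some x).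
move=> x y; rewrite /split_pi /ends /=; split.
  case: x y => [x|] [y|] /= E.
  - by left; rewrite E.
  - by right; rewrite E.
  - by right; rewrite E setUC.
  - by left.
case=> [->//|/setP E].
have := E x; have := E y; rewrite !inE !eqxx /= orbT.
by case: x {E} => [x|] /=; case: y => [y|] //=; rewrite ?orbF
  => /esym/eqP E1 /esym/eqP E2; congruence.
Qed.

End Split.

Section SplitTec.
Variables (G : mgraph) (v : vert G) (p q : dart G).
Hypotheses (tec : three_edge_connected G) (pv : dsrc p = v) (qv : dsrc q = v).
Hypotheses (pq : p.1 != q.1)
  (sep : forall X : {set vert G}, v \notin X -> p.1 \in cut X -> q.1 \in cut X -> 3 < #|cut X|).

Lemma split_src_in (X' : {set option (vert G)}) d : None \in X' -> Some v \notin X' ->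
  (split_src p q d \in X') = ((d == p) || (d == q)) (+) (Some (dsrc d) \in X').
Proof.
move=> NX vX; rewrite /split_src; case: eqP => [->|_] /=.
  by rewrite pv (negPf vX) NX.
by case: eqP => [->|_] //=; rewrite qv (negPf vX) NX.
Qed.

(** With the new vertex opposite to [v], exactly the two moved darts change sides. They belong to
    different edges, so each of these edges toggles once. *)
Lemma cut_split (X' : {set vert (split_vertex v p q)}) e :
  None \in X' -> Some v \notin X' ->
  (Some e \in cut X') =
  (e \in cut [set x | Some x \in X']) (+) ((e == p.1) || (e == q.1)).
Proof.
move=> NX vX.
have -> : (Some e \in cut X') =
    (split_src p q (e, false) \in X') (+) (split_src p q (e, true) \in X').
  exact: (in_cut X' (Some e : edge (split_vertex v p q))).
rewrite !split_src_in // !inE /dsrc /=.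
set a := Some (src e) \in X'; set b := Some (tgt e) \in X'.
have -> : ((e == p.1) || (e == q.1)) =
    (((e, false) == p) || ((e, false) == q)) (+) (((e, true) == p) || ((e, true) == q)).
  rewrite -!pair_eqE /pair_eq /=.
  case: (eqVneq e p.1) pq => [->|_] /=; first by move=> /negPf->; case: p.2.
  by case: (eqVneq e q.1) => //=; case: q.2.
by case: (_ || _); case: (_ || _); case: a; case: b.
Qed.

(** A cut avoiding the new edge is a cut of [G]. Any other cut needs two further edges. If the new
    vertex is alone on its side, these are [p.1] and [q.1]. Otherwise they are found in [cut X]
    outside [p.1] and [q.1]: this cut has at least 4 edges by [sep] if it contains both, and at
    least 3 in any case. *)
Lemma split_three_edge_connected : three_edge_connected (split_vertex v p q).
Proof.
apply/three_edge_connectedP => X'; have C := split_vertexP pv qv.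
have [fX|] := boolP ((None : edge (split_vertex v p q)) \in cut X'); last first.
  move=> fX; rewrite (contraction_saturated C fX) => X0 XT.
  set X := [set _ x | x in _] in X0 XT *.
  have /card_imset imS : injective (@Some (edge G)) by move=> ? ? [].
  apply: (@leq_trans #|cut X|).
    apply: (iffLR (three_edge_connectedP _) tec).
      by rewrite -(preim_pi0 C).
    by rewrite -(preim_piT C).
  rewrite -(imS (cut X)); apply/subset_leq_card/subsetP => _ /imsetP[e eX ->].
  by rewrite (cut_contraction C).
wlog NX : X' fX / None \in X'.
  move=> wl X0 XT; have [NX|NX] := boolP (None \in X'); first exact: wl.
  rewrite -cutC; apply: wl.
  - by rewrite cutC.
  - by rewrite inE.
  - by apply/eqP => E; move/eqP: XT; apply; rewrite -(setCK X') E setC0.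
  - by apply/eqP => E; move/eqP: X0; apply; rewrite -(setCK X') E setCT.
move=> _ _.
have vX : Some v \notin X'.
  by move: fX; rewrite in_cut /= NX addbT.
set X := [set x | Some x \in X'].
have vX2 : v \notin X by rewrite inE.
have /card_imset imS : injective (@Some (edge G)) by move=> ? ? [].
have sub (A : {set edge G}) : 2 <= #|A| ->
    (forall e, e \in A -> (e \in cut X) (+) ((e == p.1) || (e == q.1))) ->
    2 < #|cut X'|.
  move=> A2 AX; apply: (@leq_trans #|None |: [set Some x | x in A]|).
    rewrite cardsU1 imS.
    by have -> : None \notin [set Some x | x in A] by apply/imsetP => -[].
  apply/subset_leq_card/subsetP => -[e|] // /setU1P[//|/imsetP[g gA [->]]].
  by rewrite cut_split //; apply: AX.
have [X0|X0] := eqVneq X set0.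
  apply: (sub [set p.1; q.1]); first by rewrite cards2 pq.
  move=> e; rewrite in_set2 => ->; rewrite X0 in_cut !inE //.
apply: (sub (cut X :\: [set p.1; q.1])); last first.
  by move=> e; rewrite in_setD in_set2 => /andP[/negPf-> ->].
have X3 : 2 < #|cut X|.
  apply: (iffLR (three_edge_connectedP _) tec) => //.
  by apply: contraNneq vX2 => ->; rewrite inE.
rewrite cardsD; have le2 := subset_leq_card (subsetIr (cut X) [set p.1; q.1]).
rewrite cards2 pq in le2.
have [both|nboth] := boolP ((p.1 \in cut X) && (q.1 \in cut X)).
  case/andP: both => pX qX; have := sep vX2 pX qX.
  move: #|cut X| #|_ :&: _| le2 => a b; lia.
suff : #|cut X :&: [set p.1; q.1]| <= 1.
  move: #|cut X| #|_ :&: _| X3 => a b; lia.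
move: nboth; rewrite negb_and => /orP[] nX.
  apply: (leq_trans _ (eq_leq (cards1 q.1))).
  apply/subset_leq_card/subsetP => e; rewrite in_setI in_set2 in_set1.
  by case/andP => eX /orP[]// /eqP ep; rewrite -ep eX in nX.
apply: (leq_trans _ (eq_leq (cards1 p.1))).
apply/subset_leq_card/subsetP => e; rewrite in_setI in_set2 in_set1.
by case/andP => eX /orP[]// /eqP ep; rewrite -ep eX in nX.
Qed.

End SplitTec.

(** * Cubic graphs on six vertices *)

Lemma bij_card (A B : finType) (h : A -> B) : injective h -> #|A| = #|B| -> bijective h.
Proof. by move=> ih AB; apply: inj_card_bij => //; rewrite AB. Qed.

Definition table_graph (t : seq (nat * nat)) : mgraph :=
  @MGraph 'I_6 'I_9 (fun e => inord (nth (0, 0) t e).1)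
                    (fun e => inord (nth (0, 0) t e).2).

Definition K33_table : seq (nat * nat) :=
  [:: (0, 3); (0, 4); (0, 5); (1, 3); (1, 4); (1, 5); (2, 3); (2, 4); (2, 5)].

Definition prism_table : seq (nat * nat) :=
  [:: (1, 2); (0, 2); (0, 1); (4, 5); (3, 5); (3, 4); (0, 3); (1, 4); (2, 5)].

(** Equal cardinalities reduce the isomorphism to finding an edge for every listed pair. Since each
    pair is increasing, distinct entries are distinct as unordered pairs, which makes the edge map
    injective. *)
Lemma table_iso (t : seq (nat * nat)) (D : mgraph) (s : seq (vert D)) (v : vert D) :
  #|vert D| = 6 -> #|edge D| = 9 -> uniq s -> size s = 6 -> size t = 9 ->
  all (fun p => p.1 < p.2 < 6) t -> uniq t ->
  (forall p, p \in t -> exists e, ends e = [set nth v s p.1; nth v s p.2]) ->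
  iso (table_graph t) D.
Proof.
move=> V6 E9 us ss st t6 ut H.
pose f (i : 'I_6) := nth v s i.
have injf : injective f.
  move=> i j /eqP; rewrite nth_uniq ?ss ?ltn_ord // => /eqP; exact: val_inj.
have Hi (i : 'I_9) : exists e, ends e = f @: ends (i : edge (table_graph t)).
  have it : nth (0, 0) t i \in t by rewrite mem_nth // st.
  have [e Ee] := H _ it; exists e.
  have /andP[p1 p2] := allP t6 _ it.
  by rewrite Ee /ends imsetU !imset_set1 /f /= !inordK // (ltn_trans p1).
have [g Hg] := choice Hi.
have injg : injective g.
  move=> i j gij; have := Hg j; rewrite -gij Hg => /(imset_inj injf) /setP E.
  apply/val_inj/eqP; rewrite -(nth_uniq (0, 0) _ _ ut) ?st ?ltn_ord //=.
  have it : nth (0, 0) t i \in t by rewrite mem_nth // st.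
  have jt : nth (0, 0) t j \in t by rewrite mem_nth // st.
  have := allP t6 _ it; have := allP t6 _ jt.
  have := E (inord (nth (0, 0) t i).1); have := E (inord (nth (0, 0) t i).2).
  have := E (inord (nth (0, 0) t j).1); have := E (inord (nth (0, 0) t j).2).
  rewrite /ends !inE !eqxx /= orbT.
  move: (nth _ _ i) (nth _ _ j) => [a b] [c d] /=.
  move=> E1 E2 E3 E4 /andP[c1 c2] /andP[a1 a2].
  have a3 := ltn_trans a1 a2; have c3 := ltn_trans c1 c2.
  move: E1 E2 E3 E4; rewrite -!(inj_eq val_inj) /= !inordK //.
  by move=> /esym E1 /esym E2 E3 E4; rewrite xpair_eqE; lia.
exists f, g; split; [apply: bij_card | apply: bij_card | ] => //.
- by rewrite card_ord V6.
- by rewrite card_ord E9.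
Qed.

Section Cubic.
Variable D : mgraph.
Hypotheses (tec : three_edge_connected D) (V6 : #|vert D| = 6) (E9 : #|edge D| = 9).

Lemma cut1_darts (v : vert D) : cut [set v] \subset [set d.1 | d in darts_at v].
Proof.
apply/subsetP => e; rewrite in_cut !in_set1 => ev; apply/imsetP.
case: (eqVneq (src e) v) ev => [sv _|sv /= /eqP tv].
  by exists (e, false) => //; rewrite inE /dsrc sv.
by exists (e, true) => //; rewrite inE /dsrc tv.
Qed.

Lemma cut1_gt2 (v : vert D) : 2 < #|cut [set v]|.
Proof.
apply: (iffLR (three_edge_connectedP _) tec).
  by apply/set0Pn; exists v; rewrite inE.
by apply/eqP => /(congr1 (fun X : {set vert D} => #|X|)); rewrite cards1 cardsT V6.
Qed.

Lemma darts_at3 (v : vert D) : #|darts_at v| = 3.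
Proof.
have ge3 (u : vert D) : 3 <= #|darts_at u|.
  apply: leq_trans (cut1_gt2 u) _; apply: leq_trans (subset_leq_card (cut1_darts u)) _.
  exact: leq_imset_card.
have := sum_darts_at D; rewrite E9 (bigD1 v) //=.
have : \sum_(u | u != v) 3 <= \sum_(u | u != v) #|darts_at u| by apply: leq_sum.
have := ge3 v; rewrite sum_nat_const cardC1 V6.
move: #|_| (\sum_(u | _) _) => a b; lia.
Qed.

Lemma darts_at_cut (v : vert D) (d : dart D) :
  d \in darts_at v -> d.1 \in cut [set v].
Proof.
move=> dv; suff -> : cut [set v] = [set d.1 | d in darts_at v] by apply: imset_f.
apply/eqP; rewrite eqEcard cut1_darts.
by rewrite (leq_trans (leq_imset_card _ _)) // darts_at3 cut1_gt2.
Qed.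

Lemma darts_at_inj (v : vert D) : {in darts_at v &, injective (fun d => d.1)}.
Proof.
apply/imset_injP; rewrite eqn_leq leq_imset_card darts_at3.
exact: leq_trans (cut1_gt2 v) (subset_leq_card (cut1_darts v)).
Qed.

Lemma cut1_3 (v : vert D) : #|cut [set v]| = 3.
Proof.
apply/eqP; rewrite eqn_leq cut1_gt2 andbT -(darts_at3 v).
exact: leq_trans (subset_leq_card (cut1_darts v)) (leq_imset_card _ _).
Qed.

Lemma dtgt_neq (v : vert D) (d : dart D) : d \in darts_at v -> dtgt d != v.
Proof.
move=> dv; have := darts_at_cut dv; move: dv; rewrite in_cut !inE /dsrc /dtgt.
by case: d.2 => /eqP->; rewrite eqxx ?addbT.
Qed.

(** There are no parallel edges: two edges joining [v] and [y] would leave at most 3 + 3 - 4 = 2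
    edges in the cut around this pair. *)
Lemma dtgt_inj (v : vert D) : {in darts_at v &, injective (@dtgt D)}.
Proof.
move=> d d' dv dv' dd'; apply: contrapT => ne.
have ne1 : d.1 != d'.1 by apply/eqP => /(darts_at_inj dv dv').
pose y := dtgt d; have yv : y != v by apply: dtgt_neq.
pose fl (c : dart D) : dart D := (c.1, ~~ c.2).
have flP c : c \in darts_at v -> fl c \in darts_at (dtgt c).
  by case: c => e [] _; rewrite inE.
have X0 : [set x | (x \in [set v]) (+) (x \in [set y])] != set0.
  by apply/set0Pn; exists v; rewrite !inE eqxx eq_sym (negPf yv).
have XT : [set x | (x \in [set v]) (+) (x \in [set y])] != setT.
  apply/eqP => /(congr1 (fun X : {set vert D} => #|X|)); rewrite cardsT V6.
  move=> X6; suff : 6 <= 2 by [].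
  rewrite -X6; apply: (@leq_trans #|[set v; y]|).
    by apply/subset_leq_card/subsetP => x; rewrite !inE; do 2!case: eqP.
  by rewrite cards2; case: eqP.
have := iffLR (three_edge_connectedP _) tec _ X0 XT; rewrite cut_diff ltnNge.
case/negP.
have sub : [set d.1; d'.1] \subset cut [set v] :&: cut [set y].
  apply/subsetP => e /set2P[] ->; rewrite in_setI darts_at_cut //=.
    by rewrite -[d.1]/((fl d).1); apply/darts_at_cut/flP.
  by rewrite -[d'.1]/((fl d').1); apply/darts_at_cut; rewrite /y dd'; apply/flP.
have /subset_leq_card := sub; rewrite cards2 ne1 => I2.
apply: (@leq_trans #|(cut [set v] :\: cut [set y]) :|: (cut [set y] :\: cut [set v])|).
  by apply/subset_leq_card/subsetP => e; rewrite !inE; do 4!case: (_ == _).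
apply: leq_trans (leq_card_setU _ _) _.
rewrite !cardsD [cut [set y] :&: _]setIC !cut1_3.
by move: #|_| I2 => a; lia.
Qed.

Definition nb (v : vert D) : {set vert D} := [set dtgt d | d in darts_at v].

Lemma card_nb v : #|nb v| = 3.
Proof. by rewrite card_in_imset ?darts_at3 //; apply: dtgt_inj. Qed.

Lemma nbP x y : reflect (exists e, ends e = [set x; y]) (y \in nb x).
Proof.
apply: (iffP imsetP) => [[[e b]]|[e exy]].
  rewrite inE /dsrc /dtgt /= => /eqP <- ->; exists e.
  by case: b; rewrite /ends // setUC.
have : (src e \in [set x; y]) && (tgt e \in [set x; y]).
  by rewrite -exy !inE !eqxx orbT.
have : (x \in ends e) && (y \in ends e) by rewrite exy !inE !eqxx orbT.
rewrite !inE => /andP[xe ye] /andP[se te].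
have [sx|sx] := eqVneq (src e) x.
  exists (e, false); first by rewrite inE /dsrc sx.
  rewrite /dtgt /=; case/orP: ye => /eqP // yE; case/orP: te => /eqP tE; congruence.
exists (e, true); rewrite ?inE /dsrc /dtgt /=.
  by rewrite [x == src e]eq_sym (negPf sx) /= eq_sym in xe.
by move: se; rewrite (negPf sx) /= => /eqP.
Qed.

Lemma nb_sym x y : (x \in nb y) = (y \in nb x).
Proof. by apply/nbP/nbP => -[e Ee]; exists e; rewrite setUC. Qed.

Lemma nb_irr x : x \notin nb x.
Proof. by apply/imsetP => -[d /dtgt_neq/eqP ne xd]; apply: ne. Qed.

Lemma ends_inj (e e' : edge D) : ends e = ends e' -> e = e'.
Proof.
move=> E.
have [d [dv dt d1]] : exists d : dart D,
   [/\ dsrc d = src e, dtgt d = tgt e & d.1 = e] by exists (e, false).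
have : (src e \in ends e') && (tgt e \in ends e') by rewrite -E !inE !eqxx orbT.
have ne : tgt e != src e.
  by rewrite -dv -dt; apply: dtgt_neq; rewrite inE.
have : (src e' \in ends e) && (tgt e' \in ends e) by rewrite E !inE !eqxx orbT.
rewrite !inE => /andP[a b] /andP[a' b'].
have [d' [dv' dt' d1']] : exists d : dart D,
   [/\ dsrc d = src e, dtgt d = tgt e & d.1 = e'].
  have [ss|ss] := eqVneq (src e) (src e').
    exists (e', false); split=> //; rewrite /dtgt /=.
    by case/orP: b' => /eqP // te; move: ne; rewrite te ss eqxx.
  exists (e', true); split=> //; rewrite /dsrc /dtgt /=.
    by move: a'; rewrite (negPf ss) => /eqP.
  by move: a; rewrite eq_sym (negPf ss) /= => /eqP.
rewrite -d1 -d1'; congr (_.1); apply: (@dtgt_inj (src e)); rewrite ?inE ?dv ?dv' //.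
by rewrite dt dt'.
Qed.

Lemma nb_sub3 x y1 y2 y3 : y1 \in nb x -> y2 \in nb x -> y3 \in nb x ->
  uniq [:: y1; y2; y3] -> nb x =i [:: y1; y2; y3].
Proof.
move=> h1 h2 h3 u y.
have -> : nb x = [set z in [:: y1; y2; y3]].
  apply/esym/eqP; rewrite eqEcard card_nb cardsE (card_uniqP u) /= leqnn andbT.
  by apply/subsetP => z; rewrite !inE => /or3P[]/eqP->.
by rewrite inE.
Qed.

Lemma nb_full x s : {subset nb x <= s} -> size s = 3 -> {subset s <= nb x}.
Proof.
move=> sub s3 y ys; have /subset_cardP/(_ (introT subsetP sub)) -> // : #|nb x| = #|s|.
apply/eqP; rewrite eqn_leq (subset_leq_card (introT subsetP sub)) card_nb -s3.
exact: card_size.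
Qed.

(** The neighbours of a vertex [a] are pairwise nonadjacent, so each of them is joined to [a] and to
    both of the remaining vertices. *)
Lemma cubic_triangle_free :
  (forall x y z, y \in nb x -> z \in nb y -> z \notin nb x) ->
  iso (table_graph K33_table) D.
Proof.
move=> tf; have [a _] : exists a : vert D, a \in setT.
  by apply/set0Pn; rewrite -card_gt0 cardsT V6.
have sB : size (enum (nb a)) = 3 by rewrite -cardE card_nb.
have sC : size (enum (~: (a |: nb a))) = 2.
  by rewrite -cardE cardsCs setCK cardsU1 nb_irr card_nb V6.
have uB := enum_uniq (mem (nb a)); have uC := enum_uniq (mem (~: (a |: nb a))).
have eB x : (x \in enum (nb a)) = (x \in nb a) by rewrite mem_enum.
have eC x : (x \in enum (~: (a |: nb a))) = (x != a) && (x \notin nb a).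
  by rewrite mem_enum !inE negb_or.
case: (enum (nb a)) sB uB eB => [|b1 [|b2 [|b3 []]]] // _ uB eB.
case: (enum (~: (a |: nb a))) sC uC eC => [|c1 [|c2 []]] // _ uC eC.
have bC b : b \in nb a -> nb b = a |: [set x in [:: c1; c2]].
  move=> ba; apply/eqP; rewrite eqEcard card_nb cardsU1.
  have -> : a \in [set x in [:: c1; c2]] = false by rewrite inE eC eqxx.
  rewrite cardsE (card_uniqP uC) andbT; apply/subsetP => x xb.
  rewrite in_setU1 inE eC; case: (eqVneq x a) => //= _.
  exact: tf ba xb.
have adjP b x : b \in [:: b1; b2; b3] -> x \in [:: a; c1; c2] ->
    exists e, ends e = [set x; b].
  move=> bB xC; apply/nbP; rewrite nb_sym bC -?eB //.
  by move: xC; rewrite !inE => /or3P[]->; rewrite ?orbT.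
apply: (@table_iso _ _ [:: a; c1; c2; b1; b2; b3] a) => //; last first.
  move=> p; rewrite !inE.
  have bb : (b1 \in [:: b1; b2; b3]) && (b2 \in [:: b1; b2; b3]) &&
    (b3 \in [:: b1; b2; b3]) by rewrite !inE !eqxx !orbT.
  have cc : (a \in [:: a; c1; c2]) && (c1 \in [:: a; c1; c2]) &&
    (c2 \in [:: a; c1; c2]) by rewrite !inE !eqxx !orbT.
  case/andP: bb => /andP[? ?] ?; case/andP: cc => /andP[? ?] ?.
  by do 8?[case/orP]; move/eqP=> -> /=; apply: adjP.
rewrite (cat_uniq [:: a; c1; c2]) uB andbT.
apply/andP; split.
  by rewrite cons_uniq uC andbT eC eqxx.
apply/hasPn => x; rewrite eB => xa; rewrite inE negb_or eC xa andbF andbT.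
by apply: contraTneq xa => ->; apply: nb_irr.
Qed.

(** If two triangle vertices had the same third neighbour, only two edges would leave the set formed
    by it and the triangle; this is [distinct]. So the third neighbours are the other three
    vertices, and each of them must be adjacent to the remaining two. *)
Lemma cubic_triangle a1 a2 a3 :
  a2 \in nb a1 -> a3 \in nb a2 -> a3 \in nb a1 ->
  iso (table_graph prism_table) D.
Proof.
move=> a12 a23 a13.
have ne12 : a1 != a2 by apply: contraTneq a12 => ->; apply: nb_irr.
have ne23 : a2 != a3 by apply: contraTneq a23 => ->; apply: nb_irr.
have ne13 : a1 != a3 by apply: contraTneq a13 => ->; apply: nb_irr.
have third x y z : y \in nb x -> z \in nb x -> y != z ->
    exists2 c, (c != y) && (c != z) & nb x =i [:: y; z; c].
  move=> yx zx yz; have : nb x :\: [set y; z] != set0.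
    rewrite -card_gt0 cardsD; have := subset_leq_card (subsetIr (nb x) [set y; z]).
    by rewrite card_nb cards2 yz; move: #|_| => n; lia.
  case/set0Pn => c; rewrite in_setD in_set2 negb_or => /andP[cyz cx].
  exists c => //; apply: nb_sub3 => //.
  by case/andP: cyz => cy cz; rewrite /= !inE negb_or yz eq_sym cy eq_sym cz.
have [c1 /andP[c12 c13] n1] := third a1 a2 a3 a12 a13 ne23.
have [c2 /andP[c21 c23] n2] : exists2 c, (c != a1) && (c != a3) & nb a2 =i [:: a1; a3; c].
  by apply: third; rewrite // nb_sym.
have [c3 /andP[c31 c32] n3] : exists2 c, (c != a1) && (c != a2) & nb a3 =i [:: a1; a2; c].
  by apply: third; rewrite // nb_sym.
have c11 : c1 != a1.
  by apply/eqP => E; have := nb_irr a1; rewrite n1 E !inE eqxx !orbT.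
have c22 : c2 != a2.
  by apply/eqP => E; have := nb_irr a2; rewrite n2 E !inE eqxx !orbT.
have c33 : c3 != a3.
  by apply/eqP => E; have := nb_irr a3; rewrite n3 E !inE eqxx !orbT.
have distinct x y z cx cz : x != y -> y != z -> x != z ->
    nb x =i [:: y; z; cx] -> nb y =i [:: x; z; cx] -> nb z =i [:: x; y; cz] ->
    cx != x -> cx != y -> cx != z -> cz != x -> cz != y -> False.
  move=> xy yz xz nx ny nz cxx cxy cxz czx czy.
  have xc : x \in nb cx by rewrite nb_sym nx !inE eqxx !orbT.
  have yc : y \in nb cx by rewrite nb_sym ny !inE eqxx !orbT.
  have [d /andP[dx dy] nc] := third cx x y xc yc xy.
  have /nbP[e1 E1] : cz \in nb z by rewrite nz !inE eqxx !orbT.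
  have /nbP[e2 E2] : d \in nb cx by rewrite nc !inE eqxx !orbT.
  pose X := [set x; y; z; cx].
  have sub : cut X \subset [set e1; e2].
    apply/subsetP => e.
    have : exists u w, [/\ u \in X, w \notin X & ends e = [set u; w]] \/ e \notin cut X.
      exists (if src e \in X then src e else tgt e), (if src e \in X then tgt e else src e).
      rewrite in_cut; case sX : (src e \in X); case tX : (tgt e \in X); rewrite /= ?sX ?tX.
      - by right.
      - by left.
      - by left; rewrite /ends setUC.
      - by right.
    case=> u [w [[uX wX eE] _|/negPf->//]].
    have wu : w \in nb u by apply/nbP; exists e.
    move: uX wX; rewrite !inE -!orbA !negb_or => /or4P[]/eqP uE /and4P[wx wy wz wc].
    - by move: wu; rewrite uE nx !inE (negPf wy) (negPf wz) (negPf wc).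
    - by move: wu; rewrite uE ny !inE (negPf wx) (negPf wz) (negPf wc).
    - move: wu; rewrite uE nz !inE (negPf wx) (negPf wy) /= => /eqP wcz.
      by rewrite (@ends_inj e e1) ?eqxx // E1 eE uE wcz.
    - move: wu; rewrite uE nc !inE (negPf wx) (negPf wy) /= => /eqP wd.
      by rewrite (@ends_inj e e2) ?eqxx ?orbT // E2 eE uE wd.
  have : 2 < #|cut X|.
    apply: (iffLR (three_edge_connectedP _) tec).
      by apply/set0Pn; exists x; rewrite !inE eqxx.
    apply/eqP => /(congr1 (fun X : {set vert D} => #|X|)); rewrite cardsT V6.
    by rewrite /X -!setUA !cardsU1 cards1; do 3!case: (_ \notin _).
  rewrite ltnNge (leq_trans (subset_leq_card sub)) // cards2.
  by case: eqP.
have d12 : c1 != c2.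
  apply/eqP => E; apply: (distinct a1 a2 a3 c1 c3) => //.
  by rewrite E; move=> x; rewrite n2.
have d13 : c1 != c3.
  apply/eqP => E; apply: (distinct a1 a3 a2 c1 c2) => //; rewrite 1?eq_sym //.
  - by move=> x; rewrite n1 !inE orbCA.
  - by rewrite E; move=> x; rewrite n3.
have d23 : c2 != c3.
  apply/eqP => E; apply: (distinct a2 a3 a1 c2 c1) => //; rewrite 1?eq_sym //.
  - by move=> x; rewrite n2 !inE orbCA.
  - by move=> x; rewrite E n3 !inE orbCA.
have us : uniq [:: a1; a2; a3; c1; c2; c3].
  rewrite /= !inE !negb_or ne12 ne13 ne23 d12 d13 d23.
  by rewrite !(eq_sym a1) !(eq_sym a2) !(eq_sym a3) c11 c12 c13 c21 c22 c23 c31 c32 c33.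
have all6 x : x \in [:: a1; a2; a3; c1; c2; c3].
  have := card_uniqP us; rewrite /= -V6 => cs.
  by have /subset_cardP/(_ (subset_predT _))-> : #|[:: a1; a2; a3; c1; c2; c3]| = #|vert D|.
have c1nb : {subset [:: a1; c2; c3] <= nb c1}.
  apply: nb_full => // x xc; have := all6 x; rewrite !inE.
  case/or4P => [->//|/eqP xE|/eqP xE|/or3P[/eqP xE|->|->]]; rewrite ?orbT //.
  - by move: xc; rewrite xE nb_sym n2 !inE (negPf c11) (negPf c13) (negPf d12).
  - by move: xc; rewrite xE nb_sym n3 !inE (negPf c11) (negPf c12) (negPf d13).
  - by move: xc; rewrite xE (negPf (nb_irr c1)).
have c2nb : {subset [:: a2; c1; c3] <= nb c2}.
  apply: nb_full => // x xc; have := all6 x; rewrite !inE.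
  case/or4P => [/eqP xE|->//|/eqP xE|/or3P[->|/eqP xE|->]]; rewrite ?orbT //.
  - by move: xc; rewrite xE nb_sym n1 !inE (negPf c22) (negPf c23) eq_sym (negPf d12).
  - by move: xc; rewrite xE nb_sym n3 !inE (negPf c21) (negPf c22) (negPf d23).
  - by move: xc; rewrite xE (negPf (nb_irr c2)).
apply: (@table_iso _ _ [:: a1; a2; a3; c1; c2; c3] a1) => //.
move=> p; rewrite !inE.
by do 8?[case/orP]; move/eqP=> -> /=; apply/nbP; rewrite ?n1 ?n2 ?n3 ?c1nb ?c2nb ?inE ?eqxx ?orbT ?a12 ?a13 ?a23.
Qed.

Lemma cubic_classification :
  iso (table_graph K33_table) D \/ iso (table_graph prism_table) D.
Proof.
have [[x [y [z [yx zy zx]]]]|no] :=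
    pselect (exists x y z, [/\ y \in nb x, z \in nb y & z \in nb x]).
  by right; apply: cubic_triangle yx zy zx.
left; apply: cubic_triangle_free => x y z yx zy.
by apply/negP => zx; apply: no; exists x, y, z.
Qed.

End Cubic.

(** * Counting polynomials of the two cubic graphs *)

Section Iso.
Variables (G H : mgraph) (f : vert G -> vert H) (g : edge G -> edge H).
Hypotheses (bf : bijective f) (bg : bijective g).
Hypothesis fg : forall e, ends (g e) = f @: ends e.

(** Isomorphisms preserve [ends] but not the orientation of edges; this form of membership involves
    [ends] only. *)
Lemma in_cut_ends (K : mgraph) (X : {set vert K}) e :
  (e \in cut X) = ~~ [disjoint ends e & X] && ~~ (ends e \subset X).
Proof.
rewrite in_cut /ends disjoints_subset !subUset !sub1set !in_setC.
by case: (_ \in X); case: (_ \in X).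
Qed.

Lemma cut_iso (Y : {set vert H}) e : (g e \in cut Y) = (e \in cut (f @^-1: Y)).
Proof.
by rewrite !in_cut_ends fg !disjoints_subset !sub_imset_pre preimsetC.
Qed.

Lemma connected_iso (S : {set edge G}) :
  connected_by (~: (g @: S)) = connected_by (~: S).
Proof.
have injf := bij_inj bf; have injg := bij_inj bg.
have [f' fK f'K] := bf; have [g' gK g'K] := bg.
apply/connected_cutP/connected_cutP => cn X X0 XT.
  have XE : X = f @^-1: (f @: X) by apply/setP => x; rewrite inE mem_imset.
  have [] := cn (f @: X).
  - by case/set0Pn: X0 => x xX; apply/set0Pn; exists (f x); apply: imset_f.
  - apply: contraNneq XT => E; apply/eqP/setP => x.
    by move/setP/(_ (f x)): E; rewrite !inE mem_imset.
  move=> e eS eX; exists (g' e); last by rewrite XE -cut_iso g'K.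
  by move: eS; rewrite !inE -{1}(g'K e) mem_imset.
have [] := cn (f @^-1: X).
- by case/set0Pn: X0 => x xX; apply/set0Pn; exists (f' x); rewrite inE f'K.
- apply: contraNneq XT => E; apply/eqP/setP => x.
  by move/setP/(_ (f' x)): E; rewrite !inE f'K.
move=> e eS eX; exists (g e); last by rewrite cut_iso.
by move: eS; rewrite !inE mem_imset.
Qed.

Lemma wcount_iso (l : edge H -> nat) k : wcount l k = wcount (l \o g) k.
Proof.
have injg := bij_inj bg; have [g' gK g'K] := bg.
rewrite /wcount (reindex (fun S : {set edge G} => g @: S)) /=; last first.
  exists (fun S : {set edge H} => g' @: S) => S _; rewrite -imset_comp.
    by rewrite (eq_imset (g := id)) ?imset_id //; apply: gK.
  by rewrite (eq_imset (g := id)) ?imset_id //; apply: g'K.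
apply: eq_big => S; first by rewrite connected_iso card_imset.
by move=> _; rewrite big_imset //= => x y _ _; apply: injg.
Qed.

End Iso.

(** * Subsets as bit sequences, and evaluation of the counts on a table *)

Fixpoint masks (n : nat) : seq bitseq :=
  if n is n'.+1 then
    [seq false :: s | s <- masks n'] ++ [seq true :: s | s <- masks n']
  else [:: [::]].

Lemma mem_masks n s : (s \in masks n) = (size s == n).
Proof.
elim: n s => [|n IHn] [|b s] //=.
  by apply/negbTE; rewrite mem_cat; apply/norP; split; apply/mapP => -[].
have inj c : injective (cons c : bitseq -> bitseq) by move=> ? ? [].
rewrite mem_cat eqSS -IHn; case: b; rewrite ?(mem_map (@inj _)).
  by case: mapP => // -[].
by rewrite orbC; case: mapP => // -[].
Qed.

Lemma masks_uniq n : uniq (masks n).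
Proof.
elim: n => //= n IHn.
have inj c : injective (cons c : bitseq -> bitseq) by move=> ? ? [].
rewrite cat_uniq !(map_inj_uniq (@inj _)) IHn /= andbT.
by apply/hasPn => _ /mapP[s _ ->]; apply/mapP => -[].
Qed.

Definition mask_set n (s : bitseq) : {set 'I_n} := [set i : 'I_n | nth false s i].

Lemma mask_set_perm n : perm_eq [seq mask_set n s | s <- masks n] (index_enum {set 'I_n}).
Proof.
apply: uniq_perm.
- rewrite map_inj_in_uniq ?masks_uniq // => s s'.
  rewrite !mem_masks => /eqP ss /eqP ss' E.
  apply: (@eq_from_nth _ false) => [|i]; first by rewrite ss ss'.
  rewrite ss => ltin; have := congr1 (fun A : {set 'I_n} => Ordinal ltin \in A) E.
  by rewrite !inE.
- exact: index_enum_uniq.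
move=> A; rewrite mem_index_enum; apply/mapP.
exists [seq i \in A | i <- enum 'I_n].
  by rewrite mem_masks size_map size_enum_ord.
apply/setP => i; rewrite inE (nth_map i) ?size_enum_ord //.
by rewrite nth_ord_enum.
Qed.

Lemma sum_masks n (P : pred {set 'I_n}) (F : {set 'I_n} -> nat) :
  \sum_(S | P S) F S = \sum_(s <- masks n | P (mask_set n s)) F (mask_set n s).
Proof. by rewrite -(perm_big _ (mask_set_perm n)) big_map. Qed.

Lemma all_masksP n (P : pred {set 'I_n}) :
  reflect (forall S, P S) (all (fun s => P (mask_set n s)) (masks n)).
Proof.
rewrite -(all_map (mask_set n) P) (perm_all _ (mask_set_perm n)).
by apply: (iffP allP) => [PS S|PS S _]; apply: PS; rewrite ?mem_index_enum.
Qed.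

Definition crosses (t : seq (nat * nat)) (X : bitseq) (i : nat) : bool :=
  nth false X (nth (0, 0) t i).1 != nth false X (nth (0, 0) t i).2.

Definition table_connected (t : seq (nat * nat)) (S : bitseq) : bool :=
  all (fun X => has id X ==> ~~ all id X ==>
         has (fun i => ~~ nth false S i && crosses t X i) (iota 0 9)) (masks 6).

Definition table_terms (t : seq (nat * nat)) (k : nat) : seq bitseq :=
  [seq A <- masks 9 | (count id A == k) && table_connected t A].

Fixpoint monomial (S : bitseq) (v : seq Z) : Z :=
  match S, v with
  | b :: S', x :: v' => if b then Z.mul x (monomial S' v') else monomial S' v'
  | _, _ => Z.one
  end.

Lemma mask_set_card n s : size s = n -> #|mask_set n s| = count id s.
Proof.
move=> ss; rewrite -sum1dep_card -sum1_count -ss (big_nth false) big_mkord.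
by [].
Qed.

Lemma table_connectedP t S : all (fun p => p.1 < p.2 < 6) t -> size t = 9 ->
  S \in masks 9 ->
  connected_by (~: (mask_set 9 S : {set edge (table_graph t)})) = table_connected t S.
Proof.
move=> t6 st; rewrite mem_masks => /eqP sS.
pose P (X : {set vert (table_graph t)}) := (X != set0) ==> (X != setT) ==>
  [exists e : edge (table_graph t), (e \notin mask_set 9 S) && (e \in cut X)].
have -> : connected_by (~: (mask_set 9 S : {set edge (table_graph t)})) =
          all (fun s => P (mask_set 6 s)) (masks 6).
  apply/connected_cutP/all_masksP => [cn X|al X X0 XT].
    apply/implyP => X0; apply/implyP => XT; have [e eS eX] := cn X X0 XT.
    by apply/existsP; exists e; rewrite eX andbT; move: eS; rewrite inE.
  have := al X; rewrite /P X0 XT /= => /existsP[e /andP[eS eX]].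
  by exists e; rewrite // inE.
apply: eq_in_all => X; rewrite mem_masks => /eqP sX; rewrite /P.
have -> : (mask_set 6 X != set0) = has id X.
  apply/set0Pn/hasP => [[i]|[b bX /= bt]].
    by rewrite inE => Xi; exists (nth false X i); rewrite ?mem_nth ?sX.
  have lt : index b X < 6 by rewrite -sX index_mem.
  by exists (Ordinal lt); rewrite inE /= nth_index.
have -> : (mask_set 6 X != setT) = ~~ all id X.
  congr (~~ _); apply/eqP/allP => [XT b bX|al].
    have lt : index b X < 6 by rewrite -sX index_mem.
    by move/setP/(_ (Ordinal lt)): XT; rewrite !inE /= nth_index.
  by apply/setP => i; rewrite !inE; apply: al; rewrite mem_nth ?sX.
congr (_ ==> (_ ==> _)).
have crE (e : edge (table_graph t)) :
    (e \in cut (mask_set 6 X : {set vert (table_graph t)})) = crosses t X (e : 'I_9).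
  have it : nth (0, 0) t (e : 'I_9) \in t by rewrite mem_nth // st.
  have /andP[p1 p2] := allP t6 _ it.
  rewrite in_cut !inE /= !inordK ?(ltn_trans p1) // /crosses.
  by case: (nth false X _); case: (nth false X _).
apply/existsP/hasP => [[e]|[i]].
  by rewrite inE crE => ?; exists (val e) => //; rewrite mem_iota /= ltn_ord.
rewrite mem_iota /= add0n => lt9 h; exists (Ordinal lt9).
by rewrite (crE (Ordinal lt9)) inE.
Qed.

Definition table_values (l : 'I_9 -> nat) : seq Z := [seq Z.of_nat (l i) | i <- enum 'I_9].

Lemma monomialE n s (l : 'I_n -> nat) : size s = n ->
  Z.of_nat (\prod_(i in mask_set n s) l i) =
  monomial s [seq Z.of_nat (l i) | i <- enum 'I_n].
Proof.
elim: n s l => [|n IHn] [|b s] l //.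
  by rewrite big1 // => -[].
case=> ss; rewrite enum_ordSl /= -map_comp -(IHn s (l \o lift ord0)) //.
rewrite big_mkcond big_ord_recl inE /= -Nat2Z.inj_mul.
have -> : \prod_(i < n) (if lift ord0 i \in mask_set n.+1 (b :: s) then l (lift ord0 i) else 1)
   = \prod_(i in mask_set n s) (l \o lift ord0) i.
  by rewrite [RHS]big_mkcond; apply: eq_bigr => i _; rewrite !inE.
by case: b; rewrite // mul1n.
Qed.

(** The list [table_terms t k] does not depend on the lengths and can be computed, so that only
    polynomial identities remain, to be proved by [ring]. *)
Lemma table_wcount t (l : 'I_9 -> nat) k :
  all (fun p => p.1 < p.2 < 6) t -> size t = 9 ->
  Z.of_nat (@wcount (table_graph t) l k) =
  foldr Z.add Z.zero [seq monomial A (table_values l) | A <- table_terms t k].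
Proof.
move=> t6 st; rewrite /wcount.
rewrite (sum_masks (fun S : {set 'I_9} => (#|S| == k) && connected_by (~: (S : {set edge (table_graph t)})))).
rewrite big_seq_cond (eq_bigl (fun A => (A \in masks 9) && ((count id A == k) && table_connected t A))); last first.
  move=> S; have [Sm|//] := boolP (S \in masks 9).
  rewrite (table_connectedP t6 st Sm) mask_set_card //.
  by apply/eqP; rewrite -mem_masks.
rewrite -big_seq_cond -big_filter -/(table_terms t k).
have : {subset table_terms t k <= masks 9} by move=> S; rewrite mem_filter => /andP[].
elim: (table_terms t k) => [|A s IHs] sub; first by rewrite big_nil.
rewrite big_cons Nat2Z.inj_add /= IHs; last by move=> x xs; apply: sub; rewrite inE xs orbT.
congr (Z.add _ _); apply: monomialE; apply/eqP.
by rewrite -mem_masks; apply: sub; rewrite inE eqxx.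
Qed.

Section Polynomials.
Local Open Scope Z_scope.

Definition e2 (x y z : Z) := x * y + x * z + y * z.

(** A row holds the edges at one vertex of the first side, and at most two edges of a row may be
    deleted; [e2] chooses two. For [k = 3], one edge from each row is allowed unless the three form
    a column, the star of a vertex on the second side. For [k = 4], the factor
    [e2 (b1 + c1) (b2 + c2) (b3 + c3) - B - C] is the sum of the [b_i c_j] with i and j different:
    deleting two edges of the first row together with [b_i] and [c_i] disconnects. *)
Definition K33_poly (k : nat) (a1 a2 a3 b1 b2 b3 c1 c2 c3 : Z) : Z :=
  let A := e2 a1 a2 a3 in let B := e2 b1 b2 b3 in let C := e2 c1 c2 c3 in
  let ra := a1 + a2 + a3 in let rb := b1 + b2 + b3 in let rc := c1 + c2 + c3 in
  match k with
  | 0%nat => 1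
  | 1%nat => ra + rb + rc
  | 2%nat => A + B + C + e2 ra rb rc
  | 3%nat => A * (rb + rc) + B * (ra + rc) + C * (ra + rb) + ra * rb * rc
             - a1 * b1 * c1 - a2 * b2 * c2 - a3 * b3 * c3
  | _ => e2 A B C + A * (e2 (b1 + c1) (b2 + c2) (b3 + c3) - B - C)
         + B * (e2 (a1 + c1) (a2 + c2) (a3 + c3) - A - C)
         + C * (e2 (a1 + b1) (a2 + b2) (a3 + b3) - A - B)
  end.

(* The rungs are z1, z2, z3 and x_i, y_i are the triangle edges facing the
   ends of z_i. *)
Definition prism_poly (k : nat) (x1 x2 x3 y1 y2 y3 z1 z2 z3 : Z) : Z :=
  let X := x1 + x2 + x3 in let Y := y1 + y2 + y3 in let Z := z1 + z2 + z3 in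
  match k with
  | 0%nat => 1
  | 1%nat => X + Y + Z
  | 2%nat => e2 x1 x2 x3 + e2 y1 y2 y3 + e2 z1 z2 z3 + e2 X Y Z
  | 3%nat => x1 * x2 * x3 + y1 * y2 * y3 + e2 x1 x2 x3 * (Y + Z)
             + e2 y1 y2 y3 * (X + Z) + e2 z1 z2 z3 * (X + Y) + X * Y * Z
             - z1 * (x2 * x3 + y2 * y3) - z2 * (x1 * x3 + y1 * y3)
             - z3 * (x1 * x2 + y1 * y2)
  | _ => x1 * x2 * x3 * Y + y1 * y2 * y3 * X + X * Y * e2 z1 z2 z3
         + (e2 (x2 * x3 + y2 * y3) (x1 * x3 + y1 * y3) (x1 * x2 + y1 * y2)
            - x1 * x2 * x3 * X - y1 * y2 * y3 * Y)
         + Y * (x2 * x3 * (z2 + z3) + x1 * x3 * (z1 + z3) + x1 * x2 * (z1 + z2))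
         + X * (y2 * y3 * (z2 + z3) + y1 * y3 * (z1 + z3) + y1 * y2 * (z1 + z2))
  end.

Ltac expand_terms t k :=
  let x := eval vm_compute in (table_terms t k) in
  have -> : table_terms t k = x by vm_compute.

Lemma K33_terms k v1 v2 v3 v4 v5 v6 v7 v8 v9 : (k <= 4)%N ->
  foldr Z.add Z.zero [seq monomial A [:: v1; v2; v3; v4; v5; v6; v7; v8; v9]
                     | A <- table_terms K33_table k] =
  K33_poly k v1 v2 v3 v4 v5 v6 v7 v8 v9.
Proof.
case: k => [|[|[|[|[|k]]]]] // _; rewrite /K33_poly /e2 /Z.zero.
- expand_terms K33_table 1%N; cbn [map foldr monomial]; rewrite /Z.one; ring.
- expand_terms K33_table 2%N; cbn [map foldr monomial]; rewrite /Z.one; ring.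
- expand_terms K33_table 3%N; cbn [map foldr monomial]; rewrite /Z.one; ring.
- expand_terms K33_table 4%N; cbn [map foldr monomial]; rewrite /Z.one; ring.
Qed.

Lemma prism_terms k v1 v2 v3 v4 v5 v6 v7 v8 v9 : (k <= 4)%N ->
  foldr Z.add Z.zero [seq monomial A [:: v1; v2; v3; v4; v5; v6; v7; v8; v9]
                     | A <- table_terms prism_table k] =
  prism_poly k v1 v2 v3 v4 v5 v6 v7 v8 v9.
Proof.
case: k => [|[|[|[|[|k]]]]] // _; rewrite /prism_poly /e2 /Z.zero.
- expand_terms prism_table 1%N; cbn [map foldr monomial]; rewrite /Z.one; ring.
- expand_terms prism_table 2%N; cbn [map foldr monomial]; rewrite /Z.one; ring.
- expand_terms prism_table 3%N; cbn [map foldr monomial]; rewrite /Z.one; ring.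
- expand_terms prism_table 4%N; cbn [map foldr monomial]; rewrite /Z.one; ring.
Qed.

End Polynomials.

Lemma table_valuesE (l : 'I_9 -> nat) :
  table_values l = [seq Z.of_nat (l (inord i)) | i <- iota 0 9].
Proof.
rewrite /table_values -val_enum_ord -map_comp; apply: eq_map => i /=.
by rewrite inord_val.
Qed.

(** * The optimal lengths on K33 *)

Section Optimum.
Local Open Scope Z_scope.

(* Half of 3 times the squared distance from (x, y, z) to the diagonal. *)
Definition dev (x y z : Z) := x * x + y * y + z * z - x * y - x * z - y * z.

(** The claimed optimal lengths minus [q], with rows and columns for the two sides of K33. Diagonal
    cells form a matching. For 4, the cells (1,0), (0,0), (0,1) form the path with 3 edges and (2,2)
    is the separate edge. For -4, the two paths are (0,0), (0,1) and (1,2), (2,2). *)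
Definition offset (r : Z) (i j : nat) : Z :=
  match r, i, j with
  | 1, 0%nat, 0%nat | 2, 0%nat, 0%nat | 2, 1%nat, 1%nat
  | 3, 0%nat, 0%nat | 3, 1%nat, 1%nat | 3, 2%nat, 2%nat
  | 4, 0%nat, 0%nat | 4, 0%nat, 1%nat | 4, 1%nat, 0%nat | 4, 2%nat, 2%nat => 1
  | -1, 0%nat, 0%nat | -2, 0%nat, 0%nat | -2, 1%nat, 1%nat
  | -3, 0%nat, 0%nat | -3, 1%nat, 1%nat | -3, 2%nat, 2%nat
  | -4, 0%nat, 0%nat | -4, 0%nat, 1%nat | -4, 1%nat, 2%nat | -4, 2%nat, 2%nat => -1
  | _, _, _ => 0
  end.

Definition opt_poly (k : nat) (q r : Z) : Z :=
  K33_poly k (q + offset r 0 0) (q + offset r 0 1) (q + offset r 0 2)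
             (q + offset r 1 0) (q + offset r 1 1) (q + offset r 1 2)
             (q + offset r 2 0) (q + offset r 2 1) (q + offset r 2 2).

Lemma dev_ge0 x y z : 0 <= dev x y z.
Proof.
have := Z.square_nonneg (x - y); have := Z.square_nonneg (x - z).
have := Z.square_nonneg (y - z); rewrite /dev; lia.
Qed.
Global Arguments dev_ge0 : clear implicits.

Lemma e2_ge0 x y z : 0 <= x -> 0 <= y -> 0 <= z -> 0 <= e2 x y z.
Proof. rewrite /e2; nia. Qed.

(** Four times [dev x y z] is [3 (x - y)^2 + (x + y - 2 z)^2]. *)
Lemma dev_lt d x y z : 0 <= d -> 4 * dev x y z < 3 * (d * d) -> - d < x - y < d.
Proof.
move=> d0 lt; have h := Z.square_nonneg (x + y - 2 * z).
have sq u : d <= u -> d * d <= u * u by move=> du; apply: Z.mul_le_mono_nonneg.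
have := sq (x - y); have := sq (y - x); rewrite /dev in lt; lia.
Qed.

(** K33 has 81 spanning trees, so nine equal lengths give [81 N_4 = s^4]. The entries are
    [s^4 - 81 N_4] for the claimed lengths, expanded residue by residue. *)
Definition opt4_defect (r : Z) (s : Z) : Z :=
  match r with
  | -4 => 12 * s * s - 16 * s | -3 => 9 * s * s | -2 => 9 * s * s + 4 * s - 12
  | -1 => 6 * s * s + 8 * s + 3 | 1 => 6 * s * s - 8 * s + 3
  | 2 => 9 * s * s - 4 * s - 12 | 3 => 9 * s * s | 4 => 12 * s * s - 2 * s - 9
  | _ => 0
  end.

Ltac residues r :=
  let H := fresh in
  assert (H : r = -4 \/ r = -3 \/ r = -2 \/ r = -1 \/ r = 0 \/ r = 1 \/ r = 2 \/
              r = 3 \/ r = 4) by lia;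
  destruct H as [->|[->|[->|[->|[->|[->|[->|[->| ->]]]]]]]].

Lemma opt_poly4E q r : -4 <= r <= 4 ->
  81 * opt_poly 4 q r =
  (9 * q + r) * (9 * q + r) * (9 * q + r) * (9 * q + r) - opt4_defect r (9 * q + r).
Proof.
by move=> r4; residues r;
  cbv [opt_poly K33_poly e2 offset opt4_defect]; ring.
Qed.

Section Region.
Variables a1 a2 a3 b1 b2 b3 c1 c2 c3 : Z.
Hypotheses (a1_ge0 : 0 <= a1) (a2_ge0 : 0 <= a2) (a3_ge0 : 0 <= a3).
Hypotheses (b1_ge0 : 0 <= b1) (b2_ge0 : 0 <= b2) (b3_ge0 : 0 <= b3).
Hypotheses (c1_ge0 : 0 <= c1) (c2_ge0 : 0 <= c2) (c3_ge0 : 0 <= c3).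

Let ra := a1 + a2 + a3.
Let rb := b1 + b2 + b3.
Let rc := c1 + c2 + c3.
Let s := ra + rb + rc.
Let K k := K33_poly k a1 a2 a3 b1 b2 b3 c1 c2 c3.

(** Obtained by substituting [3 e2 = (sum)^2 - dev] in each row, and
    [2 rb rc + dev b + dev c - dev (b + c)] for three times the sum of the [b_i c_j] with i and j
    different. *)
Lemma K33_poly4E :
  81 * K 4 = (s * s - dev ra rb rc) * (s * s - dev ra rb rc)
  - 18 * (dev a1 a2 a3 * (rb * rc) + dev b1 b2 b3 * (ra * rc) + dev c1 c2 c3 * (ra * rb))
  - 9 * e2 (dev a1 a2 a3) (dev b1 b2 b3) (dev c1 c2 c3)
  - 27 * (e2 a1 a2 a3 * dev (b1 + c1) (b2 + c2) (b3 + c3)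
          + e2 b1 b2 b3 * dev (a1 + c1) (a2 + c2) (a3 + c3)
          + e2 c1 c2 c3 * dev (a1 + b1) (a2 + b2) (a3 + b3)).
Proof. rewrite /K /s /ra /rb /rc /K33_poly /e2 /dev; ring. Qed.

Lemma K33_poly4_le :
  81 * K 4 <= (s * s - dev ra rb rc) * (s * s - dev ra rb rc)
  - 18 * (dev a1 a2 a3 * (rb * rc) + dev b1 b2 b3 * (ra * rc) + dev c1 c2 c3 * (ra * rb)).
Proof.
rewrite K33_poly4E.
have h0 : 0 <= e2 (dev a1 a2 a3) (dev b1 b2 b3) (dev c1 c2 c3).
  by apply: e2_ge0; apply: dev_ge0.
have h1 := Z.mul_nonneg_nonneg _ _ (e2_ge0 a1_ge0 a2_ge0 a3_ge0)
             (dev_ge0 (b1 + c1) (b2 + c2) (b3 + c3)).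
have h2 := Z.mul_nonneg_nonneg _ _ (e2_ge0 b1_ge0 b2_ge0 b3_ge0)
             (dev_ge0 (a1 + c1) (a2 + c2) (a3 + c3)).
have h3 := Z.mul_nonneg_nonneg _ _ (e2_ge0 c1_ge0 c2_ge0 c3_ge0)
             (dev_ge0 (a1 + b1) (a2 + b2) (a3 + b3)).
lia.
Qed.

(** A competitor may lose at most [opt4_defect r s], hence at most [12 s^2], against [s^4]. A
    deviation 7 of the row sums already costs [14 s^2 - 49], which is more because [s >= 5]. Now the
    row sums differ by at most 2, so they are [3 q + t_i] with few possible [t_i]. Each unit of
    deviation inside a row costs about [2 s^2], and case by case 6 units are too many. *)
Lemma K33_poly4_region q r : s = 9 * q + r -> 1 <= q -> -4 <= r <= 4 ->
  opt_poly 4 q r <= K 4 ->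
  dev ra rb rc <= 6 /\ dev a1 a2 a3 + dev b1 b2 b3 + dev c1 c2 c3 <= 5.
Proof.
move=> sE q1 r4 opt.
have le := K33_poly4_le; have E := opt_poly4E q r4.
have da := dev_ge0 a1 a2 a3; have db := dev_ge0 b1 b2 b3; have dc := dev_ge0 c1 c2 c3.
have ra0 : 0 <= ra by rewrite /ra; lia.
have rb0 : 0 <= rb by rewrite /rb; lia.
have rc0 : 0 <= rc by rewrite /rc; lia.
rewrite -sE in E.
have tau6 : dev ra rb rc <= 6.
  have L : opt4_defect r s <= 12 * s * s.
    by residues r; rewrite /opt4_defect; nia.
  have w1 : 0 <= rb * rc by nia.
  have w2 : 0 <= ra * rc by nia.
  have w3 : 0 <= ra * rb by nia.
  have tauE : s * s - dev ra rb rc = 3 * (rb * rc + ra * rc + ra * rb).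
    by rewrite /s /dev; ring.
  have := Z.mul_nonneg_nonneg _ _ da w1; have := Z.mul_nonneg_nonneg _ _ db w2.
  have := Z.mul_nonneg_nonneg _ _ dc w3.
  have s5 : 25 <= s * s by nia.
  move: (dev ra rb rc) tauE le => tau tauE le m1 m2 m3.
  have tau_s : tau <= s * s by lia.
  suff : ~ (7 <= tau) by lia.
  move=> tau7; have p1 : 0 <= tau - 7 by lia.
  have p2 : 0 <= 2 * (s * s) - tau - 7 by lia.
  have := Z.mul_nonneg_nonneg _ _ p1 p2; lia.
split=> //.
suff : ~ (6 <= dev a1 a2 a3 + dev b1 b2 b3 + dev c1 c2 c3) by lia.
have devC x y z : dev x y z = dev x z y by rewrite /dev; ring.
have devC' x y z : dev x y z = dev y z x by rewrite /dev; ring.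
have le2 x y z : dev x y z <= 6 -> -2 <= x - y <= 2.
  by move=> h; have := @dev_lt 3 x y z ltac:(lia) ltac:(lia); lia.
have d12 : -2 <= ra - rb <= 2 by apply: le2 tau6.
have d13 : -2 <= ra - rc <= 2 by apply: (le2 _ _ rb); rewrite devC.
have d23 : -2 <= rb - rc <= 2 by apply: (le2 _ _ ra); rewrite -devC'.
move: (dev a1 a2 a3) (dev b1 b2 b3) (dev c1 c2 c3) da db dc le
  => A B C A0 B0 C0 le ABC.
(* Products of the hypotheses with [q - 1] and its square are supplied so that the inequality is
   linear in the remaining monomials once the [t_i] are numbers. *)
have p0 : 0 <= q - 1 by lia.
have := Z.mul_nonneg_nonneg _ _ A0 p0; have := Z.mul_nonneg_nonneg _ _ B0 p0.
have := Z.mul_nonneg_nonneg _ _ C0 p0.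
have p2 := Z.square_nonneg (q - 1).
have := Z.mul_nonneg_nonneg _ _ A0 p2; have := Z.mul_nonneg_nonneg _ _ B0 p2.
have := Z.mul_nonneg_nonneg _ _ C0 p2.
have S0 : 0 <= A + B + C - 6 by lia.
have := Z.mul_nonneg_nonneg _ _ S0 p0; have := Z.mul_nonneg_nonneg _ _ S0 p2.
have {}le := Z.le_trans _ _ _ (Z.mul_le_mono_nonneg_l _ _ 81 ltac:(lia) opt) le.
rewrite E in le.
have raE : ra = 3 * q + (ra - 3 * q) by lia.
have rbE : rb = 3 * q + (rb - 3 * q) by lia.
have rcE : rc = 3 * q + (rc - 3 * q) by lia.
have := sE; rewrite /s => rE.
move: (ra - 3 * q) (rb - 3 * q) (rc - 3 * q) raE rbE rcE => t1 t2 t3 raE rbE rcE.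
rewrite raE rbE rcE in d12 d13 d23 rE tau6.
have r1 : r = t1 + t2 + t3 by lia.
rewrite sE raE rbE rcE in le.
have t1b : -3 <= t1 <= 3 by lia.
move=> m1 m2 m3 m4 m5 m6 m7 m8.
clear - d12 d13 d23 r4 r1 t1b q1 tau6 le m1 m2 m3 m4 m5 m6 m7 m8 p0 p2 A0 B0 C0 S0.
have t2E : t2 = t1 - 2 \/ t2 = t1 - 1 \/ t2 = t1 \/ t2 = t1 + 1 \/ t2 = t1 + 2 by lia.
have t3E : t3 = t1 - 2 \/ t3 = t1 - 1 \/ t3 = t1 \/ t3 = t1 + 1 \/ t3 = t1 + 2 by lia.
have t1E : t1 = -3 \/ t1 = -2 \/ t1 = -1 \/ t1 = 0 \/ t1 = 1 \/ t1 = 2 \/ t1 = 3 by lia.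
case: t1E => [E1|[E1|[E1|[E1|[E1|[E1|E1]]]]]]; subst t1;
(case: t2E => [E2|[E2|[E2|[E2|E2]]]]; subst t2; try (exfalso; lia));
(case: t3E => [E3|[E3|[E3|[E3|E3]]]]; subst t3; try (exfalso; lia));
(match type of r1 with r = ?e =>
   let v := eval vm_compute in e in change e with v in r1 end);
subst r; cbv [opt4_defect dev] in le, tau6; lia.
Qed.

End Region.

(** Schur's inequality, that [x (x - y) (x - z)] and its two analogues have a nonnegative sum,
    rewritten with [dev]. The ordered case is [key]. *)
Lemma schur x y z : 0 <= x -> 0 <= y -> 0 <= z ->
  (x + y + z) * ((x + y + z) * (x + y + z) - 4 * dev x y z) <= 27 * (x * y * z).
Proof.
have key u v w : 0 <= w -> w <= v -> v <= u ->
    0 <= u * ((u - v) * (u - w)) + v * ((v - u) * (v - w)) + w * ((w - u) * (w - v)).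
  move=> w0 wv vu.
  have h1 : 0 <= (u - v) * ((u - v) * (u + v - w)).
    by apply: Z.mul_nonneg_nonneg; [lia | apply: Z.mul_nonneg_nonneg; lia].
  have h2 : 0 <= w * ((u - w) * (v - w)).
    by apply: Z.mul_nonneg_nonneg; [lia | apply: Z.mul_nonneg_nonneg; lia].
  lia.
move=> x0 y0 z0; rewrite /dev.
have [xy|yx] := Z.le_ge_cases x y; have [yz|zy] := Z.le_ge_cases y z;
have [xz|zx] := Z.le_ge_cases x z.
- have := key z y x x0 xy yz; lia.
- have := key z y x x0 xy yz; lia.
- have := key y z x x0 xz zy; lia.
- have := key y x z z0 zx xy; lia.
- have := key z x y y0 yx xz; lia.
- have := key x z y y0 yz zx; lia.
- have := key x y z z0 zy yx; lia.
- have := key x y z z0 zy yx; lia.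
Qed.

Lemma dev_le7 x y z : dev x y z <= 7 -> -3 <= x - y <= 3.
Proof. by move=> h; have := @dev_lt 4 x y z ltac:(lia) ltac:(lia); lia. Qed.

(** If a factor, say [x], is nonpositive, then [|x| <= R1] and [2 |y z| <= y^2 + z^2] settle the
    claim; if all are positive, every term is nonnegative. It controls the column products of
    [K33_poly 3], with [x = 3 a_i - ra] and so on. *)
Lemma triple_product_ge R1 R2 R3 x y z :
  0 <= R1 -> 0 <= R2 -> 0 <= R3 -> - R1 <= x -> - R2 <= y -> - R3 <= z ->
  0 <= 2 * (x * y * z) + R1 * (y * y + z * z) + R2 * (x * x + z * z) + R3 * (x * x + y * y).
Proof.
move=> r1 r2 r3 hx hy hz.
have X := Z.square_nonneg x; have Y := Z.square_nonneg y; have W := Z.square_nonneg z.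
have yz0 : 0 <= y * y + z * z by lia.
have xz0 : 0 <= x * x + z * z by lia.
have xy0 : 0 <= x * x + y * y by lia.
have A1 := Z.mul_nonneg_nonneg _ _ r1 yz0.
have A2 := Z.mul_nonneg_nonneg _ _ r2 xz0.
have A3 := Z.mul_nonneg_nonneg _ _ r3 xy0.
have neg (a b c R : Z) : - R <= a -> a <= 0 -> 0 <= 2 * (a * (b * c)) + R * (b * b + c * c).
  move=> aR a0.
  have s1 := Z.square_nonneg (b - c); have s2 := Z.square_nonneg (b + c).
  have b0 : 0 <= b * b + c * c by lia.
  have s3 : 0 <= (R + a) * (b * b + c * c) by apply: Z.mul_nonneg_nonneg; lia.
  have s4 : 0 <= (- a) * ((b - c) * (b - c)) by apply: Z.mul_nonneg_nonneg; lia.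
  lia.
have [x0|x0] := Z.le_ge_cases x 0.
  by have := neg x y z R1 hx x0; lia.
have [y0|y0] := Z.le_ge_cases y 0.
  by have := neg y x z R2 hy y0; lia.
have [z0|z0] := Z.le_ge_cases z 0.
  by have := neg z x y R3 hz z0; lia.
have : 0 <= x * y * z by apply: Z.mul_nonneg_nonneg => //; apply: Z.mul_nonneg_nonneg.
lia.
Qed.

(** Of the 84 sets of three edges of K33, all but the 6 vertex stars leave it connected, and 243
    times 78 is 26 times 9^3. So nine equal lengths give [243 N_3 = 26 s^3], and the entries are the
    shortfall of the claimed lengths. *)
Definition opt3_defect (r : Z) (s : Z) : Z :=
  match r with
  | -4 => 168 * s - 20 | -3 => 135 * s - 54 | -2 => 123 * s + 38
  | -1 => 78 * s + 52 | 1 => 78 * s - 52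
  | 2 => 123 * s - 38 | 3 => 135 * s + 54 | 4 => 168 * s + 20
  | _ => 0
  end.

Lemma opt_poly3E q r : -4 <= r <= 4 ->
  243 * opt_poly 3 q r =
  26 * ((9 * q + r) * (9 * q + r) * (9 * q + r)) - opt3_defect r (9 * q + r).
Proof.
by move=> r4; residues r;
  cbv [opt_poly K33_poly e2 offset opt3_defect]; ring.
Qed.

Section Region3.
Variables a1 a2 a3 b1 b2 b3 c1 c2 c3 : Z.
Hypotheses (a1_ge0 : 0 <= a1) (a2_ge0 : 0 <= a2) (a3_ge0 : 0 <= a3).
Hypotheses (b1_ge0 : 0 <= b1) (b2_ge0 : 0 <= b2) (b3_ge0 : 0 <= b3).
Hypotheses (c1_ge0 : 0 <= c1) (c2_ge0 : 0 <= c2) (c3_ge0 : 0 <= c3).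

Let ra := a1 + a2 + a3.
Let rb := b1 + b2 + b3.
Let rc := c1 + c2 + c3.
Let s := ra + rb + rc.
Let K k := K33_poly k a1 a2 a3 b1 b2 b3 c1 c2 c3.

(** In terms of [x_i = 3 a_i - ra] and its analogues, the column products leave mixed terms,
    absorbed by squares, and trilinear terms, bounded by [triple_product_ge]. The product [ra rb rc]
    is left with a negative coefficient, and [schur] bounds it from below. *)
Lemma K33_poly3_le :
  243 * K 3 <= 26 * (s * s * s) - 23 * (s * dev ra rb rc)
  - 27 * (dev a1 a2 a3 * (rb + rc) + dev b1 b2 b3 * (ra + rc) + dev c1 c2 c3 * (ra + rb)).
Proof.
have ra0 : 0 <= ra by rewrite /ra; lia.
have rb0 : 0 <= rb by rewrite /rb; lia.
have rc0 : 0 <= rc by rewrite /rc; lia.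
have S := schur ra0 rb0 rc0.
have t1 := @triple_product_ge ra rb rc (3 * a1 - ra) (3 * b1 - rb) (3 * c1 - rc) ra0 rb0 rc0
  ltac:(lia) ltac:(lia) ltac:(lia).
have t2 := @triple_product_ge ra rb rc (3 * a2 - ra) (3 * b2 - rb) (3 * c2 - rc) ra0 rb0 rc0
  ltac:(lia) ltac:(lia) ltac:(lia).
have t3 := @triple_product_ge ra rb rc (3 * a3 - ra) (3 * b3 - rb) (3 * c3 - rc) ra0 rb0 rc0
  ltac:(lia) ltac:(lia) ltac:(lia).
have sq u v x y z x' y' z' : 0 <= u -> v = u * ((x + x') * (x + x') + (y + y') * (y + y')
    + (z + z') * (z + z')) -> 0 <= v.
  move=> u0 ->; apply: Z.mul_nonneg_nonneg => //.
  have := Z.square_nonneg (x + x'); have := Z.square_nonneg (y + y').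
  have := Z.square_nonneg (z + z'); lia.
have qa := sq ra _ (3 * b1 - rb) (3 * b2 - rb) (3 * b3 - rb)
   (3 * c1 - rc) (3 * c2 - rc) (3 * c3 - rc) ra0 erefl.
have qb := sq rb _ (3 * a1 - ra) (3 * a2 - ra) (3 * a3 - ra)
   (3 * c1 - rc) (3 * c2 - rc) (3 * c3 - rc) rb0 erefl.
have qc := sq rc _ (3 * a1 - ra) (3 * a2 - ra) (3 * a3 - ra)
   (3 * b1 - rb) (3 * b2 - rb) (3 * b3 - rb) rc0 erefl.
clear - S t1 t2 t3 qa qb qc.
rewrite /K /s /K33_poly /e2 /dev /ra /rb /rc in S t1 t2 t3 qa qb qc *; lia.
Qed.

(** Here the allowed loss is at most [168 s + 20], while each unit of deviation of the row sums
    costs [23 s], so 8 units are too many. The rows are then bounded case by case, with row sums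
    [3 q + t_i]. *)
Lemma K33_poly3_region q r : s = 9 * q + r -> 1 <= q -> -4 <= r <= 4 ->
  opt_poly 3 q r <= K 3 ->
  dev ra rb rc <= 7 /\ dev a1 a2 a3 + dev b1 b2 b3 + dev c1 c2 c3 <= 8.
Proof.
move=> sE q1 r4 opt.
have le := K33_poly3_le; have E := opt_poly3E q r4.
have da := dev_ge0 a1 a2 a3; have db := dev_ge0 b1 b2 b3; have dc := dev_ge0 c1 c2 c3.
have ra0 : 0 <= ra by rewrite /ra; lia.
have rb0 : 0 <= rb by rewrite /rb; lia.
have rc0 : 0 <= rc by rewrite /rc; lia.
rewrite -sE in E.
have s5 : 5 <= s by lia.
have tau7 : dev ra rb rc <= 7.
  have L : opt3_defect r s <= 168 * s + 20.
    by residues r; cbv [opt3_defect]; lia.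
  have := Z.mul_nonneg_nonneg _ _ da (Z.add_nonneg_nonneg _ _ rb0 rc0).
  have := Z.mul_nonneg_nonneg _ _ db (Z.add_nonneg_nonneg _ _ ra0 rc0).
  have := Z.mul_nonneg_nonneg _ _ dc (Z.add_nonneg_nonneg _ _ ra0 rb0).
  move: (dev ra rb rc) le => tau le m1 m2 m3.
  suff : ~ (8 <= tau) by lia.
  move=> tau8; have p1 : 0 <= tau - 8 by lia.
  have p2 : 0 <= s by lia.
  have := Z.mul_nonneg_nonneg _ _ p1 p2; lia.
split=> //.
suff : ~ (9 <= dev a1 a2 a3 + dev b1 b2 b3 + dev c1 c2 c3) by lia.
have d12 : -3 <= ra - rb <= 3 by apply: (@dev_le7 ra rb rc).
have d13 : -3 <= ra - rc <= 3.
  by apply: (@dev_le7 ra rc rb); rewrite /dev in tau7 *; lia.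
have d23 : -3 <= rb - rc <= 3.
  by apply: (@dev_le7 rb rc ra); rewrite /dev in tau7 *; lia.
move: (dev a1 a2 a3) (dev b1 b2 b3) (dev c1 c2 c3) da db dc le
  => A B C A0 B0 C0 le ABC.
have p0 : 0 <= q - 1 by lia.
have := Z.mul_nonneg_nonneg _ _ A0 p0; have := Z.mul_nonneg_nonneg _ _ B0 p0.
have := Z.mul_nonneg_nonneg _ _ C0 p0.
have S0 : 0 <= A + B + C - 9 by lia.
have := Z.mul_nonneg_nonneg _ _ S0 p0.
have {}le := Z.le_trans _ _ _ (Z.mul_le_mono_nonneg_l _ _ 243 ltac:(lia) opt) le.
rewrite E in le.
have raE : ra = 3 * q + (ra - 3 * q) by lia.
have rbE : rb = 3 * q + (rb - 3 * q) by lia.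
have rcE : rc = 3 * q + (rc - 3 * q) by lia.
have := sE; rewrite /s => rE.
move: (ra - 3 * q) (rb - 3 * q) (rc - 3 * q) raE rbE rcE => t1 t2 t3 raE rbE rcE.
rewrite raE rbE rcE in d12 d13 d23 rE tau7.
have r1 : r = t1 + t2 + t3 by lia.
rewrite sE raE rbE rcE in le.
have t1b : -3 <= t1 <= 3 by lia.
move=> m1 m2 m3 m4.
clear - d12 d13 d23 r4 r1 t1b q1 tau7 le m1 m2 m3 m4 p0 A0 B0 C0 S0.
have t2E : t2 = t1 - 3 \/ t2 = t1 - 2 \/ t2 = t1 - 1 \/ t2 = t1 \/ t2 = t1 + 1
  \/ t2 = t1 + 2 \/ t2 = t1 + 3 by lia.
have t3E : t3 = t1 - 3 \/ t3 = t1 - 2 \/ t3 = t1 - 1 \/ t3 = t1 \/ t3 = t1 + 1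
  \/ t3 = t1 + 2 \/ t3 = t1 + 3 by lia.
have t1E : t1 = -3 \/ t1 = -2 \/ t1 = -1 \/ t1 = 0 \/ t1 = 1 \/ t1 = 2 \/ t1 = 3 by lia.
case: t1E => [E1|[E1|[E1|[E1|[E1|[E1|E1]]]]]]; subst t1;
(case: t2E => [E2|[E2|[E2|[E2|[E2|[E2|E2]]]]]]; subst t2; try (exfalso; lia));
(case: t3E => [E3|[E3|[E3|[E3|[E3|[E3|E3]]]]]]; subst t3; try (exfalso; lia));
(match type of r1 with r = ?e =>
   let v := eval vm_compute in e in change e with v in r1 end);
subst r; cbv [opt3_defect dev] in le, tau7; lia.
Qed.

End Region3.

(** * Finite check of the offsets *)

Definition row : Type := (Z * Z * Z)%type.
Definition row_sum (u : row) := let '(x, y, z) := u in x + y + z.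
Definition row_dev (u : row) := let '(x, y, z) := u in dev x y z.

Definition K33_rows (k : nat) (q : Z) (u v w : row) : Z :=
  let '(a1, a2, a3) := u in let '(b1, b2, b3) := v in let '(c1, c2, c3) := w in
  K33_poly k (q + a1) (q + a2) (q + a3) (q + b1) (q + b2) (q + b3)
             (q + c1) (q + c2) (q + c3).

Definition digits : seq Z := [:: -2; -1; 0; 1; 2].

Definition rows (n : Z) : seq row :=
  [seq u <- [seq (p, z) | p <- [seq (x, y) | x <- digits, y <- digits], z <- digits] | row_dev u <=? n].

Definition in_region (t : Z) (u v w : row) : bool :=
  let r := row_sum u + row_sum v + row_sum w in
  if -4 <=? r then if r <=? 4 then dev (row_sum u) (row_sum v) (row_sum w) <=? t
  else false else false.

(* Nested conditionals rather than boolean connectives: the virtual machine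
   would evaluate both arguments of the latter. *)
Definition for_rows (t n : Z) (P : row -> row -> row -> bool) : bool :=
  all (fun u => all (fun v => if row_dev u + row_dev v <=? n then
    all (fun w => if row_dev u + row_dev v + row_dev w <=? n then
      if in_region t u v w then P u v w else true else true)
     (rows n) else true) (rows n)) (rows n).

Definition entry (u v w : row) (i j : nat) : Z :=
  let '(x, y, z) := nth u [:: u; v; w] i in nth x [:: x; y; z] j.

Definition perms3 : seq (seq nat) :=
  [:: [:: 0; 1; 2]; [:: 0; 2; 1]; [:: 1; 0; 2]; [:: 1; 2; 0]; [:: 2; 0; 1]; [:: 2; 1; 0]]%N.

(** Equality with the pattern up to permuting rows and columns. Each pattern is equivalent to its
    transpose in this sense, so all automorphisms of K33 are accounted for. *)
Definition is_offset (u v w : row) (r : Z) : bool :=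
  has (fun p => has (fun t =>
    all (fun i => all (fun j => entry u v w (nth 0%N p i) (nth 0%N t j) =? offset r i j)
      [:: 0; 1; 2]%N) [:: 0; 1; 2]%N) perms3) perms3.

(** The difference [D] is linear in [q], so [0 <= D 1] and [D 0 <= D 1] yield [0 <= D q] for all
    [q >= 1]. *)
Definition good3 (u v w : row) : bool :=
  let r := row_sum u + row_sum v + row_sum w in
  let D q := opt_poly 3 q r - K33_rows 3 q u v w in
  if 0 <=? D 1 then D 0 <=? D 1 else false.

(** The difference [D] is quadratic in [q]. Either it is positive at 1, does not decrease from 1 to
    2 and is convex, hence positive for all integers [q >= 1]; or it vanishes at three points, hence
    identically, and the offsets must be the claimed ones. *)
Definition good4 (u v w : row) : bool :=
  let r := row_sum u + row_sum v + row_sum w in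
  let D q := opt_poly 4 q r - K33_rows 4 q u v w in
  if if 0 <? D 1 then if D 1 <=? D 2 then 2 * D 1 <=? D 2 + D 0 else false else false
  then true else if D 0 =? 0 then if D 1 =? 0 then if D 2 =? 0 then is_offset u v w r
  else false else false else false.

Lemma check3 : for_rows 7 8 good3.
Proof. by vm_compute. Qed.

Lemma check4 : for_rows 6 5 good4.
Proof. by vm_compute. Qed.

Lemma mem_digits (x : Z) : (x \in digits) = (-2 <=? x) && (x <=? 2).
Proof.
apply/idP/idP => [|h]; first by rewrite !inE => /or4P[/eqP->|/eqP->|/eqP->|/orP[]/eqP->].
have : x = -2 \/ x = -1 \/ x = 0 \/ x = 1 \/ x = 2 by lia.
by case=> [->|[->|[->|[->|->]]]].
Qed.

Lemma for_rowsP t n P (u v w : row) : for_rows t n P ->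
  let '(a1, a2, a3) := u in let '(b1, b2, b3) := v in let '(c1, c2, c3) := w in
  all (fun x => x \in digits) [:: a1; a2; a3; b1; b2; b3; c1; c2; c3] ->
  row_dev u + row_dev v + row_dev w <= n ->
  -4 <= row_sum u + row_sum v + row_sum w <= 4 ->
  dev (row_sum u) (row_sum v) (row_sum w) <= t -> P u v w.
Proof.
case: u => -[a1 a2] a3; case: v => -[b1 b2] b3; case: w => -[c1 c2] c3.
move=> chk /=; set u := (a1, a2, a3); set v := (b1, b2, b3); set w := (c1, c2, c3).
case/and5P=> A1 A2 A3 B1 /and5P[B2 B3 C1 C2 /andP[C3 _]] dn s4 dt.
have du := dev_ge0 a1 a2 a3; have dv := dev_ge0 b1 b2 b3; have dw := dev_ge0 c1 c2 c3.
have mem x y z : x \in digits -> y \in digits -> z \in digits -> dev x y z <= n ->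
    (x, y, z) \in rows n.
  move=> xd yd zd h; rewrite mem_filter; apply/andP; split; first exact/Z.leb_le.
  apply/allpairsP; exists ((x, y), z); split=> //.
  by apply/allpairsP; exists (x, y).
have uR : u \in rows n by apply: mem => //; clear -du dv dw dn; rewrite /= in dn; lia.
have vR : v \in rows n by apply: mem => //; clear -du dv dw dn; rewrite /= in dn; lia.
have wR : w \in rows n by apply: mem => //; clear -du dv dw dn; rewrite /= in dn; lia.
have := allP (allP chk u uR) v vR.
have -> : (row_dev u + row_dev v <=? n) = true.
  by apply/Z.leb_le; clear -du dv dw dn; rewrite /= in dn *; lia.
move/allP/(_ w wR); move/Z.leb_le: dn => ->.
have -> // : in_region t u v w = true.
rewrite /in_region; case: s4 => /Z.leb_le-> /Z.leb_le->.
exact/Z.leb_le.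
Qed.

(* The terms in q^4 and q^3 only depend on the sum of the offsets, so that a difference of
   two such polynomials with equal sums is quadratic in q. *)
Lemma interpolation4 q (u v w : row) :
  let K x := K33_rows 4 x u v w in let s := row_sum u + row_sum v + row_sum w in
  2 * (K q - 81 * q * q * q * q - 36 * q * q * q * s) =
  K 0 * ((q - 1) * (q - 2)) - 2 * (K 1 - 81 - 36 * s) * (q * (q - 2))
  + (K 2 - 1296 - 288 * s) * (q * (q - 1)).
Proof.
case: u => -[a1 a2] a3; case: v => -[b1 b2] b3; case: w => -[c1 c2] c3.
cbv [K33_rows K33_poly e2 row_sum]; ring.
Qed.

Lemma interpolation3 q (u v w : row) :
  let K x := K33_rows 3 x u v w in let s := row_sum u + row_sum v + row_sum w in
  K q - 78 * q * q * q - 26 * q * q * s = K 0 * (1 - q) + (K 1 - 78 - 26 * s) * q.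
Proof.
case: u => -[a1 a2] a3; case: v => -[b1 b2] b3; case: w => -[c1 c2] c3.
cbv [K33_rows K33_poly e2 row_sum]; ring.
Qed.

Definition offset_row r i : row := (offset r i 0, offset r i 1, offset r i 2).

Lemma offset_sum r : -4 <= r <= 4 ->
  row_sum (offset_row r 0) + row_sum (offset_row r 1) + row_sum (offset_row r 2) = r.
Proof. by move=> r4; residues r. Qed.

Lemma opt_rows k q r : opt_poly k q r =
  K33_rows k q (offset_row r 0) (offset_row r 1) (offset_row r 2).
Proof. by []. Qed.

Section Best.
Variables (q r a1 a2 a3 b1 b2 b3 c1 c2 c3 : Z).
Hypotheses (a1_ge0 : 0 <= a1) (a2_ge0 : 0 <= a2) (a3_ge0 : 0 <= a3).
Hypotheses (b1_ge0 : 0 <= b1) (b2_ge0 : 0 <= b2) (b3_ge0 : 0 <= b3).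
Hypotheses (c1_ge0 : 0 <= c1) (c2_ge0 : 0 <= c2) (c3_ge0 : 0 <= c3).
Hypotheses (r4 : -4 <= r <= 4) (q_ge1 : 1 <= q).
Hypothesis sE : a1 + a2 + a3 + (b1 + b2 + b3) + (c1 + c2 + c3) = 9 * q + r.

Let u : row := (a1 - q, a2 - q, a3 - q).
Let v : row := (b1 - q, b2 - q, b3 - q).
Let w : row := (c1 - q, c2 - q, c3 - q).

Lemma K33_rowsE k : K33_rows k q u v w = K33_poly k a1 a2 a3 b1 b2 b3 c1 c2 c3.
Proof. by rewrite /K33_rows /u /v /w !Zplus_minus. Qed.

Lemma row_sums : row_sum u + row_sum v + row_sum w = r.
Proof. rewrite /=; lia. Qed.

Lemma dev_shift x y z : dev (x - q) (y - q) (z - q) = dev x y z.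
Proof. rewrite /dev; ring. Qed.

Lemma dev_shift3 x y z : dev (x - 3 * q) (y - 3 * q) (z - 3 * q) = dev x y z.
Proof. rewrite /dev; ring. Qed.

(** The range of [digits] comes from here. Row sums differ by at most 3 and [|r| <= 4], so each is
    within 10/3, hence within 3, of [3 q]. A row deviation of at most 8 gives [|2 x - y - z| <= 5].
    Thus [3 (x - q)] is at most 8 in absolute value and [|x - q| <= 2]. *)
Lemma apply_check t n P : t <= 7 -> n <= 8 -> for_rows t n P ->
  dev (a1 + a2 + a3) (b1 + b2 + b3) (c1 + c2 + c3) <= t ->
  dev a1 a2 a3 + dev b1 b2 b3 + dev c1 c2 c3 <= n -> P u v w.
Proof.
move=> t7 n8 chk dt dn.
have da := dev_ge0 a1 a2 a3; have db := dev_ge0 b1 b2 b3; have dc := dev_ge0 c1 c2 c3.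
have dt7 : dev (a1 + a2 + a3) (b1 + b2 + b3) (c1 + c2 + c3) <= 7 by lia.
have s12 := dev_le7 dt7.
have s13 : -3 <= (a1 + a2 + a3) - (c1 + c2 + c3) <= 3.
  by apply: (@dev_le7 _ _ (b1 + b2 + b3)); rewrite /dev in dt7 *; lia.
have mid x y z : dev x y z <= 8 -> -5 <= 2 * x - y - z <= 5.
  move=> h; have := Z.square_nonneg (y - z); rewrite /dev in h => h2.
  suff : ~ (6 <= 2 * x - y - z) /\ ~ (6 <= y + z - 2 * x) by lia.
  split=> d.
    have d0 : 0 <= 2 * x - y - z - 6 by lia.
    have := Z.mul_nonneg_nonneg _ _ d0 d0; lia.
  have d0 : 0 <= y + z - 2 * x - 6 by lia.
  have := Z.mul_nonneg_nonneg _ _ d0 d0; lia.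
have C x y z : dev x y z = dev y x z by rewrite /dev; ring.
have C' x y z : dev x y z = dev z x y by rewrite /dev; ring.
have ma1 : -5 <= 2 * a1 - a2 - a3 <= 5 by apply: mid; lia.
have ma2 : -5 <= 2 * a2 - a1 - a3 <= 5 by apply: mid; rewrite C; lia.
have ma3 : -5 <= 2 * a3 - a1 - a2 <= 5 by apply: mid; rewrite -C'; lia.
have mb1 : -5 <= 2 * b1 - b2 - b3 <= 5 by apply: mid; lia.
have mb2 : -5 <= 2 * b2 - b1 - b3 <= 5 by apply: mid; rewrite C; lia.
have mb3 : -5 <= 2 * b3 - b1 - b2 <= 5 by apply: mid; rewrite -C'; lia.
have mc1 : -5 <= 2 * c1 - c2 - c3 <= 5 by apply: mid; lia.
have mc2 : -5 <= 2 * c2 - c1 - c3 <= 5 by apply: mid; rewrite C; lia.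
have mc3 : -5 <= 2 * c3 - c1 - c2 <= 5 by apply: mid; rewrite -C'; lia.
have s23 : -3 <= (b1 + b2 + b3) - (c1 + c2 + c3) <= 3.
  by apply: (@dev_le7 _ _ (a1 + a2 + a3)); rewrite /dev in dt7 *; lia.
clear mid C C' da db dc dt7.
have {chk} := @for_rowsP t n P u v w chk; cbv beta iota zeta delta [u v w].
apply.
- rewrite /= !mem_digits; repeat (apply/andP; split); try exact: isT; apply/Z.leb_le;
  clear -ma1 ma2 ma3 mb1 mb2 mb3 mc1 mc2 mc3 s12 s13 s23 sE r4; lia.
- by rewrite /row_dev !dev_shift.
- by have := row_sums; rewrite /u /v /w => ->.
move: dt; rewrite -(dev_shift3 (a1 + a2 + a3)) /row_sum.
have E x y z : x + y + z - 3 * q = x - q + (y - q) + (z - q) by ring.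
by rewrite !E.
Qed.

Lemma K33_poly3_opt : K33_poly 3 a1 a2 a3 b1 b2 b3 c1 c2 c3 <= opt_poly 3 q r.
Proof.
have [opt|] := Z.le_gt_cases (opt_poly 3 q r) (K33_poly 3 a1 a2 a3 b1 b2 b3 c1 c2 c3);
  last by lia.
have [dt dn] := K33_poly3_region a1_ge0 a2_ge0 a3_ge0 b1_ge0 b2_ge0 b3_ge0
  c1_ge0 c2_ge0 c3_ge0 sE q_ge1 r4 opt.
have := @apply_check 7 8 good3 ltac:(lia) ltac:(lia) check3 dt dn.
rewrite -K33_rowsE /good3 row_sums !opt_rows.
have := interpolation3 q (offset_row r 0) (offset_row r 1) (offset_row r 2).
rewrite (offset_sum r4); have := interpolation3 q u v w; rewrite row_sums.
move: (K33_rows 3) => K; case: ifP => // h1 E1 E2 h2.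
have : 0 <= (q - 1) * (K 1 (offset_row r 0) (offset_row r 1) (offset_row r 2) - K 1 u v w
   - (K 0 (offset_row r 0) (offset_row r 1) (offset_row r 2) - K 0 u v w)).
  by apply: Z.mul_nonneg_nonneg; lia.
lia.
Qed.

Lemma K33_poly4_opt :
  K33_poly 4 a1 a2 a3 b1 b2 b3 c1 c2 c3 < opt_poly 4 q r \/
  K33_poly 4 a1 a2 a3 b1 b2 b3 c1 c2 c3 = opt_poly 4 q r /\ is_offset u v w r.
Proof.
have [opt|] := Z.le_gt_cases (opt_poly 4 q r) (K33_poly 4 a1 a2 a3 b1 b2 b3 c1 c2 c3);
  last by left; lia.
have [dt dn] := K33_poly4_region a1_ge0 a2_ge0 a3_ge0 b1_ge0 b2_ge0 b3_ge0
  c1_ge0 c2_ge0 c3_ge0 sE q_ge1 r4 opt.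
have := @apply_check 6 5 good4 ltac:(lia) ltac:(lia) check4 dt dn.
rewrite -K33_rowsE /good4 row_sums !opt_rows.
have := interpolation4 q (offset_row r 0) (offset_row r 1) (offset_row r 2).
rewrite (offset_sum r4); have := interpolation4 q u v w; rewrite row_sums.
move: (K33_rows 4) => K E1 E2.
set D0 := K 0 _ _ _ - K 0 u v w; set D1 := K 1 _ _ _ - K 1 u v w.
set D2 := K 2 _ _ _ - K 2 u v w.
(* Newton's form of the interpolation, based at 1: value, first difference and second difference. *)
have E : 2 * (K q (offset_row r 0) (offset_row r 1) (offset_row r 2) - K q u v w) =
    2 * D1 + 2 * ((q - 1) * (D2 - D1)) + (q - 1) * (q - 2) * (D2 + D0 - 2 * D1).
  by rewrite /D0 /D1 /D2; clear -E1 E2; lia.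
clearbody D0 D1 D2; clear -E q_ge1; case: ifP => [h _|_].
  left; have {h} [h1 [h2 h3]] : 0 < D1 /\ D1 <= D2 /\ 2 * D1 <= D2 + D0.
    by move: h; case: ifP => // /Z.ltb_lt ?; case: ifP => // /Z.leb_le ? /Z.leb_le.
  have m1 : 0 <= (q - 1) * (D2 - D1) by apply: Z.mul_nonneg_nonneg; lia.
  have m2 : 0 <= (q - 1) * (q - 2).
    have [-> //|q2] : q = 1 \/ 2 <= q by lia.
    by apply: Z.mul_nonneg_nonneg; lia.
  have m3 : 0 <= (q - 1) * (q - 2) * (D2 + D0 - 2 * D1).
    by apply: Z.mul_nonneg_nonneg; lia.
  lia.
case: ifP => // /Z.eqb_eq e0; case: ifP => // /Z.eqb_eq e1; case: ifP => // /Z.eqb_eq e2 off.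
by right; split=> //; rewrite e0 e1 e2 in E; lia.
Qed.

End Best.

(* Here (s + 4) / 9 and the remainder are the q and r of the theorem for m = s. *)
Definition opt_at (k : nat) (s : Z) : Z := opt_poly k ((s + 4) / 9) (s - 9 * ((s + 4) / 9)).

Lemma opt_atE k q r : -4 <= r <= 4 -> opt_at k (9 * q + r) = opt_poly k q r.
Proof.
move=> r4; rewrite /opt_at.
have -> : (9 * q + r + 4) / 9 = q.
  by symmetry; apply: (Z.div_unique _ _ _ (r + 4)); lia.
by congr (opt_poly k q); lia.
Qed.

Lemma residueP s : exists q r, s = 9 * q + r /\ -4 <= r <= 4.
Proof.
exists ((s + 4) / 9), (s - 9 * ((s + 4) / 9)).
have := Z.mod_pos_bound (s + 4) 9 ltac:(lia).
have := Z.div_mod (s + 4) 9 ltac:(lia); lia.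
Qed.

Lemma residue_succ q r s : s = 9 * q + r -> -4 <= r <= 4 ->
  exists q' r', s + 1 = 9 * q' + r' /\ -4 <= r' <= 4 /\
    (r' = r + 1 /\ q' = q \/ r = 4 /\ r' = -4 /\ q' = q + 1).
Proof.
move=> sE r4; have [r3|r3] : r <= 3 \/ r = 4 by lia.
  by exists q, (r + 1); lia.
by exists (q + 1), (-4); lia.
Qed.

Lemma opt_poly2E q r : -4 <= r <= 4 ->
  2 * opt_poly 2 q r = 72 * q * q + 16 * q * r + r * r - Z.abs r.
Proof.
by move=> r4; residues r; cbv [opt_poly K33_poly e2 offset Z.abs]; ring.
Qed.

Lemma opt_poly1E q r : -4 <= r <= 4 -> opt_poly 1 q r = 9 * q + r.
Proof. by move=> r4; residues r; cbv [opt_poly K33_poly offset]; ring. Qed.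

Lemma opt_at_step k s : 0 <= s -> (k <= 4)%N -> opt_at k s <= opt_at k (s + 1).
Proof.
move=> s0 k4; have [q [r [sE r4]]] := residueP s.
have q0 : 0 <= q by lia.
have rq : q = 0 -> 0 <= r by lia.
have [q' [r' [s'E [r4' qr]]]] := residue_succ sE r4.
rewrite s'E sE !opt_atE //; case: k k4 => [|[|[|[|[|k]]]]] // _.
- by rewrite !opt_poly1E //; lia.
- suff : 2 * opt_poly 2 q r <= 2 * opt_poly 2 q' r' by lia.
  rewrite !opt_poly2E //; case: qr => [[-> ->]|[-> [-> ->]]]; last by lia.
  have [r0|r0] : 0 <= r \/ r + 1 <= 0 by lia.
    rewrite !Z.abs_eq; nia.
  rewrite !Z.abs_neq; nia.
- suff : 243 * opt_poly 3 q r <= 243 * opt_poly 3 q' r' by lia.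
  rewrite !opt_poly3E // -sE -s'E.
  have s2 : 0 <= s * (s - 1) by nia.
  have s3 : 4 <= s -> 0 <= (s - 4) * s by nia.
  have rs : 0 < r -> r <= s by lia.
  have s4 : r < 0 -> 5 <= s by lia.
  clear -qr r4 r4' s0 s2 s3 rs s4.
  by residues r; residues r'; try (exfalso; lia); cbv [opt3_defect]; lia.
suff : 81 * opt_poly 4 q r <= 81 * opt_poly 4 q' r' by lia.
rewrite !opt_poly4E // -sE -s'E.
have s2 : 0 <= s * (s - 1) by nia.
have s3 : 0 <= s * s * (s - 3) + 2 * s * s by nia.
have rs : 0 < r -> r <= s by lia.
have s4 : r < 0 -> 5 <= s by lia.
have m2 : 3 <= s -> 0 <= (s - 3) * s by nia.
have m3 : 3 <= s -> 0 <= (s - 3) * s * s by nia.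
clear -qr r4 r4' s0 s2 s3 rs s4 m2 m3.
by residues r; residues r'; try (exfalso; lia); cbv [opt4_defect]; lia.
Qed.

(** The bound on [s] is sharp: a total length below 4 admits no set of four edges, so all earlier
    values are 0. *)
Lemma opt_at4_step s : 3 <= s -> opt_at 4 s < opt_at 4 (s + 1).
Proof.
move=> s3; have [q [r [sE r4]]] := residueP s.
have [q' [r' [s'E [r4' qr]]]] := residue_succ sE r4.
rewrite s'E sE !opt_atE //.
suff : 81 * opt_poly 4 q r < 81 * opt_poly 4 q' r' by lia.
rewrite !opt_poly4E // -sE -s'E.
have m2 : 0 <= (s - 3) * s by nia.
have m3 : 0 <= (s - 3) * s * s by nia.
clear -qr r4 r4' s3 m2 m3.
by residues r; residues r'; try (exfalso; lia); cbv [opt4_defect]; lia.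
Qed.

Fixpoint for_sums (k n : nat) (P : seq nat -> bool) : bool :=
  if k is k'.+1 then
    all (fun x => for_sums k' (n - x)%N (fun t => P (x :: t))) (iota 0 n.+1)
  else P [::].

Lemma for_sumsP k n P t : for_sums k n P -> size t = k -> (sumn t <= n)%N -> P t.
Proof.
elim: k n P t => [|k IHk] n P [|x t] // /allP chk [st] le; rewrite /= in le.
apply: (IHk (n - x)%N (fun t => P (x :: t))) => //; last first.
  by rewrite leq_subRL ?(leq_trans (leq_addr _ _) le).
by apply: chk; rewrite mem_iota add0n ltnS (leq_trans (leq_addr _ _) le).
Qed.

Definition poly_of (k : nat) (t : seq nat) : Z :=
  let x i := Z.of_nat (nth 0%N t i) in
  K33_poly k (x 0%N) (x 1%N) (x 2%N) (x 3%N) (x 4%N) (x 5%N) (x 6%N) (x 7%N) (x 8%N).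

(** Totals up to 4 have quotient 0 and remainder equal to the total. The bounds by deviations start
    at [q = 1], so these tuples are enumerated. *)
Definition small_ok (t : seq nat) : bool :=
  let r := Z.of_nat (sumn t) in
  if poly_of 3 t <=? opt_poly 3 0 r then poly_of 4 t <=? opt_poly 4 0 r else false.

Lemma check_small : for_sums 9 4 small_ok.
Proof. by vm_compute. Qed.

Section Entries.
Variables a1 a2 a3 b1 b2 b3 c1 c2 c3 : Z.
Hypotheses (a1_ge0 : 0 <= a1) (a2_ge0 : 0 <= a2) (a3_ge0 : 0 <= a3).
Hypotheses (b1_ge0 : 0 <= b1) (b2_ge0 : 0 <= b2) (b3_ge0 : 0 <= b3).
Hypotheses (c1_ge0 : 0 <= c1) (c2_ge0 : 0 <= c2) (c3_ge0 : 0 <= c3).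
Let s := a1 + a2 + a3 + (b1 + b2 + b3) + (c1 + c2 + c3).

(** No two edges form a cut, so [2 N_2] is [s^2] minus the sum of the squares. For integers
    [(x - p) (x - p - 1) >= 0], which bounds each square by a linear function that is tight at [p]
    and [p + 1]; [p] is [q] or [q - 1] according to the sign of [r]. *)
Lemma K33_poly2_opt :
  K33_poly 2 a1 a2 a3 b1 b2 b3 c1 c2 c3 <= opt_at 2 s.
Proof.
have [q [r [sE r4]]] := residueP s; rewrite sE opt_atE //.
suff : 2 * K33_poly 2 a1 a2 a3 b1 b2 b3 c1 c2 c3 <= 2 * opt_poly 2 q r by lia.
rewrite opt_poly2E //.
have E : 2 * K33_poly 2 a1 a2 a3 b1 b2 b3 c1 c2 c3 = s * s
  - (a1 * a1 + a2 * a2 + a3 * a3 + b1 * b1 + b2 * b2 + b3 * b3 + c1 * c1 + c2 * c2 + c3 * c3).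
  by rewrite /K33_poly /e2 /s; ring.
rewrite {}E.
have sq p x : x * x >= (2 * p + 1) * x - p * (p + 1).
  have [h|h] : x <= p \/ p + 1 <= x by lia.
    have : 0 <= (p - x) * (p + 1 - x) by apply: Z.mul_nonneg_nonneg; lia.
    lia.
  have : 0 <= (x - p) * (x - p - 1) by apply: Z.mul_nonneg_nonneg; lia.
  lia.
have tot p : a1 * a1 + a2 * a2 + a3 * a3 + b1 * b1 + b2 * b2 + b3 * b3 + c1 * c1
    + c2 * c2 + c3 * c3 >= (2 * p + 1) * s - 9 * (p * (p + 1)).
  have := sq p a1; have := sq p a2; have := sq p a3; have := sq p b1; have := sq p b2.
  have := sq p b3; have := sq p c1; have := sq p c2; have := sq p c3; rewrite /s; lia.
have [r0|r0] : 0 <= r \/ r < 0 by lia.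
  have := tot q; rewrite sE Z.abs_eq //; lia.
have := tot (q - 1); rewrite sE Z.abs_neq; lia.
Qed.

Lemma K33_poly_opt_at k : (k <= 4)%N ->
  K33_poly k a1 a2 a3 b1 b2 b3 c1 c2 c3 <= opt_at k s.
Proof.
case: k => [|[|[|k]]] k4.
- by [].
- have [q [r [sE r4]]] := residueP s; rewrite sE opt_atE // opt_poly1E //.
  by rewrite -sE /s /=; lia.
- exact: K33_poly2_opt.
have [q [r [sE r4]]] := residueP s; rewrite sE opt_atE //.
have [q1|q0] : 1 <= q \/ q <= 0 by rewrite /s in sE; lia.
  case: k k4 => [|[|k]] // _; first exact: K33_poly3_opt sE.
  have := K33_poly4_opt a1_ge0 a2_ge0 a3_ge0 b1_ge0 b2_ge0 b3_ge0 c1_ge0 c2_ge0 c3_ge0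
    r4 q1 sE.
  by case=> [|[-> _]]; lia.
have q0E : q = 0 by rewrite /s in sE; lia.
pose t := [seq Z.to_nat x | x <- [:: a1; a2; a3; b1; b2; b3; c1; c2; c3]].
have tE : Z.of_nat (sumn t) = r.
  rewrite /t /= !Nat2Z.inj_add !Z2Nat.id //.
  by rewrite q0E in sE; rewrite /s in sE; lia.
have t4 : (sumn t <= 4)%N by lia.
have := for_sumsP check_small (erefl : size t = 9%N) t4.
rewrite /small_ok /poly_of tE /t [nth]lock /= -lock /= !Z2Nat.id // q0E.
by case: ifP => // /Z.leb_le h3 /Z.leb_le h4; case: k k4 => [|[|k]].
Qed.

Lemma K33_poly4_unique q r : s = 9 * q + r -> 5 <= s -> -4 <= r <= 4 ->
  K33_poly 4 a1 a2 a3 b1 b2 b3 c1 c2 c3 = opt_at 4 s ->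
  is_offset (a1 - q, a2 - q, a3 - q) (b1 - q, b2 - q, b3 - q) (c1 - q, c2 - q, c3 - q) r.
Proof.
move=> sE s5 r4; rewrite sE opt_atE // => E.
have q1 : 1 <= q by lia.
have := K33_poly4_opt a1_ge0 a2_ge0 a3_ge0 b1_ge0 b2_ge0 b3_ge0 c1_ge0 c2_ge0 c3_ge0
    r4 q1 sE.
by case=> [|[_ //]]; lia.
Qed.

End Entries.

(* Star-triangle transformation of both triangles turns the prism into a theta
   graph whose three chains have lengths rho_k / (X Y). *)
Lemma prism_poly4E x1 x2 x3 y1 y2 y3 z1 z2 z3 :
  let X := x1 + x2 + x3 in let Y := y1 + y2 + y3 in
  let rho1 := Y * (x2 * x3) + X * Y * z1 + X * (y2 * y3) in
  let rho2 := Y * (x1 * x3) + X * Y * z2 + X * (y1 * y3) in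
  let rho3 := Y * (x1 * x2) + X * Y * z3 + X * (y1 * y2) in
  X * Y * prism_poly 4 x1 x2 x3 y1 y2 y3 z1 z2 z3 = e2 rho1 rho2 rho3.
Proof. by cbv [prism_poly e2]; ring. Qed.

(** The totals below the threshold of the asymptotic estimate. Here [e2] of a triangle is an integer
    and at most a third of the squared total, hence the rounded quotients; the rungs are positive,
    so their total starts at 3. *)
Definition prism_small_ok : bool :=
  all (fun X => all (fun Y => all (fun Z =>
    let x := Z.of_nat X in let y := Z.of_nat Y in let z := Z.of_nat Z in
    if (X + Y + Z <= 15)%N then
      let u := y * (x * x / 3) + x * y * z + x * (y * y / 3) in
      u * u <? 3 * (x * y) * opt_at 4 (x + y + z) else true)
    (iota 3 12)) (iota 1 12)) (iota 1 12).

Lemma check_prism : prism_small_ok.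
Proof. by vm_compute. Qed.

Section Prism.
Variables x1 x2 x3 y1 y2 y3 z1 z2 z3 : Z.
Hypotheses (x1_ge0 : 0 <= x1) (x2_ge0 : 0 <= x2) (x3_ge0 : 0 <= x3).
Hypotheses (y1_ge0 : 0 <= y1) (y2_ge0 : 0 <= y2) (y3_ge0 : 0 <= y3).
Hypotheses (z1_ge0 : 0 <= z1) (z2_ge0 : 0 <= z2) (z3_ge0 : 0 <= z3).
Let X := x1 + x2 + x3.
Let Y := y1 + y2 + y3.
Let W := z1 + z2 + z3.
Let s := X + Y + W.
Let P k := prism_poly k x1 x2 x3 y1 y2 y3 z1 z2 z3.

Lemma prism_poly4_le (A B : Z) : e2 x1 x2 x3 <= A -> e2 y1 y2 y3 <= B ->
  3 * (X * Y) * P 4 <= (Y * A + X * Y * W + X * B) * (Y * A + X * Y * W + X * B).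
Proof.
move=> xA yB.
have X0 : 0 <= X by rewrite /X; lia.
have Y0 : 0 <= Y by rewrite /Y; lia.
have Z0 : 0 <= W by rewrite /W; lia.
have := prism_poly4E x1 x2 x3 y1 y2 y3 z1 z2 z3; cbv zeta; rewrite -/X -/Y.
set r1 := _ + X * (y2 * y3); set r2 := _ + X * (y1 * y3); set r3 := _ + X * (y1 * y2).
move=> E.
have h : 3 * e2 r1 r2 r3 <= (r1 + r2 + r3) * (r1 + r2 + r3).
  by have := dev_ge0 r1 r2 r3; rewrite /dev /e2; lia.
have sumE : r1 + r2 + r3 = Y * e2 x1 x2 x3 + X * Y * W + X * e2 y1 y2 y3.
  by rewrite /r1 /r2 /r3 /W /e2; ring.
have e0 := e2_ge0 x1_ge0 x2_ge0 x3_ge0; have f0 := e2_ge0 y1_ge0 y2_ge0 y3_ge0.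
have m1 := Z.mul_le_mono_nonneg_l _ _ Y Y0 xA.
have m2 := Z.mul_le_mono_nonneg_l _ _ X X0 yB.
have m3 := Z.mul_nonneg_nonneg _ _ Y0 e0; have m4 := Z.mul_nonneg_nonneg _ _ X0 f0.
have m5 := Z.mul_nonneg_nonneg _ _ (Z.mul_nonneg_nonneg _ _ X0 Y0) Z0.
have : (r1 + r2 + r3) * (r1 + r2 + r3) <=
    (Y * A + X * Y * W + X * B) * (Y * A + X * Y * W + X * B).
  by apply: Z.mul_le_mono_nonneg; lia.
by rewrite /P; lia.
Qed.

Lemma e2_le_third x y z : 3 * e2 x y z <= (x + y + z) * (x + y + z).
Proof. by have := dev_ge0 x y z; rewrite /dev /e2; lia. Qed.

(** Bounding [e2] by a third of a square, for the chains of the theta graph and for both triangles,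
    gives [27 P 4 <= X Y (X + Y + 3 W)^2]. With total [s] the right side is largest at
    [X = Y = 3 s / 8]. Hence [P 4 <= 3 s^4 / 256], while the optimum is about [s^4 / 81]. *)
Lemma prism_poly4_opt : 1 <= z1 -> 1 <= z2 -> 1 <= z3 -> 4 <= s -> P 4 < opt_at 4 s.
Proof.
move=> h1 h2 h3 s4.
have X0 : 0 <= X by rewrite /X; lia.
have Y0 : 0 <= Y by rewrite /Y; lia.
have opt0 : 1 <= opt_at 4 s.
  suff : forall n, 1 <= opt_at 4 (4 + Z.of_nat n).
    by move/(_ (Z.to_nat (s - 4))); rewrite Z2Nat.id; [rewrite Zplus_minus | lia].
  elim=> [//|n IHn]; have := @opt_at_step 4 (4 + Z.of_nat n) ltac:(lia) isT.
  by rewrite (_ : 4 + Z.of_nat n.+1 = 4 + Z.of_nat n + 1); lia.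
have [XE|X1] : X = 0 \/ 1 <= X by lia.
  rewrite /P; have [-> [-> ->]] : x1 = 0 /\ x2 = 0 /\ x3 = 0 by rewrite /X in XE; lia.
  by rewrite (_ : prism_poly _ _ _ _ _ _ _ _ _ _ = 0); [lia | rewrite /prism_poly /e2; ring].
have [YE|Y1] : Y = 0 \/ 1 <= Y by lia.
  rewrite /P; have [-> [-> ->]] : y1 = 0 /\ y2 = 0 /\ y3 = 0 by rewrite /Y in YE; lia.
  by rewrite (_ : prism_poly _ _ _ _ _ _ _ _ _ _ = 0); [lia | rewrite /prism_poly /e2; ring].
have XY : 1 <= X * Y by nia.
(* At 16 the gap between [s^4 / 81] and [3 s^4 / 256] first exceeds the bound [12 s^2 / 81] on the
   loss of the optimum: this means [13 s^2 > 12 * 256]. *)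
have [s15|s16] : s <= 15 \/ 16 <= s by lia.
  have thx : e2 x1 x2 x3 <= X * X / 3.
    by apply: Z.div_le_lower_bound; [lia|]; apply: e2_le_third.
  have thy : e2 y1 y2 y3 <= Y * Y / 3.
    by apply: Z.div_le_lower_bound; [lia|]; apply: e2_le_third.
  have le := prism_poly4_le thx thy.
  have Z3 : 3 <= W by rewrite /W; lia.
  have mX : Z.to_nat X \in iota 1 12 by rewrite mem_iota; rewrite /s in s15; lia.
  have mY : Z.to_nat Y \in iota 1 12 by rewrite mem_iota; rewrite /s in s15; lia.
  have mZ : Z.to_nat W \in iota 3 12 by rewrite mem_iota; rewrite /s in s15; lia.
  have := allP (allP (allP check_prism _ mX) _ mY) _ mZ.
  have -> : (Z.to_nat X + Z.to_nat Y + Z.to_nat W <= 15)%N by rewrite /s in s15; lia.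
  rewrite !Z2Nat.id //; [|by lia]; rewrite -/s => /Z.ltb_lt lt.
  have {}lt := Z.le_lt_trans _ _ _ le lt.
  by apply/(Z.mul_lt_mono_pos_l (3 * (X * Y))); [lia | exact: lt].
have le : 27 * P 4 <= X * Y * ((X + Y + 3 * W) * (X + Y + 3 * W)).
  have thx : 3 * e2 x1 x2 x3 <= X * X by apply: e2_le_third.
  have thy : 3 * e2 y1 y2 y3 <= Y * Y by apply: e2_le_third.
  have := @prism_poly4_le (e2 x1 x2 x3) (e2 y1 y2 y3) ltac:(lia) ltac:(lia).
  set A := e2 x1 x2 x3 in thx *; set B := e2 y1 y2 y3 in thy *.
  have A0 : 0 <= A by apply: e2_ge0.
  have B0 : 0 <= B by apply: e2_ge0.
  have Z0 : 0 <= W by rewrite /W; lia.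
  clearbody A B; move=> le.
  have m1 := Z.mul_le_mono_nonneg_l _ _ Y Y0 thx.
  have m2 := Z.mul_le_mono_nonneg_l _ _ X X0 thy.
  have n1 := Z.mul_nonneg_nonneg _ _ Y0 A0; have n2 := Z.mul_nonneg_nonneg _ _ X0 B0.
  have n3 := Z.mul_nonneg_nonneg _ _ (Z.mul_nonneg_nonneg _ _ X0 Y0) Z0.
  have sq : (3 * (Y * A + X * Y * W + X * B)) * (3 * (Y * A + X * Y * W + X * B)) <=
     (X * Y * (X + Y + 3 * W)) * (X * Y * (X + Y + 3 * W)).
    by apply: Z.mul_le_mono_nonneg; lia.
  apply/(Z.mul_le_mono_pos_l _ _ (X * Y)); first by lia.
  rewrite (_ : X * Y * (X * Y * _) = X * Y * (X + Y + 3 * W) * (X * Y * (X + Y + 3 * W)));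
    last by ring.
  by apply: Z.le_trans sq; clear -le; lia.
have le2 : 256 * P 4 <= 3 * (s * s * (s * s)).
  have ZE : X + Y + 3 * W = 3 * s - 2 * (X + Y) by rewrite /s; ring.
  rewrite ZE in le; set U := X + Y in le *.
  have U0 : 0 <= U * (3 * s - 2 * U).
    by apply: Z.mul_nonneg_nonneg; rewrite /U /s; have : 0 <= W by [rewrite /W; lia|]; lia.
  have amgm : 4 * (X * Y) <= U * U by have := Z.square_nonneg (X - Y); rewrite /U; lia.
  have m1 : 4 * (X * Y) * ((3 * s - 2 * U) * (3 * s - 2 * U)) <=
     (U * U) * ((3 * s - 2 * U) * (3 * s - 2 * U)).
    by apply: Z.mul_le_mono_nonneg_r => //; apply: Z.square_nonneg.
  have m2 : 8 * (U * (3 * s - 2 * U)) <= 9 * (s * s).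
    by have := Z.square_nonneg (4 * U - 3 * s); lia.
  have m3 : (8 * (U * (3 * s - 2 * U))) * (8 * (U * (3 * s - 2 * U))) <=
     (9 * (s * s)) * (9 * (s * s)) by apply: Z.mul_le_mono_nonneg; lia.
  by lia.
have [q [r [sE r4]]] := residueP s.
have E := opt_poly4E q r4; rewrite -(opt_atE 4 q r4) -sE in E.
have L : opt4_defect r s <= 12 * s * s.
  by clear -s16 r4; residues r; cbv [opt4_defect]; nia.
have ss : 256 <= s * s by clear -s16; nia.
have m := Z.mul_le_mono_nonneg_r 256 (s * s) (s * s) ltac:(lia) ss.
lia.
Qed.

Lemma prism_poly_opt k : (k <= 3)%N -> P k <= opt_at k s.
Proof.
move=> k3.
(* Swapping the ends of two triangle edges changes N_3 by z_k (d_i d_j + z_i z_j),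
   where d_i = x_i - y_i, and two of the d_i have the same sign. *)
have swap u1 u2 u3 v1 v2 v3 t1 t2 t3 : 0 <= u1 -> 0 <= u2 -> 0 <= u3 ->
    0 <= v1 -> 0 <= v2 -> 0 <= v3 -> 0 <= t1 -> 0 <= t2 -> 0 <= t3 ->
    0 <= (u1 - v1) * (u2 - v2) ->
    prism_poly k u1 u2 u3 v1 v2 v3 t1 t2 t3 <=
    opt_at k (u1 + u2 + u3 + (v1 + v2 + v3) + (t1 + t2 + t3)).
  move=> u1p u2p u3p v1p v2p v3p t1p t2p t3p d.
  have := @K33_poly_opt_at u3 t1 u2 u1 v2 t3 t2 v3 v1 u3p t1p u2p u1p v2p t3p t2p v3p v1p
    k (leqW k3).
  rewrite (_ : u3 + t1 + u2 + (u1 + v2 + t3) + (t2 + v3 + v1) =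
    u1 + u2 + u3 + (v1 + v2 + v3) + (t1 + t2 + t3)); last by ring.
  apply: Z.le_trans; have m := Z.mul_nonneg_nonneg _ _ t3p d.
  have m' := Z.mul_nonneg_nonneg _ _ t3p (Z.mul_nonneg_nonneg _ _ t1p t2p).
  by case: k k3 => [|[|[|[|k']]]] // _; rewrite /prism_poly /K33_poly /e2; lia.
have perm i1 i2 i3 j1 j2 j3 l1 l2 l3 :
    prism_poly k i1 i3 i2 j1 j3 j2 l1 l3 l2 = prism_poly k i1 i2 i3 j1 j2 j3 l1 l2 l3 /\
    prism_poly k i2 i3 i1 j2 j3 j1 l2 l3 l1 = prism_poly k i1 i2 i3 j1 j2 j3 l1 l2 l3.
  by clear; case: k => [|[|[|[|k']]]]; rewrite /prism_poly /e2; split; ring.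
have [p1 p2] := perm x1 x2 x3 y1 y2 y3 z1 z2 z3.
have [d|[d|d]] : 0 <= (x1 - y1) * (x2 - y2) \/ 0 <= (x1 - y1) * (x3 - y3) \/
    0 <= (x2 - y2) * (x3 - y3).
- have [a|a] := Z.le_ge_cases x1 y1; have [b|b] := Z.le_ge_cases x2 y2;
  have [c|c] := Z.le_ge_cases x3 y3; nia.
- exact: swap d.
- rewrite /P -p1 (_ : s = x1 + x3 + x2 + (y1 + y3 + y2) + (z1 + z3 + z2)); first exact: swap d.
  by rewrite /s /X /Y /W; ring.
rewrite /P -p2 (_ : s = x2 + x3 + x1 + (y2 + y3 + y1) + (z2 + z3 + z1)); first exact: swap d.
by rewrite /s /X /Y /W; ring.
Qed.

(** Contracting the third rung of the prism gives the same graph as contracting an edge of K33; the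
    arguments on the right match the other edges. *)
Lemma prism_poly_flat_rung k : (k <= 4)%N -> z3 = 0 ->
  P k = K33_poly k x3 z1 x2 x1 y2 z3 z2 y3 y1.
Proof.
by case: k => [|[|[|[|[|k]]]]] // _ z0; rewrite /P /prism_poly /K33_poly /e2 z0; ring.
Qed.

End Prism.
End Optimum.

(** * Bounds for weighted counts *)

Definition best (k s : nat) : nat := Z.to_nat (opt_at k (Z.of_nat s)).

Definition K33_weight (x : edge K33 -> nat) (i j : nat) : nat := x (inord i, inord j).

Lemma ord9P (P : 'I_9 -> Prop) : (forall i, i < 9 -> P (inord i)) -> forall i, P i.
Proof. by move=> H i; rewrite -(inord_val i); apply: H. Qed.

Definition table_to_K33_vert (i : 'I_6) : vert K33 :=
  if i < 3 then inl (inord i) else inr (inord (i - 3)).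
Definition table_to_K33_edge (i : 'I_9) : edge K33 := (inord (i %/ 3), inord (i %% 3)).
Definition K33_edge_to_table (e : edge K33) : 'I_9 := inord (3 * e.1 + e.2).

Lemma K33_edge_to_tableK : cancel K33_edge_to_table table_to_K33_edge.
Proof.
move=> [[i i3] [j j3]]; rewrite /table_to_K33_edge /K33_edge_to_table /=.
by congr (_, _); apply: val_inj; rewrite /= !inordK //; lia.
Qed.

Lemma table_to_K33_edgeK : cancel table_to_K33_edge K33_edge_to_table.
Proof.
move=> [i i9]; rewrite /table_to_K33_edge /K33_edge_to_table /=.
by apply: val_inj; rewrite /= !inordK //; lia.
Qed.

Lemma table_to_K33_vert_inj : injective table_to_K33_vert.
Proof.
move=> [i i6] [j j6]; rewrite /table_to_K33_vert /=.
by case: ifP => i3; case: ifP => j3 // -[] /(congr1 val) /=; rewrite !inordK; try lia;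
  move=> ij; apply: val_inj => /=; lia.
Qed.

Lemma K33_table_ends (e : edge (table_graph K33_table)) :
  ends (table_to_K33_edge e) = table_to_K33_vert @: ends e.
Proof.
rewrite /ends imsetU !imset_set1; move: e; apply: ord9P => i i9.
by do 9?[case: i i9 => [|i] i9; first by
  rewrite /table_to_K33_edge /table_to_K33_vert /= !inordK //= !inordK].
Qed.

Lemma wcount_K33_table x k :
  wcount (G := K33) x k = wcount (G := table_graph K33_table) (x \o table_to_K33_edge) k.
Proof.
apply: (wcount_iso (f := table_to_K33_vert : vert (table_graph K33_table) -> vert K33)).
- apply: bij_card; first exact: table_to_K33_vert_inj.
  by rewrite card_ord card_sum !card_ord.
- by exists K33_edge_to_table; [apply: table_to_K33_edgeK | apply: K33_edge_to_tableK].
- exact: K33_table_ends.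
Qed.

Lemma wcount_K33 x k : k <= 4 ->
  let z i j := Z.of_nat (K33_weight x i j) in
  Z.of_nat (wcount (G := K33) x k) =
  K33_poly k (z 0 0) (z 0 1) (z 0 2) (z 1 0) (z 1 1) (z 1 2) (z 2 0) (z 2 1) (z 2 2).
Proof.
move=> k4 z; rewrite wcount_K33_table table_wcount // table_valuesE /= K33_terms //.
by rewrite /table_to_K33_edge !inordK.
Qed.

Lemma sum_K33 (x : edge K33 -> nat) : \sum_c x c =
  K33_weight x 0 0 + K33_weight x 0 1 + K33_weight x 0 2
  + (K33_weight x 1 0 + K33_weight x 1 1 + K33_weight x 1 2)
  + (K33_weight x 2 0 + K33_weight x 2 1 + K33_weight x 2 2).
Proof.
have -> : \sum_c x c = \sum_(i < 3) \sum_(j < 3) x (i, j).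
  by rewrite pair_bigA; apply: eq_bigr => -[].
rewrite !big_ord_recr !big_ord0 /= !add0n /K33_weight.
by do !congr (_ + _); congr x; congr (_, _); apply: val_inj; rewrite /= inordK.
Qed.

Lemma wcount_K33_best x k : k <= 4 -> wcount (G := K33) x k <= best k (\sum_c x c).
Proof.
move=> k4; rewrite /best sum_K33.
pose z i j := Zle_0_nat (K33_weight x i j).
have le := K33_poly_opt_at (z 0 0) (z 0 1) (z 0 2) (z 1 0) (z 1 1) (z 1 2) (z 2 0) (z 2 1) (z 2 2) k4.
have := wcount_K33 x k4; cbv zeta => E; rewrite -E in le.
rewrite !Nat2Z.inj_add.
by move: le; move: (opt_at _ _) => b; lia.
Qed.

Definition prism_graph := table_graph prism_table.

Lemma wcount_prism (l : 'I_9 -> nat) k : k <= 4 ->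
  let z i := Z.of_nat (l (inord i)) in
  Z.of_nat (wcount (G := prism_graph) l k) =
  prism_poly k (z 0) (z 1) (z 2) (z 3) (z 4) (z 5) (z 6) (z 7) (z 8).
Proof. by move=> k4 z; rewrite table_wcount // table_valuesE /= prism_terms. Qed.

Lemma sum_ord9 (l : 'I_9 -> nat) : \sum_i l i =
  l (inord 0) + l (inord 1) + l (inord 2) + (l (inord 3) + l (inord 4) + l (inord 5))
  + (l (inord 6) + l (inord 7) + l (inord 8)).
Proof.
rewrite !big_ord_recr big_ord0 /= add0n !addnA.
by do !congr (_ + _); congr l; apply: val_inj; rewrite /= inordK.
Qed.

Lemma wcount_prism_best (l : 'I_9 -> nat) k : k <= 3 ->
  wcount (G := prism_graph) l k <= best k (\sum_i l i).
Proof.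
move=> k3; rewrite /best sum_ord9; pose z i := Zle_0_nat (l (inord i)).
have le := prism_poly_opt (z 0) (z 1) (z 2) (z 3) (z 4) (z 5) (z 6) (z 7) (z 8) k3.
have := wcount_prism l (leqW k3); cbv zeta => E; rewrite -E in le.
rewrite !Nat2Z.inj_add.
by move: le; move: (opt_at _ _) => b; lia.
Qed.

Lemma wcount_prism4_best (l : 'I_9 -> nat) :
  0 < l (inord 6) -> 0 < l (inord 7) -> 0 < l (inord 8) -> 4 <= \sum_i l i ->
  wcount (G := prism_graph) l 4 < best 4 (\sum_i l i).
Proof.
rewrite /best sum_ord9 => l6 l7 l8 s4; pose z i := Zle_0_nat (l (inord i)).
have lt := prism_poly4_opt (z 0) (z 1) (z 2) (z 3) (z 4) (z 5) (z 6) (z 7) (z 8)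
  ltac:(lia) ltac:(lia) ltac:(lia) ltac:(lia).
have := wcount_prism l (leqnn 4); cbv zeta => E; rewrite -E in lt.
rewrite !Nat2Z.inj_add.
by move: lt; move: (opt_at _ _) => b; lia.
Qed.

(* The edge of the prism of which a given edge of K33 is the twisted version,
   and a Hamiltonian cycle common to both graphs. *)
Definition untwist_edge (c : edge K33) : 'I_9 :=
  inord (nth 0 [:: 2; 6; 1; 0; 4; 8; 7; 5; 3] (K33_edge_to_table c)).
Definition untwist_vert (x : vert K33) : 'I_6 :=
  match x with inl i => inord i.*2 | inr j => inord j.*2.+1 end.

Lemma wcount_untwist (l : 'I_9 -> nat) k : k <= 4 -> l (inord 8) = 0 ->
  wcount (G := prism_graph) l k = wcount (G := K33) (l \o untwist_edge) k.
Proof.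
move=> k4 l8; apply: Nat2Z.inj; have := wcount_prism l k4; cbv zeta => ->.
have := wcount_K33 (l \o untwist_edge) k4; cbv zeta => ->.
rewrite prism_poly_flat_rung ?l8 //.
by rewrite /K33_weight /untwist_edge /K33_edge_to_table /= !inordK //= l8.
Qed.

Lemma untwist_edge_bij : bijective untwist_edge.
Proof.
apply: bij_card; last by rewrite card_prod !card_ord.
move=> c d /(congr1 (@nat_of_ord 9)); rewrite /untwist_edge.
have lt (e : edge K33) : K33_edge_to_table e < 9 by [].
have lt9 i : nth 0 [:: 2; 6; 1; 0; 4; 8; 7; 5; 3] i < 9.
  by do 9?[case: i => [//|i]]; rewrite /= nth_nil.
rewrite (inordK (lt9 _)) (inordK (lt9 _)) => /eqP.
rewrite nth_uniq // => /eqP/val_inj.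
exact: (can_inj K33_edge_to_tableK).
Qed.

Lemma untwist_ends (T : finType) (th : 'I_6 -> T) (c : edge K33) :
  th (inord 2) = th (inord 5) ->
  th @: ends (untwist_edge c : edge prism_graph) = th @: (untwist_vert @: ends c).
Proof.
move=> th25; rewrite /ends !imsetU !imset_set1.
rewrite -[c]K33_edge_to_tableK; move: (K33_edge_to_table c).
apply: ord9P => i i9; rewrite /untwist_edge /untwist_vert table_to_K33_edgeK.
do 9?[case: i i9 => [|i] i9]; rewrite //= !inordK //=.
all: first [by rewrite ?th25 | by rewrite ?th25 [RHS]setUC].
Qed.

(** * Transport of lengths to the cubic graphs *)

Definition push (I J : finType) (j : I -> J) (l : I -> nat) (g : J) : nat :=
  \sum_(e | j e == g) l e.

Lemma push_inj (I J : finType) (j : I -> J) l e : injective j -> push j l (j e) = l e.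
Proof.
by move=> ij; rewrite /push (big_pred1 e) // => e'; rewrite (inj_eq ij).
Qed.

Lemma push_notin (I J : finType) (j : I -> J) l g : g \notin codom j -> push j l g = 0.
Proof.
move=> gj; rewrite /push big_pred0 // => e.
by apply: contraNF gj => /eqP<-; apply: codom_f.
Qed.

Lemma sum_push (I J : finType) (j : I -> J) l : \sum_g push j l g = \sum_e l e.
Proof. by rewrite [RHS](partition_big j xpredT). Qed.

(* D0 is obtained from D by contracting the edges outside the image of j. *)
Definition expansion (D0 D : mgraph) (pi : vert D -> vert D0) (j : edge D0 -> edge D) : Prop :=
  [/\ injective j,
      forall e, src e = pi (src (j e)) /\ tgt e = pi (tgt (j e)),
      forall g, g \notin codom j -> pi (src g) = pi (tgt g) &
      forall l k, wcount l k = wcount (push j l) k].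

Lemma expansion_refl D : @expansion D D id id.
Proof.
split=> // [g|l k]; first by rewrite -[g]/(id g) codom_f.
by apply: eq_wcount => e; rewrite (@push_inj _ _ id).
Qed.

Lemma expansion_contraction D0 D D' pi j f pi' j' :
  @expansion D0 D pi j -> @contraction D' f D pi' j' ->
  @expansion D0 D' (pi \o pi') (j' \o j).
Proof.
move=> [ij ej cj wj] C; case: (C) => ij' imj' ej' _ _; split.
- exact: inj_comp.
- by move=> e /=; have [-> ->] := ej e; have [-> ->] := ej' (j e).
- move=> g; have [/codomP[e ->]|] := boolP (g \in codom j').
    move=> ne /=; have [<- <-] := ej' e; apply: cj; apply: contra ne => /codomP[d ->].
    by rewrite -[j' (j d)]/((j' \o j) d) codom_f.
  rewrite imj' negbK => /eqP-> _ /=; congr (pi _).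
  by case: C => _ _ _ _ ->; right.
move=> l k; rewrite wj (wcount_contraction C); last first.
  left; apply: push_notin; apply/negP => /codomP[e fe].
  by have := imj' (j' (j e)); rewrite codom_f fe /= eqxx.
apply: eq_wcount => g /=; have [/codomP[e ->]|gj] := boolP (g \in codom j).
  by rewrite push_inj // -[j' (j e)]/((j' \o j) e) push_inj //; apply: inj_comp.
rewrite !push_notin //; apply: contra gj => /codomP[e /ij' ->].
exact: codom_f.
Qed.

Lemma three_edge_connected_darts D (v : vert D) : three_edge_connected D ->
  1 < #|vert D| -> 3 <= #|darts_at v|.
Proof.
move=> tec V2; apply: (@leq_trans #|cut [set v]|).
  apply: (iffLR (three_edge_connectedP _) tec).
    by apply/set0Pn; exists v; rewrite inE.
  apply: contraTneq V2 => /(congr1 (fun X : {set vert D} => #|X|)).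
  by rewrite cards1 cardsT => <-.
by apply: leq_trans (subset_leq_card (cut1_darts v)) (leq_imset_card _ _).
Qed.

Lemma sum_card_lower (T : finType) (F : T -> nat) c :
  (forall v, c <= F v) -> c * #|T| <= \sum_v F v.
Proof.
by move=> H; rewrite mulnC -sum_nat_const; apply: leq_sum => v _; apply: H.
Qed.

Lemma sum_card_upper (T : finType) (F : T -> nat) c :
  (forall v, F v <= c) -> \sum_v F v <= c * #|T|.
Proof.
by move=> H; rewrite mulnC -sum_nat_const; apply: leq_sum => v _; apply: H.
Qed.

(** Degrees of at least 3 give [3 V <= 2 (V + 3)] for the number V of vertices. *)
Lemma three_edge_connected_order D : three_edge_connected D ->
  #|edge D| = #|vert D| + 3 -> #|vert D| <= 6.
Proof.
move=> tec E; rewrite leqNgt; apply/negP => V7.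
have := sum_card_lower (fun v => three_edge_connected_darts v tec (ltn_trans (isT : 1 < 6) V7)).
rewrite sum_darts_at E; lia.
Qed.

(** With V < 6 vertices the degree sum [2 (V + 3)] exceeds [3 V], so some vertex has degree at least
    4 and can be split. *)
Lemma cubic_expansion D0 : three_edge_connected D0 -> 0 < #|vert D0| ->
  #|edge D0| = #|vert D0| + 3 ->
  exists D pi j, [/\ @expansion D0 D pi j, three_edge_connected D,
                     #|vert D| = 6 & #|edge D| = 9].
Proof.
move=> tec0 V0 E0.
suff H n D pi j : @expansion D0 D pi j -> three_edge_connected D ->
    0 < #|vert D| -> #|edge D| = #|vert D| + 3 -> 6 - #|vert D| = n ->
    exists D pi j, [/\ @expansion D0 D pi j, three_edge_connected D,
                     #|vert D| = 6 & #|edge D| = 9].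
  exact: H (expansion_refl D0) tec0 V0 E0 erefl.
elim: n D pi j => [|n IHn] D pi j ex tec V E Vn.
  have := three_edge_connected_order tec E => V6.
  by exists D, pi, j; split=> //; lia.
have [v v4] : exists v : vert D, 4 <= #|darts_at v|.
  apply: contrapT => no; have : \sum_(v : vert D) #|darts_at v| <= 3 * #|vert D|.
    apply: sum_card_upper => v; rewrite -ltnS ltnNge; apply/negP => v4.
    by apply: no; exists v.
  by rewrite sum_darts_at E; lia.
have [p [q [pv qv pq sep]]] := separable_darts tec v4.
rewrite !inE in pv qv; move/eqP: pv => pv; move/eqP: qv => qv.
have C := split_vertexP pv qv.
apply: (IHn _ _ _ (expansion_contraction ex C)).
- exact: split_three_edge_connected.
- by rewrite card_option.
- by rewrite !card_option E addSn.
- by rewrite card_option; lia.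
Qed.

(* D arises from K33 by contracting the edges outside the image of i. *)
Definition K33_embedding (D : mgraph) (v : vert K33 -> vert D) (i : edge D -> edge K33) : Prop :=
  [/\ injective i, forall e, ends e = v @: ends (i e) &
      forall c, c \notin codom i -> v (src c) = v (tgt c)].

(** The ends have to agree only after applying [pi]. This admits as [b] the twist of the prism,
    whose incidences differ from those of K33 at the ends of a rung that [pi] contracts. *)
Lemma K33_embeddingP D0 D pi j (v : vert K33 -> vert D) (b : edge K33 -> edge D)
    (l : edge D0 -> nat) :
  @expansion D0 D pi j -> bijective b ->
  (forall c, pi @: ends (b c) = pi @: (v @: ends c)) ->
  (forall k, k <= 4 -> wcount (push j l) k = wcount (G := K33) (push j l \o b) k) ->
  exists i, [/\ @K33_embedding D0 (pi \o v) i &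
    forall k, k <= 4 -> wcount l k = wcount (G := K33) (push i l) k].
Proof.
move=> [ij ej cj wj] [b' bK b'K] pib wb; have ib' := can_inj b'K.
exists (b' \o j); split.
  split.
  - exact: inj_comp.
  - move=> e; rewrite imset_comp -pib /= b'K /ends imsetU !imset_set1.
    by have [<- <-] := ej e.
  move=> c nc; have bj : b c \notin codom j.
    apply: contra nc => /codomP[e ce].
    by rewrite -[c]bK ce -[b' (j e)]/((b' \o j) e) codom_f.
  have := pib c; rewrite /ends !imsetU !imset_set1 /= (cj _ bj) setUid => /setP E.
  have := E (pi (v (src c))); have := E (pi (v (tgt c))).
  by rewrite !inE !eqxx ?orbT => /eqP-> /eqP->.
move=> k k4; rewrite wj wb //; apply: eq_wcount => c /=.
have [/codomP[e be]|bj] := boolP (b c \in codom j).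
  by rewrite be push_inj // -[c]bK be -[b' (j e)]/((b' \o j) e) push_inj //; apply: inj_comp.
rewrite !push_notin //; apply: contra bj => /codomP[e ->] /=.
by rewrite b'K codom_f.
Qed.

(* Automorphisms of the prism sending the last rung to any given one. *)
Lemma prism_symmetry (k : nat) : k < 3 -> exists (f : 'I_6 -> 'I_6) (g : 'I_9 -> 'I_9),
  [/\ bijective f, bijective g,
      forall e : edge prism_graph, ends (g e : edge prism_graph) = f @: ends e &
      g (inord 8) = inord (6 + k)].
Proof.
have invol n (s : seq nat) : all (fun i => (nth 0 s i < n.+1) && (nth 0 s (nth 0 s i) == i)) (iota 0 n.+1) ->
    bijective (fun i : 'I_n.+1 => inord (nth 0 s i) : 'I_n.+1).
  move=> /allP al; apply: inv_bij => i; apply: val_inj => /=.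
  have := al i; rewrite mem_iota add0n ltn_ord => /(_ isT)/andP[lt /eqP E].
  by rewrite !inordK ?E.
have main (s t : seq nat) : all (fun i => (nth 0 s i < 6) && (nth 0 s (nth 0 s i) == i)) (iota 0 6) ->
    all (fun i => (nth 0 t i < 9) && (nth 0 t (nth 0 t i) == i)) (iota 0 9) ->
    all (fun i => let e := nth (0, 0) prism_table i in
                  let e' := nth (0, 0) prism_table (nth 0 t i) in
       ((e'.1 == nth 0 s e.1) && (e'.2 == nth 0 s e.2)) ||
       ((e'.1 == nth 0 s e.2) && (e'.2 == nth 0 s e.1))) (iota 0 9) ->
    [/\ bijective (fun i : 'I_6 => inord (nth 0 s i) : 'I_6),
      bijective (fun i : 'I_9 => inord (nth 0 t i) : 'I_9) &
      forall e : edge prism_graph, ends ((inord (nth 0 t (e : 'I_9)) : 'I_9) : edge prism_graph)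
         = (fun i : 'I_6 => inord (nth 0 s i) : 'I_6) @: ends e].
  move=> hs ht he; split; [exact: invol | exact: invol | move=> e].
  have e9 : nat_of_ord (e : 'I_9) \in iota 0 9 by rewrite mem_iota add0n ltn_ord.
  have := allP he _ e9; have /andP[t9 _] := allP ht _ e9; cbv zeta.
  rewrite /ends imsetU !imset_set1 /= !(inordK t9).
  have lt6 i : (nth (0, 0) prism_table i).1 < 6 /\ (nth (0, 0) prism_table i).2 < 6.
    by do 9?[case: i => [//|i]]; rewrite /= nth_nil.
  have [a b] := lt6 (e : 'I_9); rewrite (inordK a) (inordK b).
  by case/orP => /andP[/eqP-> /eqP->] //; rewrite setUC.
case: k => [|[|[|//]]] _.
- have [|||bf bg E] := main [:: 2; 1; 0; 5; 4; 3] [:: 2; 1; 0; 5; 4; 3; 8; 7; 6] => //.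
  by eexists _, _; split; [exact: bf | exact: bg | exact: E | rewrite /= inordK].
- have [|||bf bg E] := main [:: 0; 2; 1; 3; 5; 4] [:: 0; 2; 1; 3; 5; 4; 6; 8; 7] => //.
  by eexists _, _; split; [exact: bf | exact: bg | exact: E | rewrite /= inordK].
have [|||bf bg E] := main [:: 0; 1; 2; 3; 4; 5] [:: 0; 1; 2; 3; 4; 5; 6; 7; 8] => //.
by eexists _, _; split; [exact: bf | exact: bg | exact: E | rewrite /= inordK].
Qed.

Lemma three_edge_connected_best D0 (l : edge D0 -> nat) :
  three_edge_connected D0 -> 0 < #|vert D0| -> #|edge D0| = #|vert D0| + 3 ->
  (forall e, 0 < l e) ->
  (forall k, k <= 4 -> wcount l k <= best k (\sum_e l e)) /\
  (wcount l 4 = best 4 (\sum_e l e) ->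
   exists v i, @K33_embedding D0 v i /\ wcount l 4 = wcount (G := K33) (push i l) 4).
Proof.
move=> tec V0 E0 l0.
have [D [pi [j [ex tecD V6 E9]]]] := cubic_expansion tec V0 E0.
have fin v i : @K33_embedding D0 v i ->
    (forall k, k <= 4 -> wcount l k = wcount (G := K33) (push i l) k) ->
    (forall k, k <= 4 -> wcount l k <= best k (\sum_e l e)) /\
    (wcount l 4 = best 4 (\sum_e l e) ->
     exists v i, @K33_embedding D0 v i /\ wcount l 4 = wcount (G := K33) (push i l) 4).
  move=> em w; split=> [k k4|_]; last by exists v, i; split=> //; apply: w.
  by rewrite w // -(sum_push i l); apply: wcount_K33_best.
case: (cubic_classification tecD V6 E9) => -[f [g [bf bg fg]]].
  have [t [tK Kt]] : exists t : vert K33 -> 'I_6, cancel table_to_K33_vert t /\ cancel t table_to_K33_vert.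
    have [t h1 h2] : bijective table_to_K33_vert.
      apply: bij_card; first exact: table_to_K33_vert_inj.
      by rewrite card_ord card_sum !card_ord.
    by exists t.
  have [] := @K33_embeddingP D0 D pi j (f \o t) (g \o K33_edge_to_table) l ex.
  - apply: bij_comp => //.
    by exists table_to_K33_edge; [apply: K33_edge_to_tableK | apply: table_to_K33_edgeK].
  - move=> c; have tc : ends (K33_edge_to_table c : edge (table_graph K33_table)) = t @: ends c.
      rewrite -[c in RHS]K33_edge_to_tableK K33_table_ends -imset_comp.
      by rewrite (eq_imset (g := id)) ?imset_id.
    by rewrite (imset_comp f t) /= fg tc.
  - move=> k k4; rewrite (wcount_iso bf bg fg) wcount_K33_table.
    by apply: eq_wcount => e; rewrite /= table_to_K33_edgeK.
  by move=> i [em w]; apply: fin em w.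
pose r k := g (inord (6 + k)).
(* A rung in the image of [j] is an edge of [D0] and has positive length; a rung outside the image
   has length 0 and permits the twist. *)
have [allr|] := pselect (forall k, k < 3 -> r k \in codom j).
  have rpos k : k < 3 -> 0 < push j l (r k).
    move=> /allr/codomP[e ->]; case: ex => ij _ _ _.
    by rewrite push_inj.
  have [_ _ _ w] := ex.
  have sE : \sum_i (push j l \o g) i = \sum_e l e.
    rewrite -(sum_push j l) [RHS](reindex g) //; exact: onW_bij.
  have s4 : 4 <= \sum_e l e.
    apply: (@leq_trans #|edge D0|); first by rewrite E0; lia.
    by rewrite -sum1_card; apply: leq_sum => e _; apply: l0.
  have lt4 : wcount l 4 < best 4 (\sum_e l e).
    move: s4; rewrite w (wcount_iso bf bg fg) -sE; apply: wcount_prism4_best.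
    - exact: (rpos 0).
    - exact: (rpos 1).
    - exact: (rpos 2).
  split=> [k k4|E]; last by rewrite E ltnn in lt4.
  have [k3|k3] := leqP k 3.
    by rewrite w (wcount_iso bf bg fg) -sE; apply: wcount_prism_best.
  have -> : k = 4 by apply/eqP; rewrite eqn_leq k4.
  exact: ltnW.
move=> nall.
have [k [k3 rk]] : exists k, k < 3 /\ r k \notin codom j.
  apply: contrapT => no; apply: nall => k k3; apply/negPn/negP => rk.
  by apply: no; exists k.
have [f' [g' [bf' bg' fg' g8]]] := prism_symmetry k3.
have bff : bijective (f \o f') by apply: bij_comp.
have bgg : bijective (g \o g') by apply: bij_comp.
have fgg (e : edge prism_graph) : ends ((g \o g') e) = (f \o f') @: ends e.
  by rewrite /= fg fg' -imset_comp.
have [] := @K33_embeddingP D0 D pi j (f \o f' \o untwist_vert) (g \o g' \o untwist_edge) l ex.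
- by apply: bij_comp => //; apply: untwist_edge_bij.
- move=> c; rewrite /= -[g (g' _)]/((g \o g') _) fgg -!imset_comp.
  rewrite [LHS](imset_comp (pi \o (f \o f')) id) imset_id.
  rewrite [RHS](imset_comp (pi \o (f \o f')) untwist_vert).
  apply: untwist_ends; have [_ _ ce _] := ex; have := ce _ rk.
  have : pi @: ends (r k) = [set pi (f (f' (inord 2))); pi (f (f' (inord 5)))].
    rewrite /r -g8 -[g (g' _)]/((g \o g') _) fgg /ends !imsetU !imset_set1 /=.
    by rewrite !inordK.
  rewrite /ends imsetU !imset_set1 => E pE; rewrite pE setUid in E.
  move/setP: E => E; have := E (pi (f (f' (inord 2)))); have := E (pi (f (f' (inord 5)))).
  by rewrite !inE !eqxx ?orbT => /eqP pE1 /eqP pE2; rewrite /= pE1 pE2.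
- move=> k' k4; rewrite (@wcount_iso prism_graph D _ _ bff bgg fgg) wcount_untwist //=.
  by rewrite g8 push_notin.
by move=> i [em w]; apply: fin em w.
Qed.

(** * Layouts of K33 *)

Fixpoint walk (G : mgraph) (x : vert G) (p : seq (dart G)) (y : vert G) : bool :=
  if p is d :: p' then (dsrc d == x) && walk (dtgt d) p' y else x == y.

Lemma walk_cat G (x z : vert G) p1 p2 y : walk x p1 z -> walk z p2 y -> walk x (p1 ++ p2) y.
Proof.
by elim: p1 x => [|d p1 IH] x /= => [/eqP->//|/andP[-> /IH]].
Qed.

(* The edges of D are partitioned into trails indexed by the edges of K33. *)
Definition K33_layout (D : mgraph) (l : edge D -> nat) (x : edge K33 -> nat) : Prop :=
  exists (v : vert K33 -> vert D) (w : edge K33 -> seq (dart D)),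
    [/\ forall c, walk (v (src c)) (w c) (v (tgt c)),
        forall g, \sum_c count (fun d => d.1 == g) (w c) = 1 &
        forall c, x c = \sum_(d <- w c) l d.1].

Lemma K33_layout_embedding D (v : vert K33 -> vert D) (i : edge D -> edge K33) l :
  @K33_embedding D v i -> K33_layout l (push i l).
Proof.
case=> ii ei ci; exists v.
exists (fun c => if [pick e | i e == c] is Some e then [:: (e, src e != v (src c))] else [::]).
split=> [c|g|c].
- case: pickP => [e /eqP <-|no] /=.
    have := ei e; rewrite /ends imsetU !imset_set1 /dsrc /dtgt /= => /setP E.
    case: (eqVneq (src e) (v (src (i e)))) => [se|se] /=.
      rewrite se eqxx /=; have := E (tgt e); have := E (v (tgt (i e))).
      by rewrite !inE !eqxx !orbT se => /orP[/eqP-> /esym/orP[]/eqP->|/eqP->].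
    have := E (src e); have := E (v (src (i e))); rewrite !inE !eqxx /=.
    rewrite (negPf se) /= eq_sym (negPf se) /= eq_sym => -> /esym/eqP ->.
    by rewrite eqxx.
  apply/eqP/ci; apply/negP => /codomP[e ce]; have := no e.
  by rewrite ce eqxx.
- rewrite (bigD1 (i g)) //= big1 ?addn0.
    case: pickP => [e /eqP/ii ->|/(_ g)] /=; rewrite ?eqxx //.
  move=> c cg; case: pickP => [e /eqP ec|//] /=; rewrite addn0.
  by case: eqP => // eg; rewrite -ec eg eqxx in cg.
case: pickP => [e /eqP <-|no]; first by rewrite push_inj // big_seq1.
rewrite big_nil; apply: push_notin; apply/negP => /codomP[e ce].
by have := no e; rewrite ce eqxx.
Qed.

Section Suppress.
Variables (D : mgraph) (e f : edge D) (z w : vert D).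
Hypotheses (fzw : ends f = [set z; w]) (zw : w != z) (ef : e != f).
Hypothesis ze : cut [set z] = [set e; f].
Hypothesis zdarts : forall d : dart D, dsrc d = z -> d.1 \in [set e; f].
Let D' := contract f zw.

(** The edge [f] traversed from [z] to [w] for [true], from [w] to [z] for [false]. *)
Definition chain_dart (b : bool) : dart D := (f, (src f == z) (+) b).

Lemma f_ends : (src f = z /\ tgt f = w) \/ (src f = w /\ tgt f = z).
Proof.
have /setP E := fzw; have := E (src f); have := E (tgt f).
have := E z; have := E w; rewrite /ends !inE !eqxx ?orbT /= => Ew Ez.
move=> /esym tf /esym /orP[]/eqP sf; [left|right]; split=> //.
  by move: Ew; rewrite sf (negPf zw) => /eqP.
by move: Ez; rewrite sf eq_sym (negPf zw) => /eqP.
Qed.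

Lemma chain_dartT : dsrc (chain_dart true) = z /\ dtgt (chain_dart true) = w.
Proof.
rewrite /chain_dart /dsrc /dtgt /=.
by case: f_ends => -[-> ->]; rewrite ?eqxx ?(negPf zw).
Qed.

Lemma chain_dartF : dsrc (chain_dart false) = w /\ dtgt (chain_dart false) = z.
Proof.
rewrite /chain_dart /dsrc /dtgt /=.
by case: f_ends => -[-> ->]; rewrite ?eqxx ?(negPf zw).
Qed.

Definition under (d : dart D') : dart D := (val d.1, d.2).

(** A passage through [e] in the contraction must also run through [f]: afterwards if [e] is
    traversed towards [z], beforehand if away from it. *)
Definition lift_dart (d : dart D') : seq (dart D) :=
  if val d.1 == e then
    if dtgt (under d) == z then [:: under d; chain_dart true]
    else [:: chain_dart false; under d]
  else [:: under d].

Lemma dsrc_under (d : dart D') :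
  val (dsrc d) = if dsrc (under d) == z then w else dsrc (under d).
Proof. by case: d => g [] /=; rewrite -val_contract_pi. Qed.

Lemma dtgt_under (d : dart D') :
  val (dtgt d) = if dtgt (under d) == z then w else dtgt (under d).
Proof. by case: d => g [] /=; rewrite -val_contract_pi. Qed.

Lemma walk_lift_dart (d : dart D') : walk (val (dsrc d)) (lift_dart d) (val (dtgt d)).
Proof.
rewrite dsrc_under dtgt_under /lift_dart.
have [T1 T2] := chain_dartT; have [F1 F2] := chain_dartF.
have rev (c : dart D) : dtgt c = dsrc (c.1, ~~ c.2) by case: c => g [].
case: (val d.1 =P e) => [ge|ge].
  have : (dsrc (under d) == z) (+) (dtgt (under d) == z).
    have : (under d).1 \in cut [set z] by rewrite ze /= ge !inE eqxx.
    rewrite in_cut !in_set1 /dsrc /dtgt.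
    by case: (under d) => g [] //=; rewrite addbC.
  move: (under d) => c; have [dz|dz] := eqVneq (dtgt c) z.
    by rewrite addbT => /negPf-> /=; rewrite T1 T2 dz !eqxx.
  by rewrite addbF => /eqP cz; rewrite cz /= F1 F2 cz !eqxx.
have nz (c : dart D) : c.1 = val d.1 -> (dsrc c == z) = false.
  move=> cd; apply/eqP => /zdarts; rewrite cd !inE => /orP[/eqP//|/eqP df].
  by have := svalP d.1; rewrite /= -/(val d.1) df eqxx.
by rewrite /= nz // rev nz //= !eqxx.
Qed.

Lemma walk_lift (x : vert D') p y :
  walk x p y -> walk (val x) (flatten (map lift_dart p)) (val y).
Proof.
elim: p x => [|d p IHp] x /=; first by move/eqP->.
by case/andP => /eqP <- /IHp; apply: walk_cat; apply: walk_lift_dart.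
Qed.

Lemma count_lift (p : seq (dart D')) (g : edge D) :
  count (fun d => d.1 == g) (flatten (map lift_dart p)) =
  count (fun d => val d.1 == g) p + (f == g) * count (fun d => val d.1 == e) p.
Proof.
elim: p => [|d p IHp] /=; first by rewrite muln0.
rewrite count_cat IHp /lift_dart mulnDr addnACA; congr (_ + _).
case: (val d.1 == e) => /=; rewrite ?muln1 ?muln0 ?addn0 //.
by case: ifP => _ /=; rewrite addn0 // addnC.
Qed.

(** At the vertex [z] of degree 2, the trail through [e] absorbs [f], whose length [shift_weight]
    had added to that of [e]. *)
Lemma K33_layout_suppress (l : edge D -> nat) x :
  K33_layout (shift_weight e f l \o val : edge D' -> nat) x -> K33_layout l x.
Proof.
case=> v [p [wp cp xp]].
exists (fun y => val (v y)), (fun c => flatten (map lift_dart (p c))); split.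
- by move=> c; apply: walk_lift.
- have cnt (g : edge D) (gf : g != f) : \sum_c count (fun d : dart D' => val d.1 == g) (p c) = 1.
    rewrite -(cp (exist _ g gf)); apply: eq_bigr => c _; apply: eq_count => d.
    by rewrite -val_eqE.
  move=> g; under eq_bigr => c _ do rewrite count_lift.
  rewrite big_split /= -big_distrr /= (cnt e) // muln1.
  have [<-|fg] := eqVneq f g; last by rewrite cnt // eq_sym.
  rewrite big1 ?add0n // => c _; apply/eqP; rewrite -leqn0 leqNgt -has_count.
  by apply/hasPn => d _; have := svalP d.1.
move=> c; rewrite xp; elim: (p c) => [|d s IHs]; first by rewrite !big_nil.
rewrite big_cons IHs /= big_cat /=; congr (_ + _).
have /negPf df : val d.1 != f by apply: svalP d.1.
rewrite /shift_weight /= df /lift_dart.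
case: (eqVneq (val d.1) e) => [de|de]; last by rewrite big_seq1.
by case: ifP => _; rewrite big_cons big_seq1 /= de // addnC.
Qed.

End Suppress.

(** * The bound for connected graphs *)

Lemma best_mono k s s' : k <= 4 -> s <= s' -> best k s <= best k s'.
Proof.
move=> k4; elim: s' => [|s' IHs']; first by rewrite leqn0 => /eqP->.
rewrite leq_eqVlt => /orP[/eqP->//|/IHs' le]; apply: leq_trans le _; rewrite /best.
have := opt_at_step (Zle_0_nat s') k4.
rewrite (_ : Z.of_nat s'.+1 = Z.add (Z.of_nat s') 1); last by lia.
by move: (opt_at _ _) (opt_at _ _) => a b; lia.
Qed.

Lemma best4_step s : 3 <= s -> best 4 s < best 4 s.+1.
Proof.
move=> s3; have pos : 1 <= best 4 s.+1.
  by apply: (@leq_trans (best 4 4)); [rewrite /best | apply: best_mono].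
move: pos; rewrite /best (_ : Z.of_nat s.+1 = Z.add (Z.of_nat s) 1); last by lia.
have := @opt_at4_step (Z.of_nat s) ltac:(lia).
by move: (opt_at _ _) (opt_at _ _) => a b; lia.
Qed.

Lemma best4_strict s s' : 4 <= s' -> s < s' -> best 4 s < best 4 s'.
Proof.
move=> s4 ss'; have [s3|s3] := leqP 3 s.
  by apply: leq_trans (best4_step s3) _; apply: best_mono.
apply: (@leq_ltn_trans (best 4 3)); first by apply: best_mono => //; apply: ltnW.
by apply: (leq_trans (@best4_step 3 isT)); apply: best_mono.
Qed.

Lemma K33_best_unique (x : edge K33 -> nat) (q r : Z) :
  let s := \sum_c x c in
  5 <= s -> Z.of_nat s = Z.add (Z.mul 9 q) r -> Z.le (-4) r -> Z.le r 4 ->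
  wcount (G := K33) x 4 = best 4 s ->
  exists f g : 'I_3 -> 'I_3, [/\ injective f, injective g &
    forall i j, Z.of_nat (x (f i, g j)) = Z.add q (offset r i j)].
Proof.
move=> s s5 sE r1 r2 opt.
have E := wcount_K33 x (leqnn 4); cbv zeta in E.
have sZ : Z.of_nat s = Z.add (Z.add (Z.add (Z.add (Z.of_nat (K33_weight x 0 0))
      (Z.of_nat (K33_weight x 0 1))) (Z.of_nat (K33_weight x 0 2)))
    (Z.add (Z.add (Z.of_nat (K33_weight x 1 0)) (Z.of_nat (K33_weight x 1 1)))
      (Z.of_nat (K33_weight x 1 2))))
    (Z.add (Z.add (Z.of_nat (K33_weight x 2 0)) (Z.of_nat (K33_weight x 2 1)))
      (Z.of_nat (K33_weight x 2 2))).
  by rewrite /s sum_K33 !Nat2Z.inj_add.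
pose z i j := Zle_0_nat (K33_weight x i j).
have := K33_poly4_unique (z 0 0) (z 0 1) (z 0 2) (z 1 0) (z 1 1) (z 1 2) (z 2 0) (z 2 1) (z 2 2)
  (q := q) (r := r).
rewrite -sZ -E opt /best; move=> U.
have eqo : Z.of_nat (Z.to_nat (opt_at 4 (Z.of_nat s))) = opt_at 4 (Z.of_nat s).
  have : Z.lt 0 (opt_at 4 (Z.of_nat s)); last by lia.
  have := best4_strict (leq_trans (isT : 4 <= 5) s5) (leq_trans (isT : 0 < 5) s5).
  rewrite /best; lia.
have := U sE ltac:(lia) (conj r1 r2) eqo.
case/hasP => p pP /hasP[t tP /allP al].
have perm_ok (u : seq nat) : u \in perms3 ->
    (forall i : 'I_3, nth 0 u i < 3) /\ injective (fun i : 'I_3 => inord (nth 0 u i) : 'I_3).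
  move=> uP; have [su uu lt] : [/\ size u = 3, uniq u & all (gtn 3) u].
    by move: uP; rewrite !inE; do 5?[case/orP]; move/eqP->.
  have u3 (i : 'I_3) : nth 0 u i < 3 by apply: (allP lt); rewrite mem_nth // su.
  split=> // i j /(congr1 val); rewrite /= !inordK // => /eqP.
  by rewrite nth_uniq ?su // => /eqP/val_inj.
have [p3 pinj] := perm_ok p pP; have [t3 tinj] := perm_ok t tP.
exists (fun i => inord (nth 0 p i)), (fun j => inord (nth 0 t j)); split=> // i j.
have i3 : (i : nat) \in [:: 0; 1; 2] by case: i => [[|[|[|]]]].
have j3 : (j : nat) \in [:: 0; 1; 2] by case: j => [[|[|[|]]]].
have /allP/(_ _ j3)/Z.eqb_eq := al _ i3.
have := t3 j; have := p3 i; move: (nth 0 p i) (nth 0 t j) => a b.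
rewrite /entry /K33_weight; move: (offset r i j) => o; clear.
by case: a => [|[|[|a]]] // _; case: b => [|[|[|b]]] // _ /=; lia.
Qed.

Lemma offset_range r i j : Z.le (-4) r -> Z.le r 4 ->
  Z.le 0 r /\ (offset r i j = Z0 \/ offset r i j = Zpos 1) \/
  Z.lt r 0 /\ (offset r i j = Z0 \/ offset r i j = Zneg 1).
Proof.
move=> r1 r2; have : r = Zneg 4 \/ r = Zneg 3 \/ r = Zneg 2 \/ r = Zneg 1 \/ r = Z0 \/
  r = Zpos 1 \/ r = Zpos 2 \/ r = Zpos 3 \/ r = Zpos 4 by lia.
by case: i => [|[|[|i]]]; case: j => [|[|[|j]]]; do 8?[case]; move=> ->; rewrite /=; lia.
Qed.

Section ContractStep.
Variables (D : mgraph) (f : edge D) (v w : vert D).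
Hypotheses (fvw : ends f = [set v; w]) (vw : w != v).
Let D' := contract f vw.
Let C := contractP fvw vw.

Lemma sum_contract (l : edge D -> nat) :
  l f + \sum_(e : edge D') l (val e) = \sum_e l e.
Proof.
rewrite [RHS](bigD1 f) //=; congr (_ + _).
rewrite [RHS](reindex_omap (val : edge D' -> edge D) (insub : edge D -> option (edge D'))) => [|g gf]; last by rewrite insubT.
by apply: eq_bigl => e; rewrite valK eqxx andbT (svalP e).
Qed.

Lemma connected_contract : connected_by [set: edge D] -> connected_by [set: edge D'].
Proof.
rewrite -(setC0 (edge D)) -(setC0 (edge D')) -(connected_contraction C).
by rewrite imset0.
Qed.

Lemma card_edge_contract : #|edge D| = #|edge D'|.+1.
Proof. exact: card_edge_contraction C. Qed.

End ContractStep.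

(** Optimal lengths lie in two consecutive values around the quotient, so 0 cannot occur together
    with 2 or more. *)
Lemma unbalanced_not_best (x : edge K33 -> nat) (c d : edge K33) :
  5 <= \sum_c x c -> x c = 0 -> 2 <= x d -> wcount (G := K33) x 4 != best 4 (\sum_c x c).
Proof.
move=> s5 xc xd; apply/eqP => opt.
have [q [r [sE [r1 r2]]]] := residueP (Z.of_nat (\sum_c x c)).
have [f [g [fi gi E]]] := K33_best_unique s5 sE r1 r2 opt.
have sur (h : 'I_3 -> 'I_3) i : injective h -> exists i', h i' = i.
  by move=> hi; have [h' _ hK] := injF_bij hi; exists (h' i).
case: c xc => c1 c2 xc; case: d xd => d1 d2 xd.
have [i1 i1E] := sur f c1 fi; have [i2 i2E] := sur g c2 gi.
have [j1 j1E] := sur f d1 fi; have [j2 j2E] := sur g d2 gi.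
have := E i1 i2; have := E j1 j2; rewrite i1E i2E j1E j2E.
have := offset_range i1 i2 r1 r2; have := offset_range j1 j2 r1 r2.
rewrite xc; move: xd; move: (x (d1, d2)) (offset r i1 i2) (offset r j1 j2) => n a b.
by clear; lia.
Qed.

(* In the last clause some edge of K33 gets weight 0 for lack of edges, so a weight of at
   least 2 makes the weights unbalanced. *)
Definition structured (D : mgraph) (l : edge D -> nat) : Prop :=
  let s := \sum_e l e in
  [/\ forall k, k <= 4 -> wcount l k <= best k s,
      wcount l 4 = best 4 s ->
        exists x, K33_layout l x /\ wcount l 4 = wcount (G := K33) x 4 &
      #|edge D| <= 8 -> 5 <= s -> (exists e, 2 <= l e) -> wcount l 4 < best 4 s].

Lemma tec_structured D (l : edge D -> nat) : three_edge_connected D -> 0 < #|vert D| ->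
  #|edge D| = #|vert D| + 3 -> (forall e, 0 < l e) -> structured l.
Proof.
move=> tec V E l0; have [le eq] := three_edge_connected_best tec V E l0.
split=> // [opt|E8 s5 [e le2]].
  have [v [i [em w]]] := eq opt; exists (push i l); split=> //.
  exact: K33_layout_embedding em.
rewrite ltn_neqAle le // andbT; apply/eqP => opt.
have [v [i [[ii _ _] w]]] := eq opt.
have [c nc] : exists c, c \notin codom i.
  apply: contrapT => no; have : #|edge K33| <= #|codom i|.
    apply/subset_leq_card/subsetP => c _; apply/negPn/negP => nc.
    by apply: no; exists c.
  by rewrite card_codom // card_prod !card_ord leqNgt ltnS E8.
have : wcount (G := K33) (push i l) 4 != best 4 (\sum_c push i l c).
  apply: (@unbalanced_not_best _ c (i e)); rewrite ?sum_push ?push_inj //.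
  exact: push_notin.
by rewrite sum_push -w opt eqxx.
Qed.

(** Two ways to settle the optimal case. With at most 9 edges the contraction has at most 8, and the
    merged edge has length at least 2, so the last clause of [structured] makes [N_4] strictly
    smaller. Otherwise the layout of the contraction must lift to [D]. *)
Lemma two_edge_cut_structured D (X : {set vert D}) (e f : edge D) (v w : vert D)
    (l : edge D -> nat) (fvw : ends f = [set v; w]) (vw : w != v) :
  e != f -> cut X = [set e; f] -> 5 <= #|edge D| -> (forall e, 0 < l e) ->
  structured (shift_weight e f l \o val : edge (contract f vw) -> nat) ->
  (#|edge D| <= 9 \/ (forall x, K33_layout (shift_weight e f l \o val : edge (contract f vw) -> nat) x ->
      K33_layout l x)) ->
  structured l.
Proof.
move=> ef cX E5 l0 [le eq st] lay; rewrite /structured.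
have wE k : wcount (shift_weight e f l \o val : edge (contract f vw) -> nat) k = wcount l k.
  rewrite -(wcount_shift l k ef cX) (wcount_contraction (contractP fvw vw)) //.
  by left; rewrite /shift_weight eqxx.
have sE : \sum_(g : edge (contract f vw)) (shift_weight e f l \o val) g = \sum_e l e.
  have := @sum_contract D f v w vw (shift_weight e f l); rewrite {1}/shift_weight eqxx add0n => ->.
  rewrite (bigD1 f) //= (bigD1 e) //= [RHS](bigD1 f) //= [in RHS](bigD1 e) //=.
  rewrite /shift_weight !eqxx (negPf ef) add0n addnAC addnA (addnC (l f)).
  rewrite -!addnA; congr (_ + _); rewrite addnC; congr (_ + _).
  by apply: eq_bigr => g /andP[/negPf-> /negPf->].
have E' := card_edge_contract fvw vw.
have s5 : 5 <= \sum_e l e.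
  apply: leq_trans E5 _; rewrite -sum1_card; apply: leq_sum => g _; exact: l0.
have st' : #|edge D| <= 9 -> wcount l 4 < best 4 (\sum_e l e).
  move=> E9; rewrite -wE -sE; apply: st; rewrite ?sE //; first by rewrite -ltnS -E'.
  have ef' : e != f by [].
  exists (exist _ e ef'); rewrite /= /shift_weight (negPf ef) eqxx.
  by have := l0 e; have := l0 f; lia.
split=> [k k4|opt|E8 _ _].
- by have := le k k4; rewrite wE sE.
- case: lay => [E9|lay]; first by have := st' E9; rewrite opt ltnn.
  have [|x [lx wx]] := eq; first by rewrite wE sE.
  by exists x; split; [apply: lay | rewrite -wE].
exact: st' (leqW E8).
Qed.

(** Induction on the number of vertices. Contracting a bridge lowers the total length, so [N_4] is
    not optimal. Vertices of degree 2 come before other two-edge cuts because only there is the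
    layout carried back; once none is left, there are at most 9 edges. *)
Lemma connected_structured D (l : edge D -> nat) : connected_by [set: edge D] ->
  0 < #|vert D| -> #|edge D| = #|vert D| + 3 -> (forall e, 0 < l e) -> structured l.
Proof.
have [n] := ubnP #|vert D|; elim: n D l => // n IHn D l Vn conn V0 E l0.
have [tec|ntec] := pselect (three_edge_connected D); first exact: tec_structured.
have nonloop (f : edge D) X : f \in cut X -> tgt f != src f.
  by apply: contraTneq => tf; rewrite in_cut tf addbb.
have step (f : edge D) (v w : vert D) (fvw : ends f = [set v; w]) (vw : w != v) l' :
    (forall e, 0 < l' e) -> @structured (contract f vw) l'.
  move=> l'0; have EC := card_edge_contract fvw vw; have VC := card_vert_contract f vw.
  apply: IHn => //.
  - by rewrite -ltnS -VC.
  - exact: connected_contract fvw vw conn.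
  - by apply/card_gt0P; exists (contract_pi vw w).
  - by apply/eqP; rewrite -eqSS -addSn -EC -VC E.
have [[X [f cX]]|nobridge] := pselect (exists (X : {set vert D}) f, cut X = [set f]).
  have fX : f \in cut X by rewrite cX inE.
  have fvw : ends f = [set tgt f; src f] by rewrite /ends setUC.
  have vw : src f != tgt f by rewrite eq_sym; apply: nonloop fX.
  have l'0 (e : edge (contract f vw)) : 0 < (l \o val) e by apply: l0.
  have [le _ _] := step f _ _ fvw vw _ l'0.
  have sE := @sum_contract D f _ _ vw l.
  have wE k : wcount l k = wcount (l \o val : edge (contract f vw) -> nat) k.
    apply: (wcount_contraction (contractP fvw vw)); right; apply/disconnectedP.
    have [X0 XT] := cut_nontrivial fX.
    by exists X; rewrite cX setCK.
  have lt : \sum_(e : edge (contract f vw)) (l \o val) e < \sum_e l e.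
    by rewrite -sE -addn1 addnC leq_add2r.
  have s4 : 4 <= \sum_e l e.
    apply: (@leq_trans #|edge D|); first by rewrite E -[4]/(1 + 3) leq_add2r.
    by rewrite -sum1_card; apply: leq_sum => g _; apply: l0.
  have lt4 : wcount l 4 < best 4 (\sum_e l e).
    by rewrite wE; apply: leq_ltn_trans (le 4 isT) _; apply: best4_strict.
  split=> // [k k4|opt]; last by rewrite opt ltnn in lt4.
  by rewrite wE; apply: leq_trans (le k k4) _; apply: best_mono => //; apply: ltnW.
have cut2 (X : {set vert D}) : X != set0 -> X != setT -> 2 <= #|cut X|.
  move=> X0 XT; have [e _ eX] := connected_cutP _ conn X X0 XT.
  have c0 : 0 < #|cut X| by apply/card_gt0P; exists e.
  rewrite ltn_neqAle c0 andbT eq_sym; apply/negP => /cards1P[f cX].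
  by apply: nobridge; exists X, f.
have [X [X0 XT two]] : exists X : {set vert D}, [/\ X != set0, X != setT &
    exists e f, e != f /\ cut X = [set e; f]].
  case: (cut_cases conn) => [//|[X [X0 XT [[f cX]|two]]]]; last by exists X.
  by case: nobridge; exists X, f.
have V2 : 1 < #|vert D|.
  have [x xX] := set0Pn _ X0; move: XT; rewrite -subTset => /subsetPn[y _ yX].
  rewrite (leq_trans _ (max_card [set x; y])) // cards2.
  by case: eqP => // xy; rewrite -xy xX in yX.
have E5 : 5 <= #|edge D| by rewrite E -[5]/(2 + 3) leq_add2r.
have lw (e f : edge D) (v w : vert D) (vw : w != v) :
    forall g : edge (contract f vw), 0 < (shift_weight e f l \o val) g.
  move=> g /=; rewrite /shift_weight; have /negPf-> : val g != f by apply: svalP g.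
  by case: ifP => // _; rewrite addn_gt0 l0.
have [[z z2]|no2] := pselect (exists z : vert D, #|darts_at z| = 2).
  have z0 : [set z] != set0 by apply/set0Pn; exists z; rewrite inE.
  have zT : [set z] != setT.
    by apply: contraTneq V2 => zT; rewrite -cardsT -zT cards1.
  have c2 := cut2 _ z0 zT.
  have ca : cut [set z] = [set d.1 | d in darts_at z].
    apply/eqP; rewrite eqEcard cut1_darts (leq_trans (leq_imset_card _ _)) //.
    by rewrite z2.
  have cc : #|cut [set z]| == 2.
    by rewrite eqn_leq c2 andbT ca -z2 leq_imset_card.
  have /cards2P[e [f [ef cef]]] := cc.
  have fz : f \in cut [set z] by rewrite cef !inE eqxx orbT.
  have [w [fzw zw]] : exists w, ends f = [set z; w] /\ w != z.
    move: fz; rewrite in_cut !in_set1; case: (eqVneq (src f) z) => [sz|sz] /=.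
      by move=> tz; exists (tgt f); rewrite /ends sz.
    by move=> /eqP tz; exists (src f); rewrite /ends tz setUC.
  have st := step f z w fzw zw _ (lw e f z w zw).
  apply: (@two_edge_cut_structured D [set z] e f z w l fzw zw ef cef E5 l0 st).
  right=> x; apply: (K33_layout_suppress fzw) => // d dz.
  by rewrite -cef ca; apply: imset_f; rewrite inE dz.
case: two => e [f [ef cX]].
have fX : f \in cut X by rewrite cX !inE eqxx orbT.
have fvw : ends f = [set tgt f; src f] by rewrite /ends setUC.
have vw : src f != tgt f by rewrite eq_sym; apply: nonloop fX.
have st := step f _ _ fvw vw _ (lw e f _ _ vw).
apply: (@two_edge_cut_structured D X e f _ _ l fvw vw ef cX E5 l0 st).
left; suff : #|vert D| <= 6 by rewrite E -(leq_add2r 3).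
have d3 (v : vert D) : 3 <= #|darts_at v|.
  rewrite ltn_neqAle; apply/andP; split.
    by apply/eqP => v2; apply: no2; exists v.
  apply: leq_trans (leq_trans (subset_leq_card (cut1_darts v)) (leq_imset_card _ _)).
  apply: cut2; first by apply/set0Pn; exists v; rewrite inE.
  by apply: contraTneq V2 => zT; rewrite -cardsT -zT cards1.
have := sum_card_lower d3; rewrite sum_darts_at E; lia.
Qed.

(** * Components and spanning trees *)

Section Components.
Variable G : mgraph.
Implicit Types (A B : {set edge G}) (x y : vert G) (e : edge G).

Definition components A : {set {set vert G}} := [set component A x | x : vert G].

Lemma connect_adj_sym A : connect_sym (adj A).
Proof. exact/sym_connect_sym/adj_sym. Qed.

Lemma component_eq A x y : (component A x == component A y) = connect (adj A) x y.
Proof.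
apply/eqP/idP => [/setP/(_ y)|xy].
  by rewrite !inE connect0 => ->.
by apply/setP => z; rewrite !inE (same_connect (connect_adj_sym A) xy).
Qed.

Lemma connect_sub_adj A B x y : A \subset B -> connect (adj A) x y -> connect (adj B) x y.
Proof.
move=> AB; apply: connect_sub => u v /existsP[e /andP[eA ee]].
by apply/connect1/existsP; exists e; rewrite (subsetP AB).
Qed.

Lemma connect_ends A e : e \in A -> connect (adj A) (src e) (tgt e).
Proof. by move=> eA; apply/connect1/existsP; exists e; rewrite eA /ends eqxx. Qed.

Lemma connect_setU1 A e x y : connect (adj (e |: A)) x y ->
  connect (adj A) x y \/
  (connect (adj A) (src e) x || connect (adj A) (tgt e) x) /\
  (connect (adj A) (src e) y || connect (adj A) (tgt e) y).
Proof.
move=> xy; pose near z := connect (adj A) (src e) z || connect (adj A) (tgt e) z.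
pose X := [set z | connect (adj A) x z || near x && near z].
have : y \in X.
  rewrite -(closed_connect _ xy) ?inE ?connect0 //; apply: adj_closed.
  apply/pred0P => g /=; apply/negP => /andP[/setU1P[->|gA]]; rewrite in_cut !inE.
    have -> : near (src e) by rewrite /near connect0.
    have -> : near (tgt e) by rewrite /near connect0 orbT.
    rewrite !andbT; case nx : (near x); rewrite ?orbT ?orbF // => ne.
    suff : near x by rewrite nx.
    rewrite /near ![connect _ _ x](connect_adj_sym A).
    by move: ne; do 2!case: connect.
  have cg := connect_ends gA.
  rewrite /near !(same_connect_r (connect_adj_sym A) cg).
  by rewrite addbb.
by rewrite inE => /orP[xy'|/andP[]]; [left | right].
Qed.

Definition hull B (C : {set vert G}) : {set vert G} :=
  [set y | [exists x in C, connect (adj B) x y]].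

Lemma hull_component A B x : A \subset B -> hull B (component A x) = component B x.
Proof.
move=> AB; apply/setP => y; rewrite !inE; apply/exists_inP/idP => [[z]|xy].
  by rewrite inE => /(connect_sub_adj AB); apply: connect_trans.
by exists x; rewrite ?inE ?connect0.
Qed.

Lemma hull_components A B : A \subset B -> hull B @: components A = components B.
Proof.
move=> AB; rewrite /components -imset_comp; apply: eq_imset => x /=.
exact: hull_component.
Qed.

(** The map [hull] from the components of [A] to those of [e |: A] is injective once the component
    of [tgt e] is left out. *)
Lemma components_setU1_le A e : #|components A| <= #|components (e |: A)|.+1.
Proof.
set b := component A (tgt e); rewrite [#|components A|](cardsD1 b) -add1n.
apply: leq_add; first exact: leq_b1.
have sub : A \subset e |: A by apply: subsetUr.
rewrite -(hull_components sub).
apply: leq_trans (_ : #|[set hull (e |: A) C | C in components A :\ b]| <= _); last first.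
  by apply/subset_leq_card/imsetS/subD1set.
rewrite card_in_imset // => C1 C2 /setD1P[nx /imsetP[x _ E1]] /setD1P[ny /imsetP[y _ E2]].
subst C1 C2; move/negPf: nx => nx; move/negPf: ny => ny.
rewrite /b component_eq connect_adj_sym in nx; rewrite /b component_eq connect_adj_sym in ny.
rewrite !hull_component // => /eqP; rewrite component_eq => /connect_setU1.
rewrite nx ny !orbF => -[xy|[ax ay]]; apply/eqP; rewrite component_eq //.
by apply: connect_trans ay; rewrite connect_adj_sym.
Qed.

Lemma components_setU1_lt A e : ~~ connect (adj A) (src e) (tgt e) ->
  #|components (e |: A)| < #|components A|.
Proof.
move=> ne; have sub : A \subset e |: A by apply: subsetUr.
set b := component A (tgt e).
have bA : b \in components A by apply: imset_f.
rewrite [#|components A|](cardsD1 b) bA add1n ltnS -(hull_components sub).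
apply: leq_trans (leq_imset_card (hull (e |: A)) (components A :\ b)).
apply/subset_leq_card/subsetP => _ /imsetP[C CA ->].
have [->|Cb] := eqVneq C b; last by apply: imset_f; rewrite in_setD1 Cb.
have -> : hull (e |: A) b = hull (e |: A) (component A (src e)).
  rewrite !hull_component //; apply/eqP; rewrite component_eq connect_adj_sym.
  by apply: connect_ends; rewrite setU11.
by apply: imset_f; rewrite in_setD1 component_eq ne imset_f.
Qed.

Lemma components_setU A B : #|components A| <= #|components (B :|: A)| + #|B|.
Proof.
have [n] := ubnP #|B|; elim: n A B => // n IHn A B Bn.
have [->|/set0Pn[e eB]] := eqVneq B set0; first by rewrite set0U leq_addr.
rewrite (cardsD1 e) eB in Bn *; rewrite -{1}(setD1K eB) -setUA.
apply: leq_trans (IHn A (B :\ e) Bn) _.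
by rewrite add1n addnS -addSn leq_add2r components_setU1_le.
Qed.

Lemma components0 : #|components set0| = #|vert G|.
Proof.
rewrite card_imset ?cardsT // => x y /eqP; rewrite component_eq => /connectP[[|z p] /=].
  by move=> _ ->.
by case/andP => /existsP[e]; rewrite inE.
Qed.

Lemma components_connected A : connected_by A -> 0 < #|vert G| -> #|components A| = 1.
Proof.
move=> /forallP cA /card_gt0P[x _]; apply/eqP/cards1P; exists (component A x).
apply/setP => C; rewrite inE; apply/imsetP/eqP => [[y _ ->]|->]; last by exists x.
by apply/eqP; rewrite component_eq; apply/forallP: (cA y) x.
Qed.

Lemma connected_card A : connected_by A -> #|vert G| <= #|A|.+1.
Proof.
move=> cA; have [V0|V0] := posnP #|vert G|; first by rewrite V0.
by have := components_setU set0 A; rewrite setU0 components0 components_connected.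
Qed.

Lemma connected_setD1 A e : connected_by A -> e \in A ->
  connect (adj (A :\ e)) (src e) (tgt e) -> connected_by (A :\ e).
Proof.
move=> /forallP cA eA ce; apply/forallP => x; apply/forallP => y.
have /forallP/(_ y) xy := cA x; move: xy; apply: connect_sub => u v /existsP[g /andP[gA guv]].
have [ge|ge] := eqVneq g e; last first.
  by apply/connect1/existsP; exists g; rewrite in_setD1 ge gA.
rewrite ge /ends in guv; have : (u \in [set src e; tgt e]) && (v \in [set src e; tgt e]).
  by rewrite (eqP guv) !inE !eqxx orbT.
rewrite !inE => /andP[/orP[]/eqP-> /orP[]/eqP->] //.
by rewrite connect_adj_sym.
Qed.

(** By minimality the ends of an edge of [A] are not connected by other edges of [A], so adding the
    edges one at a time lowers the number of components at every step. *)
Lemma minimal_connected_card A : 0 < #|vert G| -> connected_by A ->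
  (forall e, e \in A -> ~~ connected_by (A :\ e)) -> #|A|.+1 = #|vert G|.
Proof.
move=> V0 cA mA; apply/eqP; rewrite eqn_leq connected_card // andbT.
suff H B : B \subset A -> #|components B| + #|B| <= #|vert G|.
  by have := H A (subxx A); rewrite components_connected.
have [n] := ubnP #|B|; elim: n B => // n IHn B Bn BA.
have [->|/set0Pn[e eB]] := eqVneq B set0; first by rewrite cards0 components0 addn0.
have eA := subsetP BA e eB.
rewrite (cardsD1 e) eB in Bn *; have := IHn (B :\ e) Bn (subset_trans (subD1set _ _) BA).
apply: leq_trans; rewrite add1n addnS -addSn leq_add2r -{1}(setD1K eB).
apply: components_setU1_lt; apply: contra (mA e eA) => ce.
apply: connected_setD1 => //; apply: connect_sub_adj ce; exact: setSD.
Qed.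

Lemma path_cut (X : {set vert G}) (d : dart G) p (y : vert G) :
  path (@follows G) d p -> (dtgt d \in X) != (dtgt (last d p) \in X) ->
  exists2 d', d' \in p & d'.1 \in cut X.
Proof.
elim: p d => [|d' p IHp] d /=; first by rewrite eqxx.
case/andP => /eqP dd' pp; have [dX|dX] := eqVneq (dtgt d \in X) (dtgt d' \in X).
  by rewrite dX => /(IHp _ pp)[g gp gX]; exists g; rewrite // inE gp orbT.
exists d'; first by rewrite inE eqxx.
move: dX; rewrite dd' in_cut /dsrc /dtgt; case: d'.2; do 2!case: (_ \in X) => //.
Qed.

Lemma cycle_cut (X : {set vert G}) c e : is_cycle c -> e \in [seq d.1 | d <- c] ->
  e \in cut X -> exists g, [/\ g \in [seq d.1 | d <- c], g != e & g \in cut X].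
Proof.
case/and4P => _ cyc _ uc /mapP[d dc ->] dX.
have [i p cE] := rot_to dc.
have up : d.1 \notin [seq d'.1 | d' <- p].
  by move: uc; rewrite -(rot_uniq i) -map_rot cE => /andP[].
have sub d' : d' \in p -> d' \in c by move=> dp; rewrite -(mem_rot i) cE inE dp orbT.
have : cycle (@follows G) (d :: p) by rewrite -cE rot_cycle.
rewrite /= rcons_path => /andP[pp /eqP ld].
have : (dtgt d \in X) != (dtgt (last d p) \in X).
  by move: dX; rewrite ld in_cut /dsrc /dtgt; case: d.2; do 2!case: (_ \in X).
case/(path_cut (dtgt d) pp) => d' d'p d'X; exists d'.1; split=> //.
  by apply/map_f/sub.
by apply: contraNneq up => <-; apply: map_f.
Qed.

Lemma cycle_connected A c e : is_cycle c -> {subset [seq d.1 | d <- c] <= A} ->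
  e \in [seq d.1 | d <- c] -> connected_by A -> connected_by (A :\ e).
Proof.
move=> cyc cA ec /connected_cutP conn; apply/connected_cutP => X X0 XT.
have [g gA gX] := conn X X0 XT; have [ge|ge] := eqVneq g e; last first.
  by exists g; rewrite // in_setD1 ge.
have [|h [hc he hX]] := @cycle_cut X c e cyc ec; first by rewrite -ge.
by exists h; rewrite // in_setD1 he cA.
Qed.

Lemma adj_dart A x y : adj A x y ->
  exists d : dart G, [/\ d.1 \in A, dsrc d = x & dtgt d = y].
Proof.
case/existsP => e /andP[eA /eqP/setP E].
have := E (src e); have := E (tgt e); have := E x; have := E y.
rewrite /ends !inE !eqxx ?orbT /= => yE xE /esym tE /esym sE.
have [sx|sx] := eqVneq (src e) x.
  exists (e, false); split=> //; rewrite /dtgt /=.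
  case/orP: tE => /eqP tE //; case/orP: yE => /eqP // yE; congruence.
exists (e, true); split; rewrite // /dsrc /dtgt /=.
  by move: xE; rewrite eq_sym (negPf sx) => /eqP.
by move: sE; rewrite (negPf sx) => /eqP.
Qed.

Lemma path_darts A x p : path (adj A) x p -> uniq (x :: p) ->
  exists s : seq (dart G),
   [/\ [seq dtgt d | d <- s] = p, forall d, d \in s -> d.1 \in A,
     [seq dsrc d | d <- s] = belast x p,
     forall d, dtgt d = x -> path (@follows G) d s & uniq [seq d.1 | d <- s]].
Proof.
elim: p x => [|z p IHp] x /=; first by exists [::].
case/andP => /adj_dart[d [dA dx dz]] pp /andP[xp up].
have [s [st sA ss sf us]] := IHp z pp up.
exists (d :: s); split=> /=.
- by rewrite dz st.
- by move=> d'; rewrite inE => /orP[/eqP->|/sA].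
- by rewrite dx ss.
- by move=> d' dx'; rewrite /follows dx' dx eqxx sf.
rewrite us andbT; apply: contra xp => /mapP[d' ds' dd'].
have sp : dsrc d' \in z :: p by rewrite mem_belast // -ss map_f.
have tp : dtgt d' \in z :: p by rewrite inE -st map_f ?orbT.
move: sp tp dx; rewrite /dsrc /dtgt dd'.
by case: d'.2; case: d.2 => sp tp <-.
Qed.

Lemma connect_cycle A e : e \notin A -> connect (adj A) (tgt e) (src e) ->
  exists c, is_cycle c /\ {subset [seq d.1 | d <- c] <= e |: A}.
Proof.
move=> eA /connectP[q /shortenP[p pp up _]] lp.
have [s [st sA ss sf us]] := path_darts pp up.
exists ((e, false) :: s); split; last first.
  move=> g; rewrite inE => /orP[/eqP->|/mapP[d ds ->]]; first exact: setU11.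
  by rewrite in_setU1 sA ?orbT.
apply/and4P; split=> //.
- rewrite /= rcons_path sf //= /follows -[dsrc (e, false)]/(src e) lp.
  by rewrite -[dtgt (last _ _)](last_map (@dtgt G)) st.
- rewrite [map _ _]/= ss -[dsrc (e, false)]/(src e) lp.
  by rewrite cons_uniq -rcons_uniq -lastI.
rewrite [map _ _]/= cons_uniq us andbT; apply: contra eA => /mapP[d ds ->].
exact: sA.
Qed.

(** Replaces acyclicity by an edge count, so that in corank 4 the spanning trees are the connected
    complements of sets of four edges. *)
Lemma spanning_treeP A : 0 < #|vert G| ->
  spanning_tree A = connected_by A && (#|A|.+1 == #|vert G|).
Proof.
move=> V0; rewrite /spanning_tree; have [cA|//] := boolP (connected_by A).
apply/asboolP/eqP => [acyc|cardA c cyc cA'].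
  apply: minimal_connected_card => // e eA; apply/negP => cAe.
  have [c [cyc sub]] : exists c, is_cycle c /\ {subset [seq d.1 | d <- c] <= e |: (A :\ e)}.
    apply: connect_cycle; first by rewrite setD11.
    by have /forallP/(_ (tgt e))/forallP/(_ (src e)) := cAe.
  by apply: (acyc c cyc) => g /sub; rewrite setD1K.
case: c cyc cA' => [//|d c] cyc cA'.
have dc : d.1 \in [seq d'.1 | d' <- d :: c] by apply: map_f; rewrite inE eqxx.
have := connected_card (cycle_connected cyc cA' dc cA).
by rewrite -cardA (cardsD1 d.1 A) cA' // ltnn.
Qed.

End Components.

(** * Weak subdivisions *)

Section WeakSubdivisionFacts.
Variables (D : mgraph) (l : edge D -> nat).
Let W := weak_subdivision l.

Lemma merge_eq (x y : vert D) : (Defs.merge l x == Defs.merge l y) = connect (adj (zero_edges l)) x y.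
Proof. by rewrite -val_eqE /= component_eq. Qed.

Lemma merge_zero (e : edge D) : l e = 0 -> Defs.merge l (src e) = Defs.merge l (tgt e).
Proof.
by move=> le; apply/eqP; rewrite merge_eq; apply: connect_ends; rewrite inE le.
Qed.

Lemma chain_vert_end (e : edge D) : chain_vert l e (l e) = inl (Defs.merge l (tgt e)).
Proof.
suff gen k : k = l e -> chain_vert l e k = inl (Defs.merge l (tgt e)) by apply: gen.
case: k => [/esym le|k kl] /=; first by rewrite merge_zero.
by rewrite insubF // -kl /= ltnn.
Qed.

Lemma wsub_vert_cases (y : vert W) :
  (exists x, y = inl (Defs.merge l x)) \/
  exists e k, 0 < k < l e /\ y = chain_vert l e k.
Proof.
case: y => [[S SM]|[e i]].
  by left; have /imsetP[x _ SE] := SM; exists x; congr inl; apply: val_inj.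
right; exists e, i.+1; split; first by rewrite /= -ltn_predRL.
rewrite /chain_vert; case: insubP => [j _ ji|]; last by rewrite ltn_ord.
by congr (inr (existT _ _ _)); apply: val_inj; rewrite ji.
Qed.

Definition wsub_dart (e : edge D) (i : 'I_(l e)) : dart W := (existT _ e i : edge W, false).

Lemma card_wsub_edge : #|edge W| = \sum_e l e.
Proof.
rewrite card_tagged sumnE big_map big_enum /=.
by apply: eq_bigr => e _; rewrite card_ord.
Qed.

Lemma card_wsub_vert : #|vert W| = #|components (zero_edges l)| + \sum_e (l e).-1.
Proof.
rewrite card_sum card_tagged sumnE big_map big_enum /=; congr (_ + _).
  by rewrite card_sig; apply: eq_card => S; rewrite inE.
by apply: eq_bigr => e _; rewrite card_ord.
Qed.

Lemma wcount_gt0P k : 0 < wcount l k ->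
  exists S : {set edge D}, [/\ #|S| = k, connected_by (~: S) & forall e, e \in S -> 0 < l e].
Proof.
rewrite lt0n sum_nat_eq0 negb_forall => /existsP[S]; rewrite negb_imply.
case/andP => /andP[/eqP Sk cS]; rewrite -lt0n => P; exists S; split=> // e eS.
by move: P; rewrite (bigD1 e) //= muln_gt0 => /andP[].
Qed.

Hypotheses (V0 : 0 < #|vert D|) (corank4 : #|edge D| = #|vert D| + 3).
Hypothesis tree : 0 < wcount l 4.

(** A positive [wcount l 4] provides four edges of positive weight whose complement is connected,
    hence a spanning tree by its size. It contains all edges of weight 0, which therefore form a
    forest. *)
Lemma zero_edges_components : #|components (zero_edges l)| + #|zero_edges l| = #|vert D|.
Proof.
have [S [S4 cS lS]] := wcount_gt0P tree.
apply/eqP; rewrite eqn_leq; apply/andP; split; last first.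
  have := components_setU (set0 : {set edge D}) (zero_edges l).
  by rewrite setU0 components0.
have sub : zero_edges l \subset ~: S.
  apply/subsetP => e; rewrite !inE => /eqP le; apply/negP => /lS.
  by rewrite le.
have := components_setU (zero_edges l) (~: S :\: zero_edges l).
have -> : (~: S :\: zero_edges l) :|: zero_edges l = ~: S.
  apply/setP => e; have := subsetP sub e; rewrite !inE.
  by case: (l e == 0); case: (e \in S) => // /(_ isT).
rewrite (components_connected cS V0) cardsD (setIidPr sub).
have := cardsC S; rewrite S4 corank4; have := subset_leq_card sub.
by move: #|~: S| #|zero_edges l| #|components _| #|vert D| => a b c d; lia.
Qed.

Lemma card_wsub : #|vert W| + 3 = \sum_e l e.
Proof.
rewrite card_wsub_vert; have zc := zero_edges_components.
have E : \sum_e (l e).-1 + #|edge D| = \sum_e l e + #|zero_edges l|.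
  have -> : #|zero_edges l| = \sum_e (l e == 0).
    by rewrite -sum1_card big_mkcond; apply: eq_bigr => e _; rewrite inE; case: eqP.
  have -> : #|edge D| = \sum_(e : edge D) 1 by rewrite sum1_card.
  by rewrite -!big_split; apply: eq_bigr => e _ /=; case: (l e) => [|n] /=; rewrite ?addn0 ?addn1.
move: E; rewrite corank4 -zc.
by move: #|zero_edges l| #|components _| (\sum_e _) (\sum_e _) => a b c d; lia.
Qed.

(** A cycle of weight 0 would lie in the complement of four edges of positive weight; deleting one
    of its edges would leave a connected set with too few edges. *)
Lemma admissible_tree : admissible l.
Proof.
move=> c cyc; have [S [S4 cS lS]] := wcount_gt0P tree.
rewrite lt0n; apply/negP; rewrite -(big_map (fun d => d.1) xpredT) sum_nat_seq_eq0 => /allP al.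
have sub : {subset [seq d.1 | d <- c] <= ~: S}.
  by move=> e /al /eqP le; rewrite inE; apply/negP => /lS; rewrite le.
case: c cyc al sub => [//|d c] cyc _ sub.
have dc : d.1 \in [seq d'.1 | d' <- d :: c] by apply: map_f; rewrite inE eqxx.
have := connected_card (cycle_connected cyc sub dc cS).
have := cardsC S; rewrite S4 corank4 (cardsD1 d.1 (~: S)) sub //.
by move: #|_ :\ _| #|vert D| => a b; lia.
Qed.

End WeakSubdivisionFacts.

Section ChainChoices.
Variables (D : mgraph) (l : edge D -> nat).
Let W := weak_subdivision l.

(** A choice of at most one edge in each chain, [None] standing for no edge. It links the sets
    counted by [wcount l] to sets of edges of the subdivision. *)
Definition choice_ok (g : {ffun edge D -> option (edge W)}) : bool :=
  [forall e, if g e is Some a then tag a == e else true].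
Definition choice_support (g : {ffun edge D -> option (edge W)}) : {set edge D} :=
  [set e | g e != None].
Definition choice_set (g : {ffun edge D -> option (edge W)}) : {set edge W} :=
  [set a | g (tag a) == Some a].

Definition chosen (e : edge D) : pred (option (edge W)) :=
  fun o => if o is Some a then tag a == e else false.

Lemma card_choices (S : {set edge D}) :
  #|[set g | choice_ok g && (choice_support g == S)]| = \prod_(e in S) l e.
Proof.
pose F (e : edge D) := if e \in S then chosen e else pred1 None.
have -> : #|[set g | choice_ok g && (choice_support g == S)]| = #|family F|.
  apply: eq_card => g; rewrite inE; apply/andP/familyP => [[/forallP ok /eqP SE] e|fam].
    by rewrite /F -SE inE /chosen; have := ok e; case: (g e) => [a|] //=; rewrite ?inE.
  split.
    apply/forallP => e; have := fam e; rewrite /F; case: (g e) => // a.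
    by case: ifP.
  apply/eqP/setP => e; rewrite inE; have := fam e; rewrite /F.
  by case: (g e) => [a|]; case: ifP.
rewrite card_family foldrE big_map big_enum /= [RHS]big_mkcond /=.
apply: eq_bigr => e _; rewrite /F; case: ifP => _; last by rewrite card1.
rewrite -[RHS](card_ord (l e)).
pose h (i : 'I_(l e)) : option (edge W) := Some (existT _ e i).
have injh : injective h.
  by move=> i j [] /eqP; rewrite eq_Tagged => /eqP.
rewrite -(card_codom injh); apply: eq_card => o.
apply/idP/codomP => [|[i ->]]; last exact: (eqxx e).
by case: o => // -[e' i] /eqP /= ee; subst e'; exists i.
Qed.

Lemma choice_set_inj : {in choice_ok &, injective choice_set}.
Proof.
move=> g h /forallP og /forallP oh /setP E; apply/ffunP => e.
have := og e; have := oh e; have Ea a := E a.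
case Ge : (g e) => [a|]; case He : (h e) => [b|] //.
- move=> /eqP tb /eqP ta; have := Ea a; rewrite !inE ta Ge eqxx He => /esym/eqP[->] //.
- by move=> _ /eqP ta; have := Ea a; rewrite !inE ta Ge eqxx He.
by move=> /eqP tb _; have := Ea b; rewrite !inE tb He eqxx Ge.
Qed.

Lemma card_choice_set g : choice_ok g -> #|choice_set g| = #|choice_support g|.
Proof.
move=> /forallP ok; rewrite -(card_in_imset (f := tag) (D := choice_set g)); last first.
  by move=> a b; rewrite !inE => /eqP ga /eqP gb tab; move: ga; rewrite tab gb => -[].
apply: eq_card => e; rewrite inE; apply/imsetP/idP => [[a]|].
  by rewrite inE => /eqP ga ->; rewrite ga.
case Ge : (g e) => [a|] // _; have := ok e; rewrite Ge => /eqP te.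
by exists a; rewrite // inE te Ge.
Qed.

Lemma chain_crossing (X : {set vert W}) (e : edge D) i j : i <= j -> j <= l e ->
  (chain_vert l e i \in X) != (chain_vert l e j \in X) ->
  exists k : 'I_(l e), i <= k < j /\ (existT _ e k : edge W) \in cut X.
Proof.
move=> ij; elim: j ij => [|j IHj].
  by rewrite leqn0 => /eqP-> _; rewrite eqxx.
rewrite leq_eqVlt => /orP[/eqP-> _|]; first by rewrite eqxx.
rewrite ltnS => ij jl ne.
have [E|E] := eqVneq (chain_vert l e j \in X) (chain_vert l e j.+1 \in X).
  have [|k [/andP[ik kj] kX]] := IHj ij (ltnW jl); first by rewrite E.
  by exists k; rewrite ik (leqW kj).
exists (Ordinal jl); split; first by rewrite /= ij leqnn.
rewrite in_cut -[(_ (+) _)]/((chain_vert l e j \in X) (+) (chain_vert l e j.+1 \in X)).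
by move: E; move: (chain_vert l e j \in X) (chain_vert l e j.+1 \in X) => [] [].
Qed.

(** A cut inside the chosen set meets each chain at most once and meets no chain outside the
    support, so all images of vertices of [D] lie on one side. An inner vertex on the other side
    would force its chain to cross twice. *)
Lemma connected_choice g : 0 < #|vert D| -> choice_ok g ->
  connected_by (~: choice_support g) -> connected_by (~: choice_set g).
Proof.
move=> V0 /forallP ok /connected_cutP conn; apply/negPn/negP => /disconnectedP[X [X0 XT]].
rewrite setCK => /subsetP sub.
pose Y := [set x | (inl (Defs.merge l x) : vert W) \in X].
have cross e (k : 'I_(l e)) : (existT _ e k : edge W) \in cut X -> g e = Some (existT _ e k).
  by move=> /sub; rewrite inE => /eqP.
have Ytriv : Y = set0 \/ Y = setT.
  have [|Y0] := eqVneq Y set0; first by left.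
  have [|YT] := eqVneq Y setT; first by right.
  have [e eS eY] := conn Y Y0 YT.
  have [|k [_ kX]] := @chain_crossing X e 0 (l e) (leq0n _) (leqnn _).
    move: eY; rewrite chain_vert_end in_cut !inE /=.
    by do 2!case: (_ \in X).
  by move: eS; rewrite !inE (cross _ _ kX).
have same x x' : ((inl (Defs.merge l x) : vert W) \in X) = ((inl (Defs.merge l x') : vert W) \in X).
  case: Ytriv => /setP E; have := E x; have := E x'; rewrite !inE; by [move=> -> -> | move=> -> ->].
have /card_gt0P[x0 _] := V0.
have inner e k : 0 < k < l e ->
    (chain_vert l e k \in X) = ((inl (Defs.merge l x0) : vert W) \in X).
  case/andP => k0 kl; apply/eqP; apply: contraT => ne.
  have [|i [/andP[_ ik] iX]] := @chain_crossing X e 0 k (leq0n _) (ltnW kl).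
    by rewrite [chain_vert l e 0]/= (same _ x0) eq_sym.
  have [|j [/andP[kj _] jX]] := @chain_crossing X e k (l e) (ltnW kl) (leqnn _).
    by rewrite chain_vert_end (same _ x0).
  have := cross _ _ iX; rewrite (cross _ _ jX) => -[] /eqP; rewrite eq_Tagged /= => /eqP ji.
  by have := leq_trans ik kj; rewrite ji ltnn.
have all y : (y \in X) = ((inl (Defs.merge l x0) : vert W) \in X).
  case: (wsub_vert_cases y) => [[x ->]|[e [k [kl ->]]]]; [exact: same | exact: inner].
case E : ((inl (Defs.merge l x0) : vert W) \in X).
  by case/negP: XT; apply/eqP/setP => y; rewrite all E inE.
by case/negP: X0; apply/eqP/setP => y; rewrite all E inE.
Qed.

(** Different choices give different edge sets. For the optimal lengths, the reverse inequality
    comes from the upper bound valid for every graph of the class. *)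
Lemma wcount_wsub_ge k : 0 < #|vert D| -> wcount l k <= wcount (G := W) (fun=> 1) k.
Proof.
move=> V0; pose P (S : {set edge D}) := (#|S| == k) && connected_by (~: S).
rewrite {1}/wcount; under eq_bigr => S _ do rewrite -card_choices.
have -> : \sum_(S : {set edge D} | P S) #|[set g | choice_ok g && (choice_support g == S)]|
    = #|[set g | choice_ok g && P (choice_support g)]|.
  rewrite -sum1dep_card (partition_big choice_support P) /=; last by move=> g /andP[].
  apply: eq_bigr => S PS; rewrite -sum1dep_card; apply: eq_bigl => g.
  by rewrite -andbA; case: (choice_ok g) => //=; case: eqP => [->|]; rewrite ?PS ?andbF.
rewrite /wcount; under [X in _ <= X]eq_bigr => S _ do rewrite big1 //.
rewrite sum1dep_card -(card_in_imset (f := choice_set)); last first.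
  by move=> g h; rewrite !inE => /andP[og _] /andP[oh _]; apply: choice_set_inj.
apply/subset_leq_card/subsetP => A /imsetP[g]; rewrite inE => /andP[og /andP[gk gc]] ->.
by rewrite inE card_choice_set // gk connected_choice.
Qed.

End ChainChoices.

Lemma walkP G (d0 : dart G) (a : vert G) p b :
  walk a p b <-> b = last a [seq dtgt d | d <- p] /\
    forall k, k < size p -> dsrc (nth d0 p k) = nth a (a :: [seq dtgt d | d <- p]) k.
Proof.
elim: p a => [|d p IHp] a; first by split=> [/eqP->|[-> _]] //=.
have def k : k < (size p).+1 -> nth a (dtgt d :: [seq dtgt d | d <- p]) k =
    nth (dtgt d) (dtgt d :: [seq dtgt d | d <- p]) k.
  by move=> kp; apply: set_nth_default; rewrite [size _]/= size_map.
rewrite -[walk a (d :: p) b]/((dsrc d == a) && walk (dtgt d) p b).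
split=> [/andP[/eqP da /(iffLR (IHp _))[bE H]]|[bE H]].
  by split=> // -[|k] kp; [exact: da | rewrite [LHS]H // -def // leqW].
rewrite (eqP (introT eqP (H 0 isT))) eqxx; apply/(iffRL (IHp _)); split=> // k kp.
by rewrite (H k.+1 kp) -def // leqW.
Qed.

Lemma surjective_bij (A B : finType) (h : A -> B) :
  (forall b, exists a, h a = b) -> #|A| = #|B| -> bijective h.
Proof.
move=> sur AB; apply: bij_card => // a a' E.
have EB : #|codom h| = #|B|.
  by apply: eq_card => b; have [a'' <-] := sur b; rewrite codom_f.
have /image_injP inj : #|codom h| == #|A| by rewrite EB AB.
exact: inj.
Qed.

Section LayoutIso.
Variables (H : mgraph) (x : edge K33 -> nat).
Variables (v : vert K33 -> vert H) (w : edge K33 -> seq (dart H)) (e0 : edge H).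
Hypothesis wP : forall c, walk (v (src c)) (w c) (v (tgt c)).
Hypothesis wE : forall g, \sum_c count (fun d => d.1 == g) (w c) = 1.
Hypothesis wx : forall c, x c = size (w c).
Let W := weak_subdivision x.
Let d0 : dart H := (e0, false).

Lemma layout_merge (a b : vert K33) : connect (adj (zero_edges x)) a b -> v a = v b.
Proof.
move=> ab; pose X := [set y | v y == v a].
have : b \in X; last by rewrite inE => /eqP.
rewrite -(closed_connect (adj_closed _) ab) ?inE //.
apply/pred0P => c /=; apply/negP => /andP[]; rewrite !inE wx size_eq0 => /eqP c0.
have := wP c; rewrite c0 => /eqP /= ->; by rewrite addbb.
Qed.

(** Components are nonempty, so the default is never reached, and [layout_merge] makes the value
    independent of the representative. The inner vertex of index [i] has distance [i + 1] from the
    source of its chain, so it goes to the head of dart number [i]. *)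
Definition layout_vert (y : vert W) : vert H :=
  match y with
  | inl C => odflt (v (inl ord0)) (omap v [pick a | a \in val C])
  | inr ci => dtgt (nth d0 (w (tag ci)) (tagged ci))
  end.

Definition layout_edge (a : edge W) : edge H := (nth d0 (w (tag a)) (tagged a)).1.

Lemma layout_vert_merge a : layout_vert (inl (Defs.merge x a)) = v a.
Proof.
rewrite /=; case: pickP => [b|/(_ a)]; rewrite inE ?connect0 //=.
by move/layout_merge.
Qed.

Lemma layout_chain_vert c k : k <= x c ->
  layout_vert (chain_vert x c k) = nth (v (src c)) (v (src c) :: [seq dtgt d | d <- w c]) k.
Proof.
case: k => [|k] kx; first exact: layout_vert_merge.
rewrite [chain_vert _ _ _]/=; case: insubP => [i _ ik|].
  by rewrite /= ik (nth_map d0) // -wx.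
rewrite -leqNgt => xk; rewrite layout_vert_merge.
have /(walkP d0)[-> _] := wP c.
have -> : k = (size (w c)).-1 by rewrite -wx; move: kx xk; clear; lia.
rewrite -(size_map (@dtgt H)) -nth_last /=.
by rewrite (set_nth_default (v (src c))) // size_map -wx; move: kx; clear; lia.
Qed.

Lemma layout_ends a : ends (layout_edge a) = layout_vert @: ends a.
Proof.
case: a => c i; have ix : i < size (w c) by rewrite -wx.
rewrite /ends imsetU !imset_set1 /= -!/(chain_vert x c _).
have /(walkP d0)[_ /(_ _ ix) E] := wP c.
rewrite -[X in _ = _ :|: [set layout_vert X]]/(chain_vert x c i.+1).
rewrite !layout_chain_vert ?(ltnW (ltn_ord i)) ?ltn_ord // -E /= (nth_map d0) //.
by rewrite /layout_edge /= /dsrc /dtgt; case: (nth _ _ _) => g [] //=; rewrite setUC.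
Qed.

(** Every edge lies on exactly one trail, so the edge map is surjective between sets of equal size.
    The image of the vertex map contains the ends of all edges, so by connectivity it is everything.
    That trails do not revisit vertices follows from the vertex count. *)
Lemma layout_iso : connected_by [set: edge H] -> #|vert W| = #|vert H| ->
  iso W H.
Proof.
move=> /connected_cutP conn VH.
have sum_size : \sum_c size (w c) = #|edge H|.
  rewrite -sum1_card -(eq_bigr _ (fun g _ => wE g)) exchange_big /=.
  apply: eq_bigr => c _; elim: (w c) => [|d s IHs] /=; first by rewrite big1.
  by rewrite big_split /= -IHs (bigD1 d.1) //= eqxx big1 // => g /negPf; rewrite eq_sym => ->.
have EH : #|edge W| = #|edge H|.
  by rewrite card_wsub_edge -sum_size; apply: eq_bigr => c _; rewrite wx.
have esur g : exists a, layout_edge a = g.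
  have : has (fun c => 0 < count (fun d => d.1 == g) (w c)) (index_enum (edge K33)).
    apply: contraT => /hasPn no; have := wE g; rewrite big_seq big1 // => c /no.
    by rewrite -leqNgt leqn0 => /eqP.
  case/hasP => c _; rewrite -has_count => /hasP[d dw /eqP <-].
  have ix : index d (w c) < x c by rewrite wx index_mem.
  by exists (existT _ c (Ordinal ix)); rewrite /layout_edge /= nth_index.
have vsur y : exists z, layout_vert z = y.
  pose X := [set y | y \in codom layout_vert].
  suff /eqP XT : X == setT.
    have : y \in X by rewrite XT inE.
    by rewrite inE => /codomP[z ->]; exists z.
  apply: contraT => XT; have [|e _] := conn X _ XT.
    by apply/set0Pn; exists (layout_vert (inl (Defs.merge x (inl ord0)))); rewrite inE codom_f.
  have [a <-] := esur e; rewrite in_cut !inE.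
  have sub z : z \in ends (layout_edge a) -> z \in codom layout_vert.
    by rewrite layout_ends => /imsetP[z' _ ->]; apply: codom_f.
  by rewrite !sub // !inE eqxx ?orbT.
exists layout_vert, layout_edge; split; [exact: surjective_bij | exact: surjective_bij |].
exact: layout_ends.
Qed.

End LayoutIso.

Lemma K33_layout_iso H x : K33_layout (fun _ : edge H => 1) x -> 0 < #|edge H| ->
  connected_by [set: edge H] -> #|vert (weak_subdivision x)| = #|vert H| ->
  iso (weak_subdivision x) H.
Proof.
case=> v [w [wP wE wx]] /card_gt0P[e0 _]; apply: (layout_iso e0 wP wE) => c.
by rewrite wx sum1_size.
Qed.

Lemma wsub_layout (x : edge K33 -> nat) :
  K33_layout (fun _ : edge (weak_subdivision x) => 1) x.
Proof.
exists (fun y => inl (Defs.merge x y)), (fun c => [seq wsub_dart i | i <- enum 'I_(x c)]).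
split=> [c|[c i]|c]; last by rewrite sum1_size size_map size_enum_ord.
- set p := map _ _; have szp : size p = x c by rewrite size_map size_enum_ord.
  case E : p => [|d0 p'].
    by apply/eqP; congr inl; apply: (@merge_zero _ x c); rewrite -szp E.
  rewrite -E; have nthE k (kx : k < x c) : nth d0 p k = wsub_dart (Ordinal kx).
    rewrite (nth_map (Ordinal kx)) ?size_enum_ord //; congr wsub_dart.
    by apply: val_inj; rewrite /= nth_enum_ord.
  have nthV k : k <= x c ->
      nth (chain_vert x c 0) (chain_vert x c 0 :: [seq dtgt d | d <- p]) k = chain_vert x c k.
    case: k => [//|k] kx; rewrite -[LHS]/(nth (chain_vert x c 0) [seq dtgt d | d <- p] k).
    by rewrite (nth_map d0) ?szp // nthE.
  apply/(walkP d0); split; last first.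
    move=> k; rewrite szp => kx; rewrite -[inl _]/(chain_vert x c 0) nthV ?(ltnW kx) //.
    by rewrite nthE.
  rewrite -chain_vert_end -[inl (Defs.merge x (src c))]/(chain_vert x c 0).
  rewrite -(nthV _ (leqnn _)) -[LHS]/(nth (chain_vert x c 0) (chain_vert x c 0 :: map _ _) _).
  by rewrite -szp -(size_map (@dtgt _)) -[size _]/(size (chain_vert x c 0 :: map _ p)).-1 nth_last.
rewrite (bigD1 c) //= big1 => [|c' cc'].
  rewrite count_map addn0 (eq_count (a2 := pred1 i)) => [|j /=]; last by rewrite eq_Tagged.
  by rewrite (count_uniq_mem i (enum_uniq _)) mem_enum.
rewrite count_map; apply/eqP; rewrite -leqn0 leqNgt -has_count; apply/hasPn => j _ /=.
by apply: contra cc' => /eqP E; apply/eqP; apply: (congr1 tag E).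
Qed.

Lemma K33_layout_perm D (l : edge D -> nat) x (f g : 'I_3 -> 'I_3) :
  injective f -> injective g -> K33_layout l x ->
  K33_layout l (fun c : edge K33 => x (f c.1, g c.2)).
Proof.
move=> fi gi [v [w [wP wE wx]]].
pose h (c : edge K33) : edge K33 := (f c.1, g c.2).
exists (fun y => v (match y with inl i => inl (f i) | inr j => inr (g j) end)), (w \o h).
split=> [c|e|c]; [exact: (wP (h c)) | | exact: wx].
rewrite -(wE e) [RHS](reindex h) //; apply: onW_bij; apply: injF_bij.
by move=> [a b] [a' b'] [/fi -> /gi ->].
Qed.

(** * Reliability and isomorphism *)

Section CorankFour.
Variable H : mgraph.
Hypotheses (V0 : 0 < #|vert H|) (corank4 : #|edge H| = #|vert H| + 3).

Lemma wcount1 k : wcount (fun _ : edge H => 1) k =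
  \sum_(S : {set edge H} | (#|S| == k) && connected_by (~: S)) 1.
Proof. by apply: eq_bigr => S _; rewrite big1. Qed.

Lemma num_spanning_trees_wcount : num_spanning_trees H = wcount (fun _ : edge H => 1) 4.
Proof.
rewrite wcount1 /num_spanning_trees -sum1dep_card (reindex_inj (inv_inj (@setCK _))) /=.
apply: eq_bigl => S; rewrite spanning_treeP // andbC; congr (_ && _).
have := cardsC S; rewrite corank4; move: #|S| #|~: S| #|vert H| => a b c; clear.
by move=> E; apply/eqP/eqP; lia.
Qed.

Lemma reliability_wcount (R : realType) (p : R) :
  (reliability H p = \sum_(k < 5) (wcount (fun _ : edge H => 1%N) k)%:R
    * (p ^+ (#|edge H| - k) * (1 - p) ^+ k))%R.
Proof.
rewrite /reliability (reindex_inj (inv_inj (@setCK _))) /=.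
have S5 (S : {set edge H}) : connected_by (~: S) -> #|S| < 5.
  move=> cS; have := cardsC S; have := connected_card cS; rewrite corank4.
  by move: #|S| #|~: S| #|vert H| => a b c; clear; lia.
rewrite (partition_big (fun S : {set edge H} => inord #|S|) (xpredT : pred 'I_5)) //=.
apply: eq_bigr => k _; rewrite wcount1 natr_sum big_distrl /=; apply: eq_big => [S|S].
  have [cS|//] := boolP (connected_by _); rewrite ?andbF // andbT.
  by rewrite -val_eqE /= inordK // S5.
case/andP=> cS /eqP/(congr1 val); rewrite /= inordK ?S5 // => Sk.
by rewrite mul1r setCK -(cardsC S) -Sk addKn.
Qed.

End CorankFour.

Lemma iso_sym G H : iso G H -> iso H G.
Proof.
case=> f [g [[f' fK f'K] [g' gK g'K] fg]]; exists f', g'; split.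
- by exists f.
- by exists g.
move=> e; rewrite -{2}(g'K e) fg -imset_comp (eq_imset (g := id)) ?imset_id //; exact: fK.
Qed.

Lemma iso_trans G H K : iso G H -> iso H K -> iso G K.
Proof.
case=> f [g [bf bg fg]] [f' [g' [bf' bg' fg']]]; exists (f' \o f), (g' \o g); split.
- exact: bij_comp.
- exact: bij_comp.
by move=> e; rewrite /= fg' fg -imset_comp.
Qed.

Lemma iso_graph_class n m G H : iso G H -> graph_class n m G -> graph_class n m H.
Proof.
case=> f [g [bf bg fg]] [<- <- cG]; split.
- by rewrite (bij_eq_card bf).
- by rewrite (bij_eq_card bg).
by have := connected_iso bf bg fg set0; rewrite imset0 !setC0 cG.
Qed.

(** * The optimal weak subdivision *)

Lemma nat_intZ (n : nat) (q r : int) : (n%:Z = 9 * q + r)%R ->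
  Z.of_nat n = Z.add (Z.mul 9 (Z_of_int q)) (Z_of_int r).
Proof. by lia. Qed.

Lemma nat_int_eqZ (n : nat) (q : int) (z : Z) : Z.of_nat n = Z.add (Z_of_int q) z ->
  forall k : int, (n%:Z == q + k)%R = Z.eqb z (Z_of_int k).
Proof. by move=> E k; apply/eqP/Z.eqb_spec; lia. Qed.

Lemma card_K33 (P : pred (edge K33)) : #|[set c | P c]| = \sum_c P c.
Proof. by rewrite -sum1dep_card big_mkcond /=; apply: eq_bigr => c _; case: (P c). Qed.

Definition opt_weight (q r : Z) (c : edge K33) : nat := Z.to_nat (Z.add q (offset r c.1 c.2)).

Section OptWeight.
Variables (m : nat) (q r : Z).
Hypotheses (m4 : 4 <= m) (mE : Z.of_nat m = Z.add (Z.mul 9 q) r).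
Hypotheses (r1 : Z.le (-4) r) (r2 : Z.le r 4).

(** Nothing is truncated: [4 <= m] forces [q >= 0], and even [q >= 1] when [r] is negative. *)
Lemma opt_weightE c : Z.of_nat (opt_weight q r c) = Z.add q (offset r c.1 c.2).
Proof.
rewrite /opt_weight Z2Nat.id //; have := offset_range c.1 c.2 r1 r2; move: (offset _ _ _) => o.
by lia.
Qed.

Lemma opt_weight_gt0 c : 9 <= m -> 0 < opt_weight q r c.
Proof.
move=> m9; have := opt_weightE c; have := offset_range c.1 c.2 r1 r2; move: (offset _ _ _) => o.
by move: (opt_weight _ _ _) => n; lia.
Qed.

Lemma opt_weight_entry i j : i < 3 -> j < 3 ->
  Z.of_nat (K33_weight (opt_weight q r) i j) = Z.add q (offset r i j).
Proof. by move=> i3 j3; rewrite /K33_weight opt_weightE /= !inordK. Qed.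

Lemma sum_opt_weight : \sum_c opt_weight q r c = m.
Proof.
apply: Nat2Z.inj; rewrite sum_K33 !Nat2Z.inj_add !opt_weight_entry //.
have := offset_sum (conj r1 r2); rewrite /offset_row /row_sum /=.
rewrite mE; lia.
Qed.

Lemma wcount_opt_weight k : k <= 4 -> wcount (G := K33) (opt_weight q r) k = best k m.
Proof.
move=> k4; have := wcount_K33 (opt_weight q r) k4; cbv beta zeta.
rewrite !opt_weight_entry // -[K33_poly _ _ _ _ _ _ _ _ _ _]/(opt_poly k q r).
rewrite -opt_atE // -mE /best; move: (opt_at _ _) (wcount _ _) => a b; lia.
Qed.

Lemma opt_weight_balanced : balanced (opt_weight q r).
Proof.
move=> e f; have := opt_weightE e; have := opt_weightE f.
have := offset_range e.1 e.2 r1 r2; have := offset_range f.1 f.2 r1 r2.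
move: (offset _ _ _) (offset _ _ _) (opt_weight _ _ _) (opt_weight _ _ _) => a b c d.
by clear; lia.
Qed.

End OptWeight.

Section Placement.
Variables (m : nat) (q r : int).
Hypotheses (m4 : 4 <= m) (mE : (m%:Z = 9 * q + r)%R) (r4 : (- 4 <= r <= 4)%R).
Let w := opt_weight (Z_of_int q) (Z_of_int r).

Lemma int_residueP : (r = 0 \/ r = 1 \/ r = 2 \/ r = 3 \/ r = 4 \/
  r = - 1 \/ r = - 2 \/ r = - 3 \/ r = - 4)%R.
Proof. lia. Qed.

Lemma chains_opt_weight (k : int) (c : edge K33) :
  (c \in chains_of_length w (q + k)%R) = Z.eqb (offset (Z_of_int r) c.1 c.2) (Z_of_int k).
Proof.
rewrite inE; apply: nat_int_eqZ.
exact: (opt_weightE m4 (nat_intZ mE) ltac:(lia) ltac:(lia)).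
Qed.

Lemma card_chains_opt_weight (k : int) : #|chains_of_length w (q + k)%R| =
  \sum_c Z.eqb (offset (Z_of_int r) (c : edge K33).1 c.2) (Z_of_int k).
Proof. by rewrite -card_K33; apply: eq_card => c; rewrite chains_opt_weight inE. Qed.

Lemma opt_weight_chain_counts : chain_counts q r w.
Proof.
have card0 : #|chains_of_length w q| =
    \sum_c Z.eqb (offset (Z_of_int r) (c : edge K33).1 c.2) 0.
  by rewrite -(card_chains_opt_weight 0) addr0.
rewrite /chain_counts card0 !card_chains_opt_weight.
rewrite !sum_K33 /K33_weight /= !inordK //.
by case: int_residueP => [->|]; do 7?[case=> [->|]]; try move=> ->; split.
Qed.

Lemma opt_weight_placement : chain_placement q r w.
Proof.
have diag : (r = 2 \/ r = 3 \/ r = - 2 \/ r = - 3)%R -> forall k : int, (k != 0)%R ->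
    matching (chains_of_length w (q + k)%R).
  move=> rs k k0 e f; rewrite !chains_opt_weight => eS fS ef.
  have {eS fS} [] : e.1 = e.2 /\ f.1 = f.2.
    have dg (c : edge K33) : Z.eqb (offset (Z_of_int r) c.1 c.2) (Z_of_int k) -> c.1 = c.2.
      move=> /Z.eqb_eq E; apply: val_inj; move: E; have : Z_of_int k <> Z0 by lia.
      case: c => [[i i3] [j j3]] /=; case: rs => [->|[->|[->|->]]] /=;
        by move: i i3 j j3 => [|[|[|i]]] // _ [|[|[|j]]] // _ /=; lia.
    by split; apply: dg.
  case: e ef => e1 e2 ef /= E1; case: f ef => f1 f2 ef /= E; rewrite -E -E1 in ef *.
  have nef : e1 != f1 by apply: contraNneq ef => ->.
  apply/pred0P => y /=; apply/negP; rewrite !inE => /andP[/orP[]/eqP-> /orP[]/eqP // []].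
    by move/eqP; rewrite (negPf nef).
  by move/eqP; rewrite (negPf nef).
pose o0 : 'I_3 := Ordinal (isT : 0 < 3); pose o1 : 'I_3 := Ordinal (isT : 1 < 3).
pose o2 : 'I_3 := Ordinal (isT : 2 < 3).
split=> r_eq.
- by apply: diag => //; case: r_eq; tauto.
- by apply: diag => //; case: r_eq; tauto.
- exists [:: ((o1, o0) : edge K33, false); ((o0, o0), true); ((o0, o1), false)].
  exists [:: ((o2, o2) : edge K33, false)]; split=> //.
    by rewrite disjoint_has.
  apply/setP => c; rewrite chains_opt_weight r_eq inE.
  by case: c => [[[|[|[|i]]] i3] [[|[|[|j]]] j3]].
exists [:: ((o0, o0) : edge K33, true); ((o0, o1), false)].
exists [:: ((o1, o2) : edge K33, false); ((o2, o2), true)]; split=> //.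
  by rewrite disjoint_has.
apply/setP => c; rewrite chains_opt_weight r_eq inE.
by case: c => [[[|[|[|i]]] i3] [[|[|[|j]]] j3]].
Qed.

End Placement.

(** * Recovering the optimum from the placement of its chains *)

Lemma extend_uniq n (s : seq 'I_n) : uniq s ->
  exists2 f : 'I_n -> 'I_n, injective f & forall k : 'I_n, k < size s -> f k = nth k s k.
Proof.
move=> us; pose t := s ++ [seq x <- enum 'I_n | x \notin s].
have ut : uniq t.
  rewrite cat_uniq us filter_uniq ?enum_uniq // andbT.
  by apply/hasPn => x; rewrite mem_filter => /andP[].
have st : size t = n.
  rewrite -[RHS](size_enum_ord n); apply: perm_size; apply: uniq_perm => //.
    exact: enum_uniq.
  by move=> x; rewrite mem_cat mem_filter mem_enum andbT orbN.
exists (fun k => nth k t k) => [i j|k ks]; last by rewrite nth_cat ks.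
rewrite (set_nth_default j) ?st // => /eqP; rewrite nth_uniq ?st // => /eqP.
exact: val_inj.
Qed.

Lemma ord3_eq (a b c : 'I_3) : uniq [:: a; b; c] ->
  exists2 f : 'I_3 -> 'I_3, injective f &
    [/\ f (Ordinal (isT : 0 < 3)) = a, f (Ordinal (isT : 1 < 3)) = b &
        f (Ordinal (isT : 2 < 3)) = c].
Proof. by case/extend_uniq => f fi fE; exists f => //; split; rewrite fE. Qed.

Section Relabel.
Variable S : {set edge K33}.

Definition relabels (P : nat -> nat -> bool) : Prop :=
  exists f g : 'I_3 -> 'I_3, [/\ injective f, injective g &
    forall i j, ((f i, g j) \in S) = P i j].

(** The edges of a matching lie in distinct rows and in distinct columns; listing them orders both
    so that the edges fill the start of the diagonal. *)
Lemma matching_relabels : matching S -> #|S| <= 3 ->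
  relabels (fun i j => (i == j) && (i < #|S|)).
Proof.
move=> mS S3.
have inj1 : {in enum S &, injective (fun c : edge K33 => c.1)}.
  move=> c d; rewrite !mem_enum => cS dS cd; apply/eqP; apply: contraT => /(mS _ _ cS dS).
  by move=> /pred0P/(_ (inl c.1)); rewrite /= !inE /= cd eqxx.
have inj2 : {in enum S &, injective (fun c : edge K33 => c.2)}.
  move=> c d; rewrite !mem_enum => cS dS cd; apply/eqP; apply: contraT => /(mS _ _ cS dS).
  by move=> /pred0P/(_ (inr c.2)); rewrite /= !inE /= cd eqxx.
have [f fi fE] := extend_uniq (etrans (map_inj_in_uniq inj1) (enum_uniq S)).
have [g gi gE] := extend_uniq (etrans (map_inj_in_uniq inj2) (enum_uniq S)).
rewrite !size_map -cardE in fE gE.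
have fgE (k : 'I_3) : k < #|S| -> (f k, g k) = nth (k, k) (enum S) k.
  move=> kS; rewrite fE // gE // !(nth_map ((k, k) : edge K33)) -?cardE //.
  by case: (nth _ _ _).
exists f, g; split=> // i j; apply/idP/andP => [ijS|[/eqP/val_inj <- iS]]; last first.
  by rewrite fgE // -mem_enum mem_nth // -cardE.
have kS : index ((f i, g j) : edge K33) (enum S) < #|S| by rewrite cardE index_mem mem_enum.
pose k : 'I_3 := Ordinal (leq_trans kS S3).
have := fgE k kS; rewrite /= nth_index ?mem_enum // => -[/fi ki /gi kj].
by rewrite -ki -kj eqxx.
Qed.

Lemma cells_relabels (s : seq (nat * nat)) (f g : 'I_3 -> 'I_3) :
  injective f -> injective g ->
  all (fun c => (c.1 < 3) && (c.2 < 3)) s ->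
  S =i [seq (f (inord c.1), g (inord c.2)) | c <- s] ->
  relabels (fun i j => (i, j) \in s).
Proof.
move=> fi gi /allP s3 SE; exists f, g; split=> // i j; rewrite SE.
apply/mapP/idP => [[[a b] abs [/fi iE /gi jE]]|ijs].
  by have /andP[/= a3 b3] := s3 _ abs; rewrite iE jE !inordK.
by exists (i : nat, j : nat) => //=; rewrite !inord_val.
Qed.

Lemma K33_vert_eqE (a b : 'I_3) :
  ((((inl a : 'I_3 + 'I_3) == inl b) = (a == b)) * (((inr a : 'I_3 + 'I_3) == inr b) = (a == b)))
  * ((((inl a : 'I_3 + 'I_3) == inr b) = false) * (((inr a : 'I_3 + 'I_3) == inl b) = false)).
Proof. by []. Qed.

Let inordE : (inord 0 = Ordinal (isT : 0 < 3)) * (inord 1 = Ordinal (isT : 1 < 3)) *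
   (inord 2 = Ordinal (isT : 2 < 3)).
Proof. by split; [split|]; apply: val_inj; rewrite /= inordK. Qed.

Ltac distinct3 := rewrite /= !inE !negb_or ?andbT; repeat (apply/andP; split);
  apply/eqP => ?; subst;
  match goal with H : is_true (~~ _) |- _ => by move: H; rewrite ?eqxx ?orbT end.
Ltac same_cells := let c := fresh in intros c; match goal with H : S = _ |- _ => rewrite H !inE end;
  do 4!case: (c == _).

(** The darts of a path alternate in direction, so only the side on which the 3-edge path starts is
    free. It uses two rows and two columns, and disjointness puts the single edge in the third of
    each. *)
Lemma paths31_relabels : two_disjoint_paths 3 1 S ->
  relabels (fun i j => (i, j) \in [:: (0, 0); (0, 1); (1, 0); (2, 2)]).
Proof.
have key i0 i1 i2 j0 j1 j2 : uniq [:: i0; i1; i2] -> uniq [:: j0; j1; j2] ->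
    S =i [:: (i0, j0); (i0, j1); (i1, j0); (i2, j2)] ->
    relabels (fun i j => (i, j) \in [:: (0, 0); (0, 1); (1, 0); (2, 2)]).
  move=> /ord3_eq[f fi [f0 f1 f2]] /ord3_eq[g gi [g0 g1 g2]] SE.
  by apply: (cells_relabels fi gi) => // c; rewrite SE /= !inordE f0 f1 f2 g0 g1 g2.
case=> [[|[c1 b1] [|[c2 b2] [|[c3 b3] [|? ?]]]]] [[|[c4 b4] [|? ?]]] [[] // p1 _ [] // p2 _ dis SE].
case: c1 c2 c3 c4 p1 p2 dis SE => [i1 j1] [i2 j2] [i3 j3] [i4 j4].
case: b1; case: b2; case: b3; rewrite /is_path /follows /dsrc /dtgt /= ?andbF // => /and3P[].
all: rewrite /dsrc /dtgt /= !inE disjoint_has /= !inE !K33_vert_eqE ?andbT ?orbF.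
- case/andP => /eqP<- /eqP<- jj ii; case: b4 => _; rewrite !K33_vert_eqE => h SE.
    by apply: (key i1 i3 i4 j2 j1 j4); [distinct3 | distinct3 | same_cells].
  by apply: (key i1 i3 i4 j2 j1 j4); [distinct3 | distinct3 | same_cells].
case/andP => /eqP<- /eqP<- ii jj; case: b4 => _; rewrite !K33_vert_eqE => h SE.
  by apply: (key i2 i1 i4 j1 j3 j4); [distinct3 | distinct3 | same_cells].
by apply: (key i2 i1 i4 j1 j3 j4); [distinct3 | distinct3 | same_cells].
Qed.

(** If both middle vertices were on the same side, the four end vertices would be distinct on the
    other side, which has only three; this is [no4]. So one path lies in a row and the other in a
    column. *)
Lemma paths22_relabels : two_disjoint_paths 2 2 S ->
  relabels (fun i j => (i, j) \in [:: (0, 0); (0, 1); (1, 2); (2, 2)]).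
Proof.
have key i0 i1 i2 j0 j1 j2 : uniq [:: i0; i1; i2] -> uniq [:: j0; j1; j2] ->
    S =i [:: (i0, j0); (i0, j1); (i1, j2); (i2, j2)] ->
    relabels (fun i j => (i, j) \in [:: (0, 0); (0, 1); (1, 2); (2, 2)]).
  move=> /ord3_eq[f fi [f0 f1 f2]] /ord3_eq[g gi [g0 g1 g2]] SE.
  by apply: (cells_relabels fi gi) => // c; rewrite SE /= !inordE f0 f1 f2 g0 g1 g2.
have no4 (a b c d : 'I_3) : uniq [:: a; b; c; d] -> False.
  move=> /card_uniqP u4; have := max_card (mem [:: a; b; c; d]).
  by rewrite u4 card_ord.
case=> [[|[c1 b1] [|[c2 b2] [|? ?]]]] [[|[c3 b3] [|[c4 b4] [|? ?]]]] [[] // p1 _ [] // p2 _ dis SE].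
case: c1 c2 c3 c4 p1 p2 dis SE => [i1 j1] [i2 j2] [i3 j3] [i4 j4].
case: b1; case: b2; rewrite /is_path /follows /dsrc /dtgt /= ?andbF // => /and3P[].
all: case: b3; case: b4; rewrite /dsrc /dtgt /= ?andbF //.
all: rewrite !inE disjoint_has /= !inE !K33_vert_eqE ?andbT ?orbF.
- by move=> _ n12 _ /andP[_ n34] h _; case: (no4 j1 j2 j3 j4); distinct3.
- move=> /eqP<- n12 _ /andP[/eqP<- n34] h SE.
  by apply: (key i1 i3 i4 j1 j2 j3); [distinct3 | distinct3 | same_cells].
- move=> /eqP<- n12 _ /andP[/eqP<- n34] h SE.
  by apply: (key i3 i1 i2 j3 j4 j1); [distinct3 | distinct3 | same_cells].
by move=> _ n12 _ /andP[_ n34] h _; case: (no4 i1 i2 i3 i4); distinct3.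
Qed.

End Relabel.

Section Relabelling.
Variables (m : nat) (q r : int) (l : edge K33 -> nat).
Hypotheses (mE : (m%:Z = 9 * q + r)%R) (r4 : (- 4 <= r <= 4)%R).
Hypotheses (sum_l : \sum_c l c = m) (bal : balanced l).

(* The number of chains exceeding the minimal length is the residue of m modulo 9. *)
Lemma balanced_chains :
  ((0 <= r)%R -> (forall c, ((l c)%:Z = q + (c \in chains_of_length l (q + 1))%:Z)%R) /\
     #|chains_of_length l (q + 1)%R| = `|r|%N) /\
  ((r < 0)%R -> (forall c, ((l c)%:Z = q - (c \in chains_of_length l (q - 1))%:Z)%R) /\
     #|chains_of_length l (q - 1)%R| = `|r|%N).
Proof.
pose o : edge K33 := (ord0, ord0).
have [c0 minc] : exists c0, forall c, l c0 <= l c.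
  by case: (arg_minnP l (isT : xpredT o)) => c0 _ H; exists c0 => c; apply: H.
have lE c : l c = l c0 + (l c != l c0).
  have := minc c; have := bal c c0; move: (l c) (l c0) => a b; clear; case: eqP; lia.
pose B := [set c | l c != l c0].
have sumE : 9 * l c0 + #|B| = m.
  rewrite -sum_l (eq_bigr _ (fun c _ => lE c)) big_split /= sum_nat_const card_prod !card_ord.
  by rewrite card_K33.
have BC : #|B| + #|~: B| = 9 by rewrite cardsC card_prod !card_ord.
have C0 : 0 < #|~: B| by apply/card_gt0P; exists c0; rewrite !inE eqxx.
split=> rs.
  have [q0 rB] : ((l c0)%:Z = q)%R /\ #|B| = `|r|%N.
    by move: sumE BC C0 mE; clear -rs r4; move: #|B| #|~: B| (l c0) => a b c; lia.
  have SB : chains_of_length l (q + 1)%R = B.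
    apply/setP => c; rewrite !inE lE -q0; case: (l c != l c0) => /=; lia.
  rewrite SB; split=> // c; rewrite inE -q0 {1}lE; case: (l c != l c0) => /=; lia.
have [q0 rB] : ((l c0)%:Z = q - 1)%R /\ #|~: B| = `|r|%N.
  by move: sumE BC C0 mE; clear -rs r4; move: #|B| #|~: B| (l c0) => a b c; lia.
have SB : chains_of_length l (q - 1)%R = ~: B.
  apply/setP => c; rewrite !inE lE -q0; case: (l c != l c0) => /=; lia.
rewrite SB; split=> // c; rewrite !inE {1}lE; case: (l c != l c0) => /=; lia.
Qed.

Lemma placement_relabelling : chain_placement q r l ->
  exists f g : 'I_3 -> 'I_3, [/\ injective f, injective g &
    forall i j, l (f i, g j) = opt_weight (Z_of_int q) (Z_of_int r) (i, j)].
Proof.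
case=> mpos mneg p31 p22; have [bpos bneg] := balanced_chains.
suff [s [S [P [lS [f [g [fi gi fgS]]] PE]]]] :
    exists (s : int) (S : {set edge K33}) (P : nat -> nat -> bool),
    [/\ forall c, ((l c)%:Z = q + s * (c \in S)%:Z)%R, relabels S P &
        forall i j, i < 3 -> j < 3 ->
          offset (Z_of_int r) i j = Z_of_int (s * (P i j)%:Z)%R].
  exists f, g; split=> // i j; rewrite /opt_weight /= PE // -fgS.
  by have := lS (f i, g j); case: (_ \in S); lia.
(* For [|r| <= 1] the theorem imposes no placement, but at most one edge always forms a matching, so
   these residues join the cases 2 and 3. *)
have small (S : {set edge K33}) : #|S| <= 1 -> matching S.
  by move=> /card_le1_eqP S1 e f eS fS; rewrite (S1 e f eS fS) eqxx.
have [r_ge0|r_lt0] : ((0 <= r) \/ (r < 0))%R by lia.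
  have [lS cS] := bpos r_ge0; exists 1%R, (chains_of_length l (q + 1)%R).
  have [r3|r_eq] : ((r <= 3) \/ (r = 4))%R by lia.
    exists (fun i j => (i == j) && (i < `|r|)); split.
    - by move=> c; rewrite mul1r.
    - rewrite -cS; apply: matching_relabels; last by rewrite cS; lia.
      have [r1|r1] : ((r <= 1) \/ (r = 2 \/ r = 3))%R by lia.
        by apply: small; rewrite cS; lia.
      exact: mpos.
    have : (r = 0 \/ r = 1 \/ r = 2 \/ r = 3)%R by lia.
    by case=> [->|[->|[->|->]]] [|[|[|i]]] [|[|[|j]]].
  exists (fun i j => (i, j) \in [:: (0, 0); (0, 1); (1, 0); (2, 2)]); split.
  - by move=> c; rewrite mul1r.
  - exact/paths31_relabels/p31.
  by rewrite r_eq => -[|[|[|i]]] [|[|[|j]]].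
have [lS cS] := bneg r_lt0; exists (- 1)%R, (chains_of_length l (q - 1)%R).
have [r3|r_eq] : ((- 3 <= r) \/ (r = - 4))%R by lia.
  exists (fun i j => (i == j) && (i < `|r|)); split.
  - by move=> c; rewrite mulN1r.
  - rewrite -cS; apply: matching_relabels; last by rewrite cS; lia.
    have [r1|r1] : ((- 1 <= r) \/ (r = - 2 \/ r = - 3))%R by lia.
      by apply: small; rewrite cS; lia.
    exact: mneg.
  have : (r = - 1 \/ r = - 2 \/ r = - 3)%R by lia.
  by case=> [->|[->|->]] [|[|[|i]]] [|[|[|j]]].
exists (fun i j => (i, j) \in [:: (0, 0); (0, 1); (1, 2); (2, 2)]); split.
- by move=> c; rewrite mulN1r.
- exact/paths22_relabels/p22.
by rewrite r_eq => -[|[|[|i]]] [|[|[|j]]].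
Qed.

End Relabelling.

Lemma K33_layout_sum1 H x : K33_layout (fun _ : edge H => 1) x -> \sum_c x c = #|edge H|.
Proof.
case=> v [w [_ wE wx]]; rewrite -sum1_card -(eq_bigr _ (fun g _ => wE g)) exchange_big /=.
apply: eq_bigr => c _; rewrite wx sum1_size; elim: (w c) => [|d s IHs] /=; first by rewrite big1.
by rewrite big_split /= -IHs (bigD1 d.1) //= eqxx big1 // => g /negPf; rewrite eq_sym => ->.
Qed.

Lemma iso_refl G : iso G G.
Proof. by exists id, id; split=> [||e]; [exists id | exists id | rewrite imset_id]. Qed.

(** Settles [n = 1], where the total 4 is below the range in which the optimal lengths are
    unique. *)
Lemma iso_single_vertex G H : #|vert G| = 1 -> #|vert H| = 1 -> #|edge G| = #|edge H| -> iso G H.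
Proof.
have bij (A B : finType) (AB : #|A| = #|B|) : exists h : A -> B, bijective h.
  exists (fun a => enum_val (cast_ord AB (enum_rank a))).
  by apply: bij_card => // a a' /enum_val_inj/cast_ord_inj/enum_rank_inj.
move=> G1 H1 E; have [f bf] := bij _ _ (etrans G1 (esym H1)); have [g bg] := bij _ _ E.
exists f, g; split=> // e; apply/setP => y.
have all z : z = y by have /card_le1_eqP := eq_leq H1; apply.
rewrite (_ : y \in ends _); last by rewrite inE (all (src _)) inE eqxx.
by apply/esym/imsetP; exists (src e); rewrite ?[f _]all // !inE eqxx.
Qed.

Section Optimality.
Variables (n m : nat) (q r : int).
Hypotheses (n_ge1 : 1 <= n) (m_def : m = n + 3).
Hypotheses (m_div : (m%:Z = 9 * q + r)%R) (r_range : (- 4 <= r <= 4)%R).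
Let w := opt_weight (Z_of_int q) (Z_of_int r).
Let G := weak_subdivision w.

Let m4 : 4 <= m. Proof. by rewrite m_def addn3. Qed.
Let r1 : Z.le (-4) (Z_of_int r). Proof. by clear -r_range; lia. Qed.
Let r2 : Z.le (Z_of_int r) 4. Proof. by clear -r_range; lia. Qed.
Let V6 : #|vert K33| = 6. Proof. by rewrite card_sum !card_ord. Qed.
Let E9 : #|edge K33| = #|vert K33| + 3. Proof. by rewrite V6 card_prod !card_ord. Qed.
Let V0 : 0 < #|vert K33|. Proof. by rewrite V6. Qed.

Let wcount_w k : k <= 4 -> wcount (G := K33) w k = best k m.
Proof. exact: (wcount_opt_weight m4 (nat_intZ m_div) r1 r2). Qed.

Let tree : 0 < wcount (G := K33) w 4.
Proof.
by rewrite wcount_w //; apply: leq_ltn_trans (best4_strict m4 (leq_trans (isT : 0 < 4) m4)).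
Qed.

Let sum_w : \sum_c w c = m.
Proof. exact: (sum_opt_weight m4 (nat_intZ m_div) r1 r2). Qed.

Lemma best_le_opt_subdivision k : k <= 4 -> best k m <= wcount (fun _ : edge G => 1) k.
Proof. by move=> k4; rewrite -wcount_w //; apply: wcount_wsub_ge. Qed.

Lemma opt_subdivision_class : graph_class n m G.
Proof.
split; last first.
- have := leq_trans tree (wcount_wsub_ge w 4 V0).
  by case/wcount_gt0P => S [_ cS _]; apply: connected_sub cS; apply: subsetT.
- by rewrite card_wsub_edge sum_w.
by have := card_wsub V0 E9 tree; rewrite sum_w m_def => /eqP; rewrite eqn_add2r => /eqP.
Qed.

Lemma layout_opt_iso H x (f g : 'I_3 -> 'I_3) : graph_class n m H ->
  K33_layout (fun _ : edge H => 1) x -> injective f -> injective g ->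
  (forall i j, x (f i, g j) = w (i, j)) -> iso H G.
Proof.
move=> [VH EH cH] lay fi gi xE; apply: iso_sym; apply: K33_layout_iso => //.
- have -> : w = fun c => x (f c.1, g c.2) by apply/funext => -[i j]; rewrite xE.
  exact: K33_layout_perm fi gi lay.
- by rewrite EH (leq_trans _ m4).
by have [-> _ _] := opt_subdivision_class.
Qed.

Lemma graph_class_best H : graph_class n m H ->
  (forall k, k <= 4 -> wcount (fun _ : edge H => 1) k <= best k m) /\
  (~ iso H G -> wcount (fun _ : edge H => 1) 4 < best 4 m).
Proof.
move=> cls; have [VH EH cH] := cls.
have [||//|le eq _] := @connected_structured H (fun=> 1) cH; rewrite ?VH ?EH //.
rewrite sum1_card EH in le eq; split=> // niso.
rewrite ltn_neqAle le // andbT; apply/eqP => opt; apply: niso.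
have [n1|n2] := eqVneq n 1.
  have [VG EG _] := opt_subdivision_class.
  by apply: iso_single_vertex; rewrite ?VH ?VG ?EH ?EG ?n1.
have [x [lay wx]] := eq opt; have sx := K33_layout_sum1 lay; rewrite EH in sx.
have [] := @K33_best_unique x (Z_of_int q) (Z_of_int r); rewrite ?sx //.
- by rewrite m_def addn3; move: n_ge1 n2; clear; case: n => [|[|k]].
- exact: nat_intZ.
- by rewrite -wx.
move=> f [g [fi gi xE]]; apply: (layout_opt_iso cls lay fi gi) => i j.
by apply: Nat2Z.inj; rewrite xE (opt_weightE m4 (nat_intZ m_div) r1 r2).
Qed.

(** The chains of a weak subdivision are a layout with lengths [l]. Once relabelled to the optimal
    lengths, it is identified in the same way as the layout of an optimal graph. *)
Lemma placement_iso H l : graph_class n m H -> balanced l ->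
  iso H (weak_subdivision l) -> chain_placement q r l -> iso H G.
Proof.
move=> cls bal isoH place; apply: (iso_trans isoH).
have clsW := iso_graph_class isoH cls; have [VW EW cW] := clsW.
rewrite card_wsub_edge in EW.
have [f [g [fi gi lE]]] := placement_relabelling m_div r_range EW bal place.
exact: (layout_opt_iso clsW (wsub_layout l) fi gi lE).
Qed.

End Optimality.

Theorem theorem9p7 (R : realType) (n m : nat) (q r : int)
    (n_ge1 : 1 <= n) (m_def : m = n + 3)
    (m_div : (m%:Z = 9 * q + r)%R) (r_range : (- 4 <= r <= 4)%R) :
  exists G : mgraph,
    [/\ uniquely_optimal R n m G,
        uniquely_max_spanning_trees n m G,
        exists l : edge K33 -> nat,
          [/\ admissible l, balanced l, iso G (weak_subdivision l),
              6 <= n -> forall e, 0 < l e &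
              chain_counts q r l /\ chain_placement q r l] &
        forall H : mgraph, graph_class n m H ->
          (exists l : edge K33 -> nat,
             [/\ admissible l, balanced l, iso H (weak_subdivision l) &
                 chain_placement q r l]) ->
          iso H G].
Proof.
pose w := opt_weight (Z_of_int q) (Z_of_int r); exists (weak_subdivision w).
have m4 : 4 <= m by rewrite m_def addn3.
have mZ := nat_intZ m_div.
have r1 : Z.le (-4) (Z_of_int r) by clear -r_range; lia.
have r2 : Z.le (Z_of_int r) 4 by clear -r_range; lia.
have cls := opt_subdivision_class n_ge1 m_def m_div r_range.
have lower := best_le_opt_subdivision n_ge1 m_def m_div r_range.
have upper H := @graph_class_best n m q r n_ge1 m_def m_div r_range H.
have corank H : graph_class n m H -> 0 < #|vert H| /\ #|edge H| = #|vert H| + 3.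
  by case=> -> -> _.
have [Vw Ew] := corank _ cls.
split.
- split=> // H clsH niso p /andP[p0 p1]; have [VH EH] := corank _ clsH.
  have [le /(_ niso) lt] := upper H clsH.
  have [_ mH _] := clsH; have [_ mG _] := cls.
  (* The summand for 4 deleted edges is split off: it is compared strictly, the others weakly. *)
  rewrite !reliability_wcount // mH mG big_ord_recr [X in (_ < X)%R]big_ord_recr /=.
  have t_gt0 k : (0 < p ^+ (m - k) * (1 - p) ^+ k)%R.
    by rewrite mulr_gt0 ?exprn_gt0 // subr_gt0.
  apply: ler_ltD; last by rewrite ltr_pM2r // ltr_nat (leq_trans lt) // lower.
  apply: ler_sum => k _; rewrite ler_pM2r // ler_nat.
  have k4 := ltnW (ltn_ord k); exact: leq_trans (le k k4) (lower k k4).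
- split=> // H clsH niso; have [VH EH] := corank _ clsH.
  rewrite !num_spanning_trees_wcount //; have [_ /(_ niso) lt] := upper H clsH.
  exact: leq_trans lt (lower 4 isT).
- exists w; split.
  + apply: admissible_tree; rewrite ?card_sum ?card_prod ?card_ord //.
    rewrite (wcount_opt_weight m4 mZ r1 r2) //.
    exact: leq_ltn_trans (best4_strict m4 (leq_trans (isT : 0 < 4) m4)).
  + exact: (opt_weight_balanced m4 mZ r1 r2).
  + exact: iso_refl.
  + by move=> n6 e; apply: (opt_weight_gt0 m4 mZ r1 r2); rewrite m_def; lia.
  split; [exact: opt_weight_chain_counts m4 m_div r_range | exact: opt_weight_placement m4 m_div r_range].
by move=> H clsH [l [_ bal isoH place]];
  exact: (placement_iso n_ge1 m_def m_div r_range clsH bal isoH place).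
Qed.
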